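(* Let $p,q\in(0,\infty]$, let either $m\in\mathbb{N}$ be fixed or $m=m(n)\to\infty$ as $n\to\infty$, and for each $n$ let $X=(X_{i,j})_{i\le m,j\le n}$ be uniformly distributed on $\mathbb{B}_{p,q}^{m,n}$. Let $k,l\in\mathbb{N}$ (with $k\le m$ if $m$ is fixed), and let $(\eta_{i,j})_{i\le k,j\le l}$ be an array of independent $q$-Gaussian random variables. (a) As $n\to\infty$, $$(m^{1/p}n^{1/q}X_{i,j})_{i\le k,j\le l}\longrightarrow(\eta_{i,j})_{i\le k,j\le l}\quad\text{in distribution}.$$ (b) As $n\to\infty$, the empirical measure satisfies $$\frac{1}{mn}\sum_{i=1}^m\sum_{j=1}^n\delta_{m^{1/p}n^{1/q}X_{i,j}}\longrightarrow\mathcal{L}(\eta_{1,1})$$ in probability, understood as convergence in probability in the space of probability measures on $\mathbb{R}$ endowed with the Lévy–Prokhorov metric.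
   Context: For $p\in(0,\infty]$, $\lVert x\rVert_p=(\sum_{i}|x_i|^p)^{1/p}$ if $p<\infty$ and $\lVert x\rVert_\infty=\max_i|x_i|$. For $x\in\mathbb{R}^{m\times n}$, $\lVert x\rVert_{p,q}:=\bigl\lVert\bigl(\lVert(x_{i,j})_{j\le n}\rVert_q\bigr)_{i\le m}\bigr\rVert_p$ and $\mathbb{B}_{p,q}^{m,n}:=\{x\in\mathbb{R}^{m\times n}:\lVert x\rVert_{p,q}\le1\}$. The $q$-Gaussian distribution has Lebesgue density $\frac{1}{2q^{1/q}\Gamma(1/q+1)}e^{-|x|^q/q}$ on $\mathbb{R}$ if $q<\infty$, and $\frac12\mathbf{1}_{[-1,1]}(x)$ if $q=\infty$. Convention: $1/\infty:=0$. $\mathcal{L}(Y)$ is the law of $Y$; $\delta_x$ is the Dirac measure at $x$. In (a), $n$ is large enough that $k\le m$ and $l\le n$. *)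

(* Defs.v *)
(* MathComp-Analysis *)
From HB Require Import structures.
From mathcomp Require Import all_boot all_order all_algebra.
From mathcomp Require Import all_classical all_reals all_analysis.

Set Implicit Arguments.
Unset Strict Implicit.
Unset Printing Implicit Defensive.

Import Order.TTheory GRing.Theory Num.Theory.
Import numFieldNormedType.Exports.

Local Open Scope classical_set_scope.
Local Open Scope ring_scope.

(* The library's conventions +oo^-1 = 0 and fine 0 = 0 make [fine p^-1] the
   real number 1/p for p in (0, +oo], with 1/oo = 0. *)
Notation "1/[ p ]" := (fine (p%E^-1)%E)
  (at level 2, p at level 200, format "1/[ p ]") : ring_scope.

Section mixed_norm.
Context {R : realType}.

(* Only exponents in (0, +oo] are meaningful; the value at -oo is junk. *)
Definition lp_norm (p : \bar R) (n : nat) (x : 'I_n -> R) : R :=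
  match p with
  | r%:E => (\sum_(i < n) `|x i| `^ r) `^ r^-1
  | +oo%E => \big[Num.max/0]_(i < n) `|x i|
  | -oo%E => 0
  end.

Definition mixed_norm (p q : \bar R) (m n : nat) (x : 'M[R]_(m, n)) : R :=
  lp_norm p (fun i => lp_norm q (fun j => x i j)).

Definition mixed_ball (p q : \bar R) (m n : nat) : set 'M[R]_(m, n) :=
  [set x | mixed_norm p q x <= 1].

End mixed_norm.

(* 'M[T]_(m, n) carries the product sigma-algebra, i.e. the one generated by
   the coordinate maps. *)
Definition measure_matrix_display : measure_display -> measure_display.
Proof. exact. Qed.

Section measurable_matrix.
Context {d} {T : sigmaRingType d} (m n : nat).

Definition matrix_cylinders : set (set 'M[T]_(m, n)) :=
  [set A | exists i j, exists2 B : set T,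
    measurable B & A = (fun x : 'M[T]_(m, n) => x i j) @^-1` B].

Let matrix_set0 : <<s matrix_cylinders >> set0.
Proof. exact: sigma_algebra0. Qed.

Let matrix_setC A : <<s matrix_cylinders >> A -> <<s matrix_cylinders >> (~` A).
Proof. exact: sigma_algebraC. Qed.

Let matrix_bigcup (F : (set 'M[T]_(m, n))^nat) :
  (forall i, <<s matrix_cylinders >> (F i)) ->
  <<s matrix_cylinders >> (\bigcup_i (F i)).
Proof. exact: sigma_algebra_bigcup. Qed.

HB.instance Definition _ := @isMeasurable.Build (measure_matrix_display d)
  'M[T]_(m, n) <<s matrix_cylinders >> matrix_set0 matrix_setC matrix_bigcup.

End measurable_matrix.

Section lebesgue_matrix.
Context {R : realType}.

Fixpoint lebesgue_tuple (n : nat) : set (n.-tuple R) -> \bar R :=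
  match n with
  | 0 => dirac [tuple]
  | n'.+1 => pushforward (@lebesgue_measure R \x @lebesgue_tuple n')%E
               (fun xt : measurableTypeR R * n'.-tuple R =>
                  [tuple of xt.1 :: xt.2] : n'.+1.-tuple R)
  end.

Definition lebesgue_matrix (m n : nat) : set 'M[R]_(m, n) -> \bar R :=
  pushforward (@lebesgue_tuple (m * n))
    (fun t => \matrix_(i, j) tnth t (mxvec_index i j)).

End lebesgue_matrix.

(* lebesgue_tuple and lebesgue_matrix are measures, with the expected value on
   boxes (this characterizes the Lebesgue measure). *)
Section cons_measure.
Context {R : realType} (n : nat).
Variable mu : {sigma_finite_measure set (n.-tuple R) -> \bar R}.

Let c (xt : measurableTypeR R * n.-tuple R) : n.+1.-tuple R :=
  [tuple of xt.1 :: xt.2].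

Let mc : measurable_fun [set: measurableTypeR R * n.-tuple R] c.
Proof. by apply: measurable_cons. Qed.

Definition cons_measure : set (n.+1.-tuple R) -> \bar R :=
  pushforward (@lebesgue_measure R \x mu)%E c.

Let cons0 : cons_measure set0 = 0%E.
Proof. by rewrite /cons_measure /pushforward preimage_set0 measure0. Qed.

Let cons_ge0 A : (0 <= cons_measure A)%E.
Proof. exact: measure_ge0. Qed.

Let cons_sigma_additive : semi_sigma_additive cons_measure.
Proof.
exact: (@measure_semi_sigma_additive _ _ _ (measure_function_pushforward__canonical__measure_function_Measure (lebesgue_measure \x mu)%E mc)).
Qed.

HB.instance Definition _ := isMeasure.Build _ _ _ cons_measure
  cons0 cons_ge0 cons_sigma_additive.

Let cons_sigma_finite : sigma_finite setT cons_measure.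
Proof.
have /sigma_finiteP[F [TF ndF Foo]] := sigma_finiteT (@lebesgue_measure R).
have /sigma_finiteP[G [TG ndG Goo]] := sigma_finiteT mu.
pose u (t : n.+1.-tuple R) : measurableTypeR R * n.-tuple R :=
  (thead t, [tuple of behead t]).
have cu t : u (c t) = t.
  by case: t => x t; rewrite /u /c/= theadE; congr pair; exact: val_inj.
have mu1 : measurable_fun setT u.
  apply/measurable_fun_pairP; split => /=; last exact: measurable_behead.
  exact: (@measurable_tnth _ R).
exists (fun i => u @^-1` (F i `*` G i)).
  rewrite -preimage_bigcup -(preimage_setT u); congr (u @^-1` _).
  apply/seteqP; split => // -[x y] _.
  have [i _ Fix] : (\bigcup_i F i) x by rewrite -TF.
  have [j _ Gjy] : (\bigcup_i G i) y by rewrite -TG.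
  exists (maxn i j) => //; split.
    by move: x Fix; exact/subsetPset/ndF/leq_maxl.
  by move: y Gjy; exact/subsetPset/ndG/leq_maxr.
move=> i; have [mF Fi] := Foo i; have [mG Gi] := Goo i; split.
  rewrite -[X in measurable X]setTI; apply: mu1 => //.
  exact: measurableX.
rewrite /cons_measure /pushforward -comp_preimage (_ : u \o c = id).
  by rewrite preimage_id product_measure1E// lte_mul_pinfty// ge0_fin_numE.
by apply/funext => t; rewrite /= cu.
Qed.

HB.instance Definition _ := Measure_isSigmaFinite.Build _ _ _ cons_measure
  cons_sigma_finite.

End cons_measure.

Section lebesgue_matrix_theory.
Context {R : realType}.

Lemma lebesgue_tuple_measure (n : nat) :
  {mu : {sigma_finite_measure set (n.-tuple R) -> \bar R} |
    mu = @lebesgue_tuple R n :> (set (n.-tuple R) -> \bar R)}.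
Proof.
elim: n => [|n [mu muE]].
  by exists (dirac ([tuple] : 0.-tuple R)).
exists (cons_measure mu).
by rewrite /= -muE.
Qed.

Lemma lebesgue_tuple_box n (A : 'I_n -> set R) : (forall i, measurable (A i)) ->
  lebesgue_tuple [set t : n.-tuple R | forall i, A i (tnth t i)] =
  (\prod_(i < n) lebesgue_measure (A i))%E.
Proof.
elim: n A => [|n IH] A mA.
  rewrite big_ord0 /= diracE mem_set//. by case.
have [mu muE] := lebesgue_tuple_measure n.
rewrite big_ord_recl /= /pushforward -muE.
pose B := [set t : n.-tuple R | forall i, A (lift ord0 i) (tnth t i)].
have mB : measurable B.
  rewrite (_ : B = \bigcap_(i in [set: 'I_n]) (@tnth _ R ^~ i) @^-1` A (lift ord0 i)).
    apply: fin_bigcap_measurable => [|i _]; first exact: finite_finset.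
    rewrite -[X in measurable X]setTI.
    exact: (measurable_tnth (T := R)).
  by apply/seteqP; split=> [t Bt i _|t Bt i]; [exact: Bt|exact: Bt].
rewrite (_ : _ @^-1` _ = A ord0 `*` B).
  apply: etrans (@product_measure1E _ _ (measurableTypeR R) _ R (@lebesgue_measure R) mu _ _ (mA ord0) mB) _.
  congr (_ * _)%E.
  by apply: etrans (congr1 (@^~ B) muE) _; exact: IH.
apply/seteqP; split=> -[x t] /=.
  by move=> h; split=> [|i]; [have := h ord0|have := h (lift ord0 i); rewrite tnthS].
by move=> [h1 h2] i; case: (unliftP ord0 i) => [j ->|->//]; rewrite tnthS.
Qed.

Lemma lebesgue_matrix_measure (m n : nat) :
  {mu : {measure set 'M[R]_(m, n) -> \bar R} |
    mu = @lebesgue_matrix R m n :> (set 'M[R]_(m, n) -> \bar R)}.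
Proof.
have [mu muE] := lebesgue_tuple_measure (m * n).
pose h (t : (m * n).-tuple R) : 'M[R]_(m, n) :=
  \matrix_(i, j) tnth t (mxvec_index i j).
have mh : measurable_fun setT h.
  apply: (@measurability _ _ _ _ _ _ (@matrix_cylinders _ R m n)) => //.
  move=> _ [_ [i [j [B mB ->]]] <-].
  rewrite setTI (_ : _ @^-1` _ = (@tnth _ R ^~ (mxvec_index i j)) @^-1` B).
    rewrite -[X in measurable X]setTI.
    exact: (measurable_tnth (T := R)).
  by apply/seteqP; split => t; rewrite /h /= mxE.
exists (measure_function_pushforward__canonical__measure_function_Measure mu mh).
by rewrite /lebesgue_matrix -muE.
Qed.

Lemma lebesgue_matrix_box m n (A : 'I_m -> 'I_n -> set R) : (forall i j, measurable (A i j)) ->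
  lebesgue_matrix [set x : 'M[R]_(m, n) | forall i j, A i j (x i j)] =
  (\prod_(i < m) \prod_(j < n) lebesgue_measure (A i j))%E.
Proof.
move=> mA; have [f fK gK] := curry_mxvec_bij m n.
rewrite pair_bigA /= (reindex f) /=; last first.
  exists (uncurry (@mxvec_index m n)) => ? _; [exact: gK|exact: fK].
rewrite -lebesgue_tuple_box; last by move=> i; exact: mA.
rewrite /lebesgue_matrix /pushforward; congr lebesgue_tuple.
apply/seteqP; split=> t /= h => [k|i j].
  have := h (f k).1 (f k).2; rewrite mxE.
  by have := gK k; case: (f k) => a b /= ->.
rewrite mxE; have := h (mxvec_index i j).
by have := fK (i, j) => /= ->.
Qed.
End lebesgue_matrix_theory.

Section random_variables.
Context {R : realType}.

Definition uniform_on (m n : nat) d (T : measurableType d)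
    (P : probability T R) (X : {RV P >-> 'M[R]_(m, n)})
    (B : set 'M[R]_(m, n)) : Prop :=
  forall A : set 'M[R]_(m, n), measurable A ->
    distribution P X A = (lebesgue_matrix (A `&` B) / lebesgue_matrix B)%E.

Definition Gamma (s : R) : R :=
  \int[lebesgue_measure]_(t in `]0, +oo[) (t `^ (s - 1) * expR (- t)).

(* The value at q = -oo is junk. *)
Definition q_gaussian_density (q : \bar R) (x : R) : R :=
  match q with
  | r%:E => (2 * r `^ r^-1 * Gamma (r^-1 + 1))^-1 * expR (- (`|x| `^ r / r))
  | +oo%E => 2^-1 * \1_(`[-1, 1] : set R) x
  | -oo%E => 0
  end.

Definition q_gaussian (q : \bar R) d (T : measurableType d)
    (P : probability T R) (Y : {RV P >-> R}) : Prop :=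
  forall A : set R, measurable A ->
    distribution P Y A =
    (\int[lebesgue_measure]_(x in A) (q_gaussian_density q x)%:E)%E.

Definition mutually_independent (I : finType) d (T : measurableType d)
    (P : probability T R) (Y : I -> {RV P >-> R}) : Prop :=
  forall (J : {set I}) (A : I -> set R), (forall i, measurable (A i)) ->
    P (\bigcap_(i in [set` J]) Y i @^-1` A i) =
    (\prod_(i in J) P (Y i @^-1` A i))%E.

End random_variables.

Section modes_of_convergence.
Context {R : realType}.

(* The Y n may be defined on different probability spaces. *)
Definition cvg_in_distribution (E : topologicalType)
    (d : nat -> measure_display) (T : forall n, measurableType (d n))
    (P : forall n, probability (T n) R) (Y : forall n, T n -> E)
    d' (T' : measurableType d') (P' : probability T' R) (Z : T' -> E) : Prop :=
  forall f : E -> R, continuous f -> (exists M, forall x, `|f x| <= M) ->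
    ('E_(P n)[f \o Y n])%E @[n --> \oo] --> ('E_P'[f \o Z])%E.

Definition thickening (A : set R) (e : R) : set R := \bigcup_(a in A) ball a e.

Definition levy_prokhorov (mu nu : set R -> \bar R) : \bar R :=
  ereal_inf [set e%:E | e in [set e : R | 0 < e /\
    forall A : set R, measurable A ->
      (mu A <= nu (thickening A e) + e%:E)%E /\
      (nu A <= mu (thickening A e) + e%:E)%E]].

(* The mu n are random measures, possibly on different probability spaces. *)
Definition cvg_in_probability_LP
    (d : nat -> measure_display) (T : forall n, measurableType (d n))
    (P : forall n, probability (T n) R) (mu : forall n, T n -> set R -> \bar R)
    (nu : set R -> \bar R) : Prop :=
  forall e : R, 0 < e ->
    P n [set w | (e%:E < levy_prokhorov (mu n w) nu)%E] @[n --> \oo] --> 0%E.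

End modes_of_convergence.

Section entries.
Context {R : realType}.

(* The upper left k x l block of x, padded with zeros when k <= m or l <= n
   fails. *)
Definition corner (k l m n : nat) (x : 'M[R]_(m, n)) : 'M[R]_(k, l) :=
  \matrix_(i, j) match insub (val i), insub (val j) with
                 | Some i', Some j' => x i' j'
                 | _, _ => 0
                 end.

Definition empirical_measure (m n : nat) (x : 'M[R]_(m, n)) (A : set R) :
    \bar R :=
  (((m * n)%:R^-1)%:E * \sum_(i < m) \sum_(j < n) \d_(x i j) A)%E.

End entries.

(* Main.v *)
Require Import Defs.
From HB Require Import structures.
From mathcomp Require Import all_boot all_order all_algebra.
From mathcomp Require Import all_classical all_reals all_analysis.
From mathcomp Require Import measurable_realfun ring lra.
Import Order.TTheory GRing.Theory Num.Theory.
Import numFieldNormedType.Exports.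
Local Open Scope classical_set_scope.
Local Open Scope ring_scope.

Set Implicit Arguments.
Unset Strict Implicit.
Unset Printing Implicit Defensive.

(* Let N_i(x) be the l^q norm of the i-th row of x.  Take X uniform on the ball
   and Y an independent matrix of i.i.d. q-Gaussian entries.  Both densities
   depend only on the row norms, so the matrix with rows N_i(X)/N_i(Y) Y_i has
   the law of X.  Scaling one row turns the homogeneity of Lebesgue measure into
   exact formulas for the moments of N_i^p under the ball and of N_i^q under the
   Gaussian law; by Chebyshev, m^(1/p) N_i(X) and N_i(Y)/n^(1/q) are close to 1
   uniformly in m and i.  Hence each entry of the rescaled X is a factor close
   to 1 times the corresponding entry of Y.  Part (a) follows because the corner
   of Y has the law of eta, part (b) from Markov's inequality for the proportion
   of entries moved by more than a given distance, and from Chebyshev's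
   inequality for the number of entries of Y in each cell of a finite partition. *)

(** * Measurability and Lebesgue measure on matrices *)

(** The usual representation of the uniform law on a ball by normalised independent variables rests
    on polar coordinates and a surface measure. The exchange of row norms avoids both: three linear
    substitutions in a double integral show that the exchanged law is a constant times Lebesgue
    measure on the ball, and total mass fixes the constant. The volume of the ball is never computed
    either; that a uniform law exists makes it finite and positive. Exponents below 1 cause no
    trouble, because the norms enter only through homogeneity and through dominating each entry. For
    infinite exponents the moment formulas are replaced by a stretching argument: lengthening a
    short row by the factor 1/(1-e) stays inside the cube and changes volume by (1-e)^-n. None of
    the bounds on row norms involves m, so a fixed m and any m tending to infinity are treated at
    once. In (a) the test function is merely continuous while Y is unbounded, so the multiplicative
    closeness of X to Y has to be combined with a modulus of continuity that depends on the
    point. *)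

Section matrix_measurable.
Context {R : realType} (m n : nat).
Implicit Types (A : 'I_m -> 'I_n -> set R).

Lemma measurable_coord i j :
  measurable_fun setT (fun x : 'M[R]_(m, n) => x i j : R).
Proof.
move=> _ B mB; rewrite setTI; apply: sub_sigma_algebra.
by exists i, j, B.
Qed.

Lemma measurable_fun_mx d (T : measurableType d) (f : T -> 'M[R]_(m, n)) :
  (forall i j, measurable_fun setT (fun t => f t i j)) -> measurable_fun setT f.
Proof.
move=> mf; apply: (@measurability _ _ _ _ _ _ (@matrix_cylinders _ R m n)) => //.
move=> _ [_ [i [j [B mB ->]]] <-].
exact: mf.
Qed.

Definition mbox A := [set x : 'M[R]_(m, n) | forall i j, A i j (x i j)].

Lemma measurable_mbox A :
  (forall i j, measurable (A i j)) -> measurable (mbox A).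
Proof.
move=> mA.
rewrite (_ : mbox A = \bigcap_(ij in [set: 'I_m * 'I_n])
    (fun x : 'M[R]_(m, n) => x ij.1 ij.2) @^-1` A ij.1 ij.2).
  apply: fin_bigcap_measurable => [|[i j] _]; first exact: finite_finset.
  by rewrite -[X in measurable X]setTI; exact: measurable_coord.
by apply/seteqP; split=> [x Ax [i j] _|x Ax i j]; [exact: Ax|exact: (Ax (i, j))].
Qed.

(** The sigma-algebra comes from the coordinates, while continuous test functions refer to the
    topology. Boxes with rational centres and common radius [1/(N+1)] form a countable base that
    reconciles the two. *)
Lemma open_measurable_mx (U : set 'M[R]_(m, n)) : open U -> measurable U.
Proof.
move=> oU.
pose bx (z : 'M[rat]_(m, n) * nat) :=
  mbox (fun i j => ball (ratr (z.1 i j) : R) z.2.+1%:R^-1).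
have -> : U = \bigcup_(z in [set: 'M[rat]_(m, n) * nat])
    (if `[< bx z `<=` U >] then bx z else set0).
  apply/seteqP; split=> [x Ux|x [z _]]; last first.
    by case: asboolP => // bU /bU.
  have /nbhs_ballP[e /= e0 xeU] : nbhs x U by exact: open_nbhs_nbhs.
  have e20 : 0 < e / 2 by exact: divr_gt0.
  have [N _ /(_ N (leqnn N)) HN] := near_infty_natSinv_lt (PosNum e20).
  have N0 : 0 < N.+1%:R^-1 :> R by rewrite invr_gt0.
  have qP i j : {qq : rat | ball (ratr qq : R) N.+1%:R^-1 (x i j)}.
    apply: cid.
    have [r [] + [qq _ qr]] := @dense_rat R (ball (x i j) N.+1%:R^-1)
      (ex_intro _ (x i j) (ballxx _ N0))
      (ball_open _ _).
    by rewrite -qr => ?; exists qq; exact: ball_sym.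
  exists (\matrix_(i, j) sval (qP i j), N) => //.
  have bxU : bx (\matrix_(i, j) sval (qP i j), N) `<=` U.
    move=> y /= yb; apply: xeU; split => // i j.
    rewrite [e]splitr; apply: (@ball_triangle _ _ (ratr (sval (qP i j)) : R)).
      by apply: ball_sym; apply: le_ball (svalP (qP i j)); exact: ltW.
    by have := yb i j; rewrite mxE; apply: le_ball; exact: ltW.
  rewrite asboolT// => i j /=; rewrite mxE; exact: svalP (qP i j).
apply: countable_bigcupT_measurable => [|z]; first exact: countableP.
case: ifP => // _; apply: measurable_mbox => i j.
by rewrite ball_itv; exact: measurable_itv.
Qed.

End matrix_measurable.

Section matrix_unique.
Context {R : realType} (m n : nat).

Lemma matrix_cylinder_mbox i j (B : set R) :
  (fun x : 'M[R]_(m, n) => x i j) @^-1` B =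
  mbox (fun i' j' => if (i' == i) && (j' == j) then B else setT).
Proof.
apply/seteqP; split=> [x Bx i' j'|x /(_ i j)]; last by rewrite !eqxx.
by case: ifPn => // /andP[/eqP -> /eqP ->].
Qed.

(** Boxes of finite volume exhausting the space: they serve both the uniqueness of measures and the
    sigma-finiteness of Lebesgue measure. *)
Definition mcube (k : nat) : set 'M[R]_(m, n) :=
  mbox (fun _ _ => `]- k%:R, k%:R[%classic).

Lemma mcubeT : \bigcup_k (mcube k) = setT.
Proof.
apply/seteqP; split=> // x _.
pose M := \big[Num.max/0]_(ij : 'I_m * 'I_n) `|x ij.1 ij.2|.
exists (Num.truncn M).+1 => // i j.
rewrite /= in_itv /= -ltr_norml; apply: le_lt_trans (truncnS_gt M).
exact: (le_bigmax _ (fun ij : 'I_m * 'I_n => `|x ij.1 ij.2|) (i, j)).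
Qed.

(** Boxes are stable under intersection and generate the sigma-algebra, and the cubes provide the
    exhaustion by sets of finite measure. *)
Lemma measure_mx_unique (m1 m2 : {measure set 'M[R]_(m, n) -> \bar R}) :
  (forall A : 'I_m -> 'I_n -> set R, (forall i j, measurable (A i j)) ->
    m1 (mbox A) = m2 (mbox A)) ->
  (forall k : nat, (m1 (mcube k) < +oo)%E) ->
  forall B, measurable B -> m1 B = m2 B.
Proof.
move=> m12 m1oo B mB.
pose G := [set mbox A | A in
  [set A : 'I_m -> 'I_n -> set R | forall i j, measurable (A i j)]].
apply: (measure_unique G mcube) => //.
- apply/seteqP; split; last first.
    apply: smallest_sub; first exact: sigma_algebra_measurable.
    by move=> _ [A mA <-]; exact: measurable_mbox.
  apply: sub_sigma_algebra2 => _ [i [j [C mC ->]]].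
  rewrite matrix_cylinder_mbox; eexists; last reflexivity.
  by move=> i' j' /=; case: ifP.
- move=> _ _ [A1 mA1 <-] [A2 mA2 <-].
  exists (fun i j => A1 i j `&` A2 i j); first by move=> i j; exact: measurableI.
  apply/seteqP; split=> [x A12|x [A1x A2x] i j]; last by split; [exact: A1x|exact: A2x].
  by split=> i j; have [] := A12 i j.
- by move=> k /=; eexists; last reflexivity.
- exact: mcubeT.
- by move=> _ [A mA <-]; exact: m12.
Qed.

End matrix_unique.

(** * Scaling of Lebesgue measure *)

Section lebesgue_scaling.
Context {R : realType}.
Notation leb := (@lebesgue_measure R).

(** The uniqueness of Lebesgue measure, applied to [c] times the image measure, reduces the claim to
    half-open intervals. *)
Lemma lebesgue_measure_scale (c : R) (A : set R) : 0 < c -> measurable A ->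
  leb ((fun x => c * x) @^-1` A) = ((c^-1)%:E * leb A)%E.
Proof.
move=> c0 mA.
have mc : measurable_fun [set: measurableTypeR R]
    (fun x : R => c * x : measurableTypeR R).
  by apply: measurable_funM => //.
pose pf : {measure set (measurableTypeR R) -> \bar R} :=
  measure_function_pushforward__canonical__measure_function_Measure leb mc.
have -> : leb A = (c%:E * leb ((fun x => (c * x)%R) @^-1` A))%E.
  apply: (@lebesgue_measure_unique R (mscale (NngNum (ltW c0)) pf)) => //.
  move=> _ [[a b]] _ <-.
  transitivity (c%:E * leb ((fun x => (c * x)%R) @^-1` `]a, b]%classic))%E; last by [].
  have -> : (fun x : R => c * x) @^-1` `]a, b] = `]a / c, b / c]%classic.
    apply/seteqP; split=> x /=.
      by rewrite !in_itv /= ltr_pdivrMr// ler_pdivlMr// mulrC.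
    by rewrite !in_itv /= ltr_pdivrMr// ler_pdivlMr// mulrC.
  rewrite !lebesgue_measure_itv /= !lte_fin ltr_pM2r ?invr_gt0//.
  case: ifPn => _; last by rewrite mule0.
  by rewrite -!EFinD -EFinM -mulrBl mulrC divfK// gt_eqF.
by rewrite muleA -EFinM mulVf ?gt_eqF// mul1e.
Qed.

End lebesgue_scaling.

Section lebesgue_matrix_instances.
Context {R : realType}.

Section tuple.
Context (n : nat).
(** The structure of the witness is transported to [lebesgue_tuple] itself, so that products and
    Tonelli's theorem can be stated for it directly; the same is done for [lebesgue_matrix]. *)
Let mu := sval (@lebesgue_tuple_measure R n).
Let muE : mu = @lebesgue_tuple R n :> (set (n.-tuple R) -> \bar R) :=
  svalP (@lebesgue_tuple_measure R n).

Let tuple0 : @lebesgue_tuple R n set0 = 0%E.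
Proof. by rewrite -muE measure0. Qed.

Let tuple_ge0 A : (0 <= @lebesgue_tuple R n A)%E.
Proof. by rewrite -muE; exact: measure_ge0. Qed.

Let tuple_sigma_additive : semi_sigma_additive (@lebesgue_tuple R n).
Proof. by rewrite -muE; exact: measure_semi_sigma_additive. Qed.

HB.instance Definition _ := isMeasure.Build _ _ _ (@lebesgue_tuple R n)
  tuple0 tuple_ge0 tuple_sigma_additive.

Let tuple_sigma_finite : sigma_finite setT (@lebesgue_tuple R n).
Proof. by rewrite -muE; exact: sigma_finiteT. Qed.

HB.instance Definition _ := Measure_isSigmaFinite.Build _ _ _
  (@lebesgue_tuple R n) tuple_sigma_finite.

End tuple.

Section matrix.
Context (m n : nat).
Let mu := sval (@lebesgue_matrix_measure R m n).
Let muE : mu = @lebesgue_matrix R m n :> (set 'M[R]_(m, n) -> \bar R) :=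
  svalP (@lebesgue_matrix_measure R m n).

Let matrix0 : @lebesgue_matrix R m n set0 = 0%E.
Proof. by rewrite -muE measure0. Qed.

Let matrix_ge0 A : (0 <= @lebesgue_matrix R m n A)%E.
Proof. by rewrite -muE; exact: measure_ge0. Qed.

Let matrix_sigma_additive : semi_sigma_additive (@lebesgue_matrix R m n).
Proof. by rewrite -muE; exact: measure_semi_sigma_additive. Qed.

HB.instance Definition _ := isMeasure.Build _ _ _ (@lebesgue_matrix R m n)
  matrix0 matrix_ge0 matrix_sigma_additive.

Lemma lebesgue_mbox (A : 'I_m -> 'I_n -> set R) :
  (forall i j, measurable (A i j)) ->
  lebesgue_matrix (mbox A) = (\prod_(i < m) \prod_(j < n) lebesgue_measure (A i j))%E.
Proof. exact: lebesgue_matrix_box. Qed.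

Lemma lebesgue_matrix_mcube k : (lebesgue_matrix (@mcube R m n k) < +oo)%E.
Proof.
rewrite /mcube lebesgue_mbox//.
rewrite -ge0_fin_numE; last by apply: prode_ge0 => i _; apply: prode_ge0.
apply: prode_fin_num => i _; apply: prode_fin_num => j _.
by rewrite lebesgue_measure_itv /=; case: ifP.
Qed.

Let matrix_sigma_finite : sigma_finite setT (@lebesgue_matrix R m n).
Proof.
exists (@mcube R m n); first by rewrite mcubeT.
move=> k; split; last exact: lebesgue_matrix_mcube.
exact: measurable_mbox.
Qed.

HB.instance Definition _ := Measure_isSigmaFinite.Build _ _ _
  (@lebesgue_matrix R m n) matrix_sigma_finite.

End matrix.
End lebesgue_matrix_instances.

Section scaling.
Context {R : realType} (m n : nat).
Notation lam := (@lebesgue_matrix R m n).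

Definition mx_scale (c : 'I_m -> R) (x : 'M[R]_(m, n)) : 'M[R]_(m, n) :=
  \matrix_(i, j) (c i * x i j).

Lemma measurable_mx_scale c : measurable_fun setT (mx_scale c).
Proof.
apply: measurable_fun_mx => i j.
under eq_fun do rewrite mxE.
by apply: measurable_funM => //; exact: measurable_coord.
Qed.

Lemma lebesgue_mx_scale c A : (forall i, 0 < c i) -> measurable A ->
  lam (mx_scale c @^-1` A) = ((\prod_i (c i)^-1 ^+ n)%:E * lam A)%E.
Proof.
move=> c0 mA.
have pr0 : 0 <= \prod_i (c i)^-1 ^+ n.
  by apply: prodr_ge0 => i _; rewrite exprn_ge0// invr_ge0 ltW.
pose pf : {measure set 'M[R]_(m, n) -> \bar R} :=
  measure_function_pushforward__canonical__measure_function_Measure lam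
   (measurable_mx_scale c).
apply/esym.
apply: (@measure_mx_unique R m n (mscale (NngNum pr0) lam) pf) => //.
  move=> B mB; rewrite /mscale/= /pushforward.
  have -> : mx_scale c @^-1` mbox B = mbox (fun i j => (fun x => c i * x) @^-1` B i j).
    by apply/seteqP; split=> x /= Bx i j; have := Bx i j; rewrite mxE.
  rewrite [LHS]/mscale/= !lebesgue_mbox//; last first.
    move=> i j; rewrite -[X in measurable X]setTI.
    exact: measurable_funM.
  rewrite -prodEFin -big_split/=; apply: eq_bigr => i _.
  transitivity (\prod_(j < n) (((c i)^-1)%:E * lebesgue_measure (B i j)))%E.
    by rewrite big_split/= prodEFin big_const iter_mulr_1 card_ord.
  by apply: eq_bigr => j _; rewrite lebesgue_measure_scale.
move=> k; rewrite /mscale/= lte_mul_pinfty//.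
exact: lebesgue_matrix_mcube.
Qed.

Lemma integral_mx_scale c (f : 'M[R]_(m, n) -> \bar R) : (forall i, 0 < c i) ->
  measurable_fun setT f -> (forall x, 0 <= f x)%E ->
  (\int[lam]_x f (mx_scale c x) = (\prod_i (c i)^-1 ^+ n)%:E * \int[lam]_x f x)%E.
Proof.
move=> c0 mf f0.
have pr0 : 0 <= \prod_i (c i)^-1 ^+ n.
  by apply: prodr_ge0 => i _; rewrite exprn_ge0// invr_ge0 ltW.
rewrite -[LHS](@ge0_integral_pushforward _ _ _ _ _ _ (measurable_mx_scale c) _ setT)//.
rewrite -(@ge0_integral_mscale _ _ _ lam setT _ (NngNum pr0))//.
pose pf : {measure set 'M[R]_(m, n) -> \bar R} :=
  measure_function_pushforward__canonical__measure_function_Measure lam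
   (measurable_mx_scale c).
change (\int[pf]_y f y = \int[mscale (NngNum pr0) lam]_x f x)%E.
apply: eq_measure_integral => A mA _.
exact: lebesgue_mx_scale.
Qed.

End scaling.

(** * Integrals of products of one-variable functions *)

Section product_integral.
Context {R : realType}.
Notation leb := (@lebesgue_measure R).

(** By nonnegativity, Tonelli's theorem peels off one coordinate at a time, following the recursion
    that defines [lebesgue_tuple]. *)
Lemma integral_tuple_prod n (f : 'I_n -> R -> R) :
  (forall i, measurable_fun setT (f i)) -> (forall i x, 0 <= f i x) ->
  (\int[@lebesgue_tuple R n]_t (\prod_i f i (tnth t i))%:E =
   \prod_i \int[leb]_x (f i x)%:E)%E.
Proof.
elim: n f => [|n IH] f mf f0.
  rewrite big_ord0.
  change (\int[dirac ([tuple] : 0.-tuple R)]_t (\prod_i f i (tnth t i))%:E = 1)%E.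
  rewrite integral_dirac ?diracT ?mul1e ?big_ord0//.
  by apply/measurable_EFinP; apply: measurable_prod => -[].
pose c (xt : measurableTypeR R * n.-tuple R) : n.+1.-tuple R :=
  [tuple of xt.1 :: xt.2].
have mc : measurable_fun setT c by apply: measurable_cons.
have mprod k (g : 'I_k -> R -> R) : (forall i, measurable_fun setT (g i)) ->
    measurable_fun setT (fun t : k.-tuple R => (\prod_i g i (tnth t i))%:E).
  move=> mg; apply/measurable_EFinP; apply: measurable_prod => i _.
  apply: measurableT_comp => //; exact: measurable_tnth.
have pr0 k (g : 'I_k -> R -> R) : (forall i x, 0 <= g i x) ->
    forall t : k.-tuple R, (0 <= (\prod_i g i (tnth t i))%:E)%E.
  by move=> g0 t; rewrite lee_fin prodr_ge0.
change (\int[pushforward (leb \x @lebesgue_tuple R n)%E c]_t (\prod_i f i (tnth t i))%:E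
   = \prod_i \int[leb]_x (f i x)%:E)%E.
rewrite ge0_integral_pushforward//; last 2 first.
- exact: mprod.
- by move=> t _; exact: pr0.
rewrite fubini_tonelli1; last 2 first.
- by apply: measurableT_comp => //; exact: mprod.
- by move=> xt; exact: pr0.
rewrite /fubini_F big_ord_recl.
pose g i := f (lift ord0 i).
transitivity (\int[leb]_x ((f ord0 x)%:E * \prod_(i < n) \int[leb]_y (g i y)%:E))%E.
  apply: eq_integral => x _.
  rewrite -IH; [|by move=> i; exact: mf|by move=> i y; exact: f0].
  rewrite -ge0_integralZl//; last 3 first.
  - by apply: mprod => i; exact: mf.
  - by move=> t _; apply: pr0 => i y; exact: f0.
  - by rewrite lee_fin.
  apply: eq_integral => t _; rewrite /= -EFinM big_ord_recl /=.
  by congr (_ * _)%:E; apply: eq_bigr => i _; rewrite /g tnthS.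
rewrite ge0_integralZr//.
- by apply/measurable_EFinP; exact: mf.
- by move=> x _; rewrite lee_fin.
- by apply: prode_ge0 => i _; apply: integral_ge0 => x _; rewrite lee_fin f0.
Qed.

Lemma integral_matrix_prod m n (f : 'I_m -> 'I_n -> R -> R) :
  (forall i j, measurable_fun setT (f i j)) -> (forall i j x, 0 <= f i j x) ->
  (\int[@lebesgue_matrix R m n]_x (\prod_i \prod_j f i j (x i j))%:E =
   \prod_i \prod_j \int[leb]_x (f i j x)%:E)%E.
Proof.
move=> mf f0.
pose h (t : (m * n).-tuple R) : 'M[R]_(m, n) :=
  \matrix_(i, j) tnth t (mxvec_index i j).
have mh : measurable_fun setT h.
  apply: measurable_fun_mx => i j; under eq_fun do rewrite mxE.
  exact: measurable_tnth.
change (\int[pushforward (@lebesgue_tuple R (m * n)) h]_x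
  (\prod_i \prod_j f i j (x i j))%:E = \prod_i \prod_j \int[leb]_x (f i j x)%:E)%E.
rewrite ge0_integral_pushforward//; last 2 first.
- apply/measurable_EFinP; apply: measurable_prod => i _.
  apply: measurable_prod => j _.
  by apply: measurableT_comp => //; exact: measurable_coord.
- by move=> x _; rewrite lee_fin; apply: prodr_ge0 => i _; apply: prodr_ge0.
have [u uK Ku] := curry_mxvec_bij m n.
pose F k := f (u k).1 (u k).2.
rewrite [RHS]pair_bigA /= (reindex u) /=; last first.
  by exists (uncurry (@mxvec_index m n)) => ? _; [exact: Ku|exact: uK].
rewrite -(@integral_tuple_prod _ F)//.
- apply: eq_integral => t _ /=; congr EFin.
  rewrite pair_bigA /= (reindex u) /=; last first.
    by exists (uncurry (@mxvec_index m n)) => ? _; [exact: Ku|exact: uK].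
  apply: eq_bigr => k _; rewrite mxE /F.
  by have := Ku k; case: (u k) => a b /= ->.
- by move=> k; exact: mf.
- by move=> k x; exact: f0.
Qed.

End product_integral.

(** * Row norms and the exchange of radial parts *)

Section lp_norm_theory.
Context {R : realType}.
Implicit Types (p : \bar R) (n : nat).

Lemma lp_norm_ge0 p n (x : 'I_n -> R) : 0 <= lp_norm p x.
Proof.
by case: p => [r||] //=; [exact: powR_ge0|apply: bigmax_ge_id].
Qed.

(** For exponents below 1 the triangle inequality fails. Homogeneity and the domination of entries
    in [ler_lp_norm] hold for every positive exponent and carry the whole argument. *)
Lemma lp_normZ p n (c : R) (x : 'I_n -> R) : (0 < p)%E -> 0 <= c ->
  lp_norm p (fun i => c * x i) = c * lp_norm p x.
Proof.
case: p => [r||] //=; rewrite ?lte_fin => r0 c0.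
  under eq_bigr do rewrite normrM (ger0_norm c0) powRM//.
  rewrite -mulr_sumr powRM ?powR_ge0//; last by apply: sumr_ge0 => i _; exact: powR_ge0.
  by rewrite -powRrM divff ?gt_eqF// powRr1.
under eq_bigr do rewrite normrM (ger0_norm c0).
elim/big_ind2 : _ => [|a b a' b' -> ->|//]; first by rewrite mulr0.
by rewrite maxr_pMr.
Qed.

Lemma ler_lp_norm p n (x : 'I_n -> R) i : (0 < p)%E -> `|x i| <= lp_norm p x.
Proof.
case: p => [r||] //=; rewrite ?lte_fin => r0; last first.
  exact: (le_bigmax _ (fun i => `|x i|)).
rewrite -[leLHS](@powRr1 _ `|x i|)// -(@divff _ r) ?gt_eqF// powRrM.
apply: ge0_ler_powR; rewrite ?invr_ge0 ?nnegrE ?powR_ge0 ?(ltW r0)//.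
  by apply: sumr_ge0 => j _; exact: powR_ge0.
by rewrite (bigD1 i)//= lerDl; apply: sumr_ge0 => j _; exact: powR_ge0.
Qed.

Lemma measurable_lp_norm p n d (T : measurableType d) (f : 'I_n -> T -> R) :
  (forall i, measurable_fun setT (f i)) ->
  measurable_fun setT (fun t => lp_norm p (f^~ t)).
Proof.
move=> mf; case: p => [r||] //=.
  apply: (@measurableT_comp _ _ _ _ _ _ (@powR R ^~ r^-1)); first exact: measurable_powR.
  apply: measurable_sum => i.
  apply: (@measurableT_comp _ _ _ _ _ _ (@powR R ^~ r)); first exact: measurable_powR.
  by apply: measurableT_comp => //; exact: mf.
have mB (s : seq 'I_n) : measurable_fun setT
    (fun t => \big[Num.max/0]_(i <- s) `|f i t|).
  elim: s => [|i s IH]; first by under eq_fun do rewrite big_nil; exact: measurable_cst.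
  under eq_fun do rewrite big_cons.
  by apply: measurable_maxr => //; apply: measurableT_comp => //; exact: mf.
exact: mB.
Qed.

End lp_norm_theory.

Section row_norm.
Context {R : realType} (q : \bar R) (q0 : (0 < q)%E) (m n : nat).
Implicit Types (x y : 'M[R]_(m, n)) (c : 'I_m -> R).
Notation lam := (@lebesgue_matrix R m n).

Definition row_norm x i : R := lp_norm q (fun j => x i j).

Lemma row_norm_ge0 x i : 0 <= row_norm x i.
Proof. exact: lp_norm_ge0. Qed.

Lemma row_norm_scale c x i : 0 <= c i ->
  row_norm (mx_scale c x) i = c i * row_norm x i.
Proof.
move=> c0; rewrite -lp_normZ//; congr lp_norm.
by apply/funext => j; rewrite mxE.
Qed.

Lemma measurable_row_norm i : measurable_fun setT (fun x => row_norm x i).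
Proof. by apply: measurable_lp_norm => j; exact: measurable_coord. Qed.

Lemma mx_scaleA c c' x :
  mx_scale c (mx_scale c' x) = mx_scale (fun i => c i * c' i) x.
Proof. by apply/matrixP => i j; rewrite !mxE mulrA. Qed.

Lemma mx_scale1 c x : (forall i, c i = 1) -> mx_scale c x = x.
Proof. by move=> c1; apply/matrixP => i j; rewrite mxE c1 mul1r. Qed.

Lemma measurable_fun_mx_scale d (T : measurableType d)
    (f : 'I_m -> T -> R) (g : T -> 'M[R]_(m, n)) :
  (forall i, measurable_fun setT (f i)) -> measurable_fun setT g ->
  measurable_fun setT (fun t => mx_scale (f^~ t) (g t)).
Proof.
move=> mf mg; apply: measurable_fun_mx => i j; under eq_fun do rewrite mxE.
apply: measurable_funM => //.
by apply: (measurableT_comp (@measurable_coord R m n i j)).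
Qed.

(** Where dividing by the row norms is genuine; elsewhere the inverse of 0 takes its default value
    0. *)
Definition full_rows : set 'M[R]_(m, n) := [set x | forall i, 0 < row_norm x i].

Lemma measurable_full_rows : measurable full_rows.
Proof.
rewrite (_ : full_rows = \bigcap_(i in [set: 'I_m])
    ((fun x => row_norm x i) @^-1` `]0, +oo[)).
  apply: fin_bigcap_measurable => [|i _]; first exact: finite_finset.
  by rewrite -[X in measurable X]setTI; exact: measurable_row_norm.
apply/seteqP; split=> [x Ux i _|x Ux i]; first by rewrite /= in_itv/= Ux.
by have := Ux i I; rewrite /= in_itv/= andbT.
Qed.

(** A row of norm 0 has entry 0 in column [j0], so the complement lies in a finite union of
    coordinate hyperplanes. *)
Lemma lebesgue_full_rowsC : (0 < n)%N -> lam (~` full_rows) = 0%E.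
Proof.
move=> n0; pose j0 := Ordinal n0.
pose Z i : set 'M[R]_(m, n) := (fun x : 'M[R]_(m, n) => x i j0) @^-1` [set 0].
have mZ i : measurable (Z i).
  by rewrite -[X in measurable X]setTI; exact: measurable_coord.
have Z0 i : lam (Z i) = 0%E.
  rewrite /Z matrix_cylinder_mbox lebesgue_mbox; last first.
    by move=> i' j'; case: ifP.
  by rewrite (bigD1 i)//= (bigD1 j0)//= !eqxx /= lebesgue_measure_set1 !mul0e.
have [mB B0] : measurable (\big[setU/set0]_i Z i) /\ lam (\big[setU/set0]_i Z i) = 0%E.
  elim/big_ind : _ => [|A B [mA A0] [mB B0]|i _]; first by rewrite measure0.
    by split; [exact: measurableU|rewrite measureU0].
  by split.
apply/eqP; rewrite eq_le measure_ge0 andbT -B0; apply: le_measure.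
- by rewrite inE; apply: measurableC; exact: measurable_full_rows.
- by rewrite inE.
- move=> x /existsNP[i /negP]; rewrite -leNgt => xi.
  by rewrite (bigD1 i)//=; left; rewrite /Z /=; apply/eqP; rewrite -normr_le0; apply: le_trans xi; exact: ler_lp_norm.
Qed.

End row_norm.

Section radial_exchange.
Context {R : realType} (q : \bar R) (q0 : (0 < q)%E) (m n : nat) (n0 : (0 < n)%N).
Implicit Types (x y : 'M[R]_(m, n)).
Notation lam := (@lebesgue_matrix R m n).
Notation rn := (row_norm q).
Notation U := (@full_rows R q m n).
Variable G : 'M[R]_(m, n) -> R.
Hypothesis mG : measurable_fun setT G.
Hypothesis G0 : forall x, 0 <= G x.
Hypothesis Gnorm : forall x y, rn x =1 rn y -> G x = G y.

Definition exchange x y := mx_scale (fun i => rn x i / rn y i) y.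

(** The Jacobian determinant of the map multiplying each row by the corresponding row norm of
    [x]. *)
Definition volfac (x : 'M[R]_(m, n)) := \prod_i rn x i ^+ n.

Lemma measurable_inv_norm i : measurable_fun setT (fun x : 'M[R]_(m, n) => (rn x i)^-1).
Proof.
under eq_fun do rewrite -powR_inv1 ?row_norm_ge0//.
apply: (@measurableT_comp _ _ _ _ _ _ (@powR R ^~ (-1))); first exact: measurable_powR.
exact: measurable_row_norm.
Qed.

Let T2 := ('M[R]_(m, n) * 'M[R]_(m, n))%type.

Let mn1 i : measurable_fun setT (fun z : T2 => rn z.1 i).
Proof. by apply: (measurableT_comp (@measurable_row_norm R q m n i)); exact: measurable_fst. Qed.

Let mn2 i : measurable_fun setT (fun z : T2 => rn z.2 i).
Proof. by apply: (measurableT_comp (@measurable_row_norm R q m n i)); exact: measurable_snd. Qed.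

Let mv1 i : measurable_fun setT (fun z : T2 => (rn z.1 i)^-1).
Proof. by apply: (measurableT_comp (@measurable_inv_norm i)); exact: measurable_fst. Qed.

Let mv2 i : measurable_fun setT (fun z : T2 => (rn z.2 i)^-1).
Proof. by apply: (measurableT_comp (@measurable_inv_norm i)); exact: measurable_snd. Qed.

Lemma measurable_exchange : measurable_fun setT (fun z : T2 => exchange z.1 z.2).
Proof.
apply: (@measurable_fun_mx_scale R m n _ T2 (fun i z => rn z.1 i / rn z.2 i)) => //.
by move=> i; exact: measurable_funM.
Qed.

Lemma row_norm_exchange x y i : U y -> rn (exchange x y) i = rn x i.
Proof.
move=> Uy; rewrite row_norm_scale//.
  by rewrite divfK// gt_eqF.
by rewrite divr_ge0 ?row_norm_ge0.
Qed.

Let ind A (x : 'M[R]_(m, n)) : R := \1_A x.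

Let mind A d (T : measurableType d) (g : T -> 'M[R]_(m, n)) : measurable A ->
  measurable_fun setT g -> measurable_fun setT (fun t => ind A (g t)).
Proof. by move=> mA mg; apply: (measurableT_comp _ mg); exact: measurable_indic. Qed.

Let mU : measurable U. Proof. exact: measurable_full_rows. Qed.

(** The integrands before and after each of the three substitutions of [exchange_const], Jacobians
    included. The first two turn [f] into [g] and [g] into [h]; the third leaves the product of
    [w x] with indicators of [y]. The inverse square in [w] produces a matrix with row norms
    [1 / rn x i]. *)
Let f A x y := ind U x * ind U y * ind A (exchange x y) * G y.
Let g A x y := ind U x * ind U y * volfac y * ind A (mx_scale (rn x) y) * G y.
Let h A x y := ind U x * ind U y * (volfac x)^-1 * (volfac y * (volfac x)^-1)
  * ind A y * G (mx_scale (fun i => (rn x i)^-1) y).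
Let w x := ind U x * (volfac x)^-1 * (volfac x)^-1
   * G (mx_scale (fun i => (rn x i)^-1 * (rn x i)^-1) x).

Let mvol : measurable_fun setT volfac.
Proof.
by apply: measurable_prod => i _; apply: measurable_funX; exact: measurable_row_norm.
Qed.

Let vol_ge0 x : 0 <= volfac x.
Proof. by apply: prodr_ge0 => i _; rewrite exprn_ge0// row_norm_ge0. Qed.

Let vol_gt0 x : U x -> 0 < volfac x.
Proof. by move=> Ux; apply: prodr_gt0 => i _; rewrite exprn_gt0. Qed.

Let mvolV : measurable_fun setT (fun x => (volfac x)^-1).
Proof.
under eq_fun do rewrite -powR_inv1//.
by apply: (@measurableT_comp _ _ _ _ _ _ (@powR R ^~ (-1))); first exact: measurable_powR.
Qed.

Let ind_ge0 A x : 0 <= ind A x.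
Proof. by rewrite /ind indicE. Qed.

Let indT A x : A x -> ind A x = 1.
Proof. by move=> Ax; rewrite /ind indicE mem_set. Qed.

Let indF A x : ~ A x -> ind A x = 0.
Proof. by move=> Ax; rewrite /ind indicE memNset. Qed.

Let indU c x : (forall i, 0 < c i) -> ind U (mx_scale c x) = ind U x.
Proof.
move=> c0; rewrite /ind !indicE; congr (_%:R); congr nat_of_bool.
apply/idP/idP; rewrite !inE => Ux i; have := Ux i; rewrite row_norm_scale ?ltW//.
  by rewrite pmulr_rgt0.
by move=> ?; rewrite mulr_gt0.
Qed.

Let vol_scale c x : (forall i, 0 < c i) ->
  volfac (mx_scale c x) = \prod_i (c i) ^+ n * volfac x.
Proof.
move=> c0; rewrite -big_split/=; apply: eq_bigr => i _.
by rewrite row_norm_scale ?ltW// exprMn.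
Qed.

Let unscale c (F : 'M[R]_(m, n) -> R) : (forall i, 0 < c i) ->
  measurable_fun setT F -> (forall x, 0 <= F x) ->
  (\int[lam]_x (F x)%:E = \int[lam]_x (\prod_i (c i) ^+ n * F (mx_scale c x))%:E)%E.
Proof.
move=> c0 mF F0.
under [RHS]eq_integral do rewrite EFinM.
rewrite ge0_integralZl//; last 3 first.
- apply/measurable_EFinP; apply: (measurableT_comp mF); exact: measurable_mx_scale.
- by move=> x _; rewrite lee_fin.
- by rewrite lee_fin; apply: prodr_ge0 => i _; rewrite exprn_ge0// ltW.
rewrite (@integral_mx_scale R m n c (fun x => (F x)%:E))//; last exact/measurable_EFinP.
rewrite muleA -EFinM -big_split/= big1 ?mul1e// => i _.
by rewrite -exprMn divff ?gt_eqF// expr1n.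
Qed.

Let mf A : measurable A -> measurable_fun setT (fun z : T2 => f A z.1 z.2).
Proof.
move=> mA; rewrite /f; repeat apply: measurable_funM.
- exact: mind.
- exact: mind.
- by apply: mind => //; exact: measurable_exchange.
- exact: (measurableT_comp mG).
Qed.

Let mg A : measurable A -> measurable_fun setT (fun z : T2 => g A z.1 z.2).
Proof.
move=> mA; rewrite /g; repeat apply: measurable_funM.
- exact: mind.
- exact: mind.
- exact: (measurableT_comp mvol).
- apply: mind => //.
  exact: (@measurable_fun_mx_scale R m n _ T2 (fun i z => rn z.1 i)).
- exact: (measurableT_comp mG).
Qed.

Let mh A : measurable A -> measurable_fun setT (fun z : T2 => h A z.1 z.2).
Proof.
move=> mA; rewrite /h; repeat apply: measurable_funM.
- exact: mind.
- exact: mind.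
- exact: (measurableT_comp mvolV).
- exact: (measurableT_comp mvol).
- exact: (measurableT_comp mvolV).
- exact: mind.
- apply: (measurableT_comp mG).
  exact: (@measurable_fun_mx_scale R m n _ T2 (fun i z => (rn z.1 i)^-1)).
Qed.

Let mw : measurable_fun setT w.
Proof.
rewrite /w; repeat apply: measurable_funM.
- exact: mind.
- exact: mvolV.
- exact: mvolV.
- apply: (measurableT_comp mG).
  apply: (@measurable_fun_mx_scale R m n _ _ (fun i z => (rn z i)^-1 * (rn z i)^-1)) => // i.
  by apply: measurable_funM; exact: measurable_inv_norm.
Qed.

Let fg A y : measurable A ->
  (\int[lam]_x (f A x y)%:E = \int[lam]_x (g A x y)%:E)%E.
Proof.
move=> mA; have [Uy|Uy] := pselect (U y); last first.
  by apply: eq_integral => x _; rewrite /f /g (indF Uy) mulr0 !mul0r.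
rewrite (@unscale (rn y) (f A ^~ y))//.
- apply: eq_integral => x _; congr EFin.
  rewrite /f /g indU// -/(volfac y).
  have -> : exchange (mx_scale (rn y) x) y = mx_scale (rn x) y.
    apply/matrixP => i j; rewrite !mxE row_norm_scale ?row_norm_ge0//.
    by rewrite (mulrC (rn y i)) mulfK// gt_eqF.
  by ring.
- have := measurable_fun_pair1 y (mf mA); exact.
- by move=> x; rewrite /f !mulr_ge0.
Qed.

Let gh A x : measurable A ->
  (\int[lam]_y (g A x y)%:E = \int[lam]_y (h A x y)%:E)%E.
Proof.
move=> mA; have [Ux|Ux] := pselect (U x); last first.
  by apply: eq_integral => y _; rewrite /g /h (indF Ux) !mul0r.
have x0 i : 0 < (rn x i)^-1 by rewrite invr_gt0.
have vV : \prod_i (rn x i)^-1 ^+ n = (volfac x)^-1.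
  by rewrite /volfac -prodfV; apply: eq_bigr => i _; rewrite exprVn.
rewrite (@unscale (fun i => (rn x i)^-1) (g A x))//.
- apply: eq_integral => y _; congr EFin.
  rewrite /g /h indU// vol_scale// vV mx_scaleA mx_scale1; last first.
    by move=> i; rewrite divff// gt_eqF.
  by ring.
- have := measurable_fun_pair2 x (mg mA); exact.
- by move=> y; rewrite /g !mulr_ge0.
Qed.

Let hw A y : measurable A ->
  (\int[lam]_x (h A x y)%:E = (ind U y * ind A y)%:E * \int[lam]_x (w x)%:E)%E.
Proof.
move=> mA; have [Uy|Uy] := pselect (U y); last first.
  rewrite (indF Uy) mul0r mul0e; apply: integral0_eq => x _.
  by rewrite /h (indF Uy) mulr0 !mul0r.
rewrite (@unscale (rn y) (h A ^~ y))//; last 2 first.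
- have := measurable_fun_pair1 y (mh mA); exact.
- by move=> x; rewrite /h !mulr_ge0// invr_ge0.
rewrite -ge0_integralZl//; last 3 first.
- exact/measurable_EFinP.
- by move=> x _; rewrite lee_fin /w !mulr_ge0// invr_ge0.
- by rewrite lee_fin mulr_ge0.
apply: eq_integral => x _; rewrite -EFinM; congr EFin.
have [Ux|Ux] := pselect (U x); last by rewrite /h /w indU// (indF Ux) !mul0r !mulr0.
rewrite /h /w indU// vol_scale// -/(volfac y) (indT Uy) (indT Ux).
(* Both matrices have row norms [1 / rn x i]. This is where the dependence of [G] on row norms alone
   separates [x] from [y]. *)
rewrite (@Gnorm (mx_scale (fun i => (rn (mx_scale (rn y) x) i)^-1) y)
  (mx_scale (fun i => (rn x i)^-1 * (rn x i)^-1) x)); last first.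
  move=> i; rewrite !row_norm_scale ?invr_ge0 ?mulr_ge0 ?invr_ge0 ?row_norm_ge0//.
  have := Uy i; have := Ux i; move: (rn x i) (rn y i) => a b a0 b0.
  by field; rewrite !gt_eqF.
have := vol_gt0 Uy; have := vol_gt0 Ux; move: (volfac x) (volfac y) => a b a0 b0.
by field; rewrite !gt_eqF.
Qed.

(* Substituting x -> N(y)x, then y -> y/N(x), then x -> N(y)x, row by row, moves
   all dependence on A into the factor [\1_A y]. *)
Lemma exchange_const : exists C : \bar R, forall A, measurable A ->
  (\int[lam]_x \int[lam]_y (f A x y)%:E = C * lam A)%E.
Proof.
exists (\int[lam]_x (w x)%:E)%E => A mA.
have EM (F : 'M[R]_(m, n) -> 'M[R]_(m, n) -> R) :
    measurable_fun setT (fun z : T2 => F z.1 z.2) ->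
    measurable_fun setT (fun z : T2 => (F z.1 z.2)%:E).
  by move=> ?; exact/measurable_EFinP.
have F0 : (forall z : T2, 0 <= (f A z.1 z.2)%:E)%E.
  by move=> z; rewrite lee_fin /f !mulr_ge0.
have g0 : (forall z : T2, 0 <= (g A z.1 z.2)%:E)%E.
  by move=> z; rewrite lee_fin /g !mulr_ge0.
have h0 : (forall z : T2, 0 <= (h A z.1 z.2)%:E)%E.
  by move=> z; rewrite lee_fin /h !mulr_ge0// invr_ge0.
rewrite (fubini_tonelli (m1 := lam) (m2 := lam) (fun z => (f A z.1 z.2)%:E) (EM _ (mf mA)) F0)/=.
under eq_integral do rewrite fg//.
rewrite -(fubini_tonelli (m1 := lam) (m2 := lam) (fun z => (g A z.1 z.2)%:E) (EM _ (mg mA)) g0)/=.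
under eq_integral do rewrite gh//.
rewrite (fubini_tonelli (m1 := lam) (m2 := lam) (fun z => (h A z.1 z.2)%:E) (EM _ (mh mA)) h0)/=.
under eq_integral do rewrite hw//.
rewrite ge0_integralZr//; last 3 first.
- by apply/measurable_EFinP; apply: measurable_funM; exact: mind.
- by move=> x _; rewrite lee_fin mulr_ge0.
- by apply: integral_ge0 => x _; rewrite lee_fin /w !mulr_ge0// invr_ge0.
rewrite muleC; congr (_ * _)%E.
transitivity (\int[lam]_x (\1_(U `&` A) x)%:E)%E.
  by apply: eq_integral => x _; rewrite /ind !indicE in_setI -natrM mulnb.
rewrite integral_indic ?setIT//; last exact: measurableI.
have UC0 := @lebesgue_full_rowsC R q q0 m n n0.
apply/eqP; rewrite eq_le; apply/andP; split.
  by apply: le_measure; rewrite ?inE//; exact: measurableI.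
rewrite -(measureU0 (measurableI _ _ mU mA) (measurableC mU) UC0).
apply: le_measure; rewrite ?inE//.
  by apply: measurableU; [exact: measurableI|exact: measurableC].
by move=> x Ax; have [|] := pselect (U x); [left|right].
Qed.

End radial_exchange.

(** * Moments of the row norms *)

Section minimum_derivative.
Context {R : realType}.

(** Rearranged, the hypothesis says that [a * t^(-u) + b * t] is minimal at [t = 1], so its
    derivative [b - u * a] vanishes there. *)
Lemma powR_tangent (u a b : R) :
  (forall t : R, 0 < t -> a - (t - 1) * b <= t `^ (- u) * a) -> b = u * a.
Proof.
move=> H.
pose F : R -> R := a *: (fun t => t `^ (- u)) + b *: id.
have FE t : F t = a * t `^ (- u) + b * t by [].
have dF (t : R) : 0 < t -> is_derive t 1 F (a * (- u * t `^ (- u - 1)) + b * 1).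
  move=> t0.
  by apply: is_deriveD; apply: is_deriveZ; exact: is_derive1_powR.
have m1 : (1 : R) \in `]0, 2[ by rewrite in_itv/= ltr01 ltr1n.
have le02 : (0 : R) <= 2 by rewrite ler0n.
move: F FE dF => F FE dF.
have H1 : is_derive (1 : R) 1 F 0.
  apply: (derive1_at_min le02 _ m1).
    move=> t; rewrite in_itv/= => /andP[t0 _].
    exact: (@ex_derive _ _ _ _ _ _ _ (dF t t0)).
  move=> t; rewrite in_itv/= => /andP[t0 _]; have := H _ t0.
  rewrite !FE powR1 => h; lra.
have := @derive_val _ _ _ _ _ _ _ (dF 1 ltr01).
rewrite (@derive_val _ _ _ _ _ _ _ H1) powR1 => h; lra.
Qed.

End minimum_derivative.

Section row_moment.
Context {R : realType} (q : \bar R) (q0 : (0 < q)%E) (m n : nat) (i : 'I_m).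
Implicit Types (x y : 'M[R]_(m, n)).
Notation lam := (@lebesgue_matrix R m n).
Notation rn := (row_norm q).
Variables (r : R) (r0 : 0 < r).

Definition one_row (c : R) (i' : 'I_m) : R := if i' == i then c else 1.

Let s x := rn x i `^ r.

Lemma integral_one_row c (f : 'M[R]_(m, n) -> R) : 0 < c ->
  measurable_fun setT f -> (forall x, 0 <= f x) ->
  (\int[lam]_x (f (mx_scale (one_row c) x))%:E =
   (c ^- n)%:E * \int[lam]_x (f x)%:E)%E.
Proof.
move=> c0 mf f0; rewrite (@integral_mx_scale R m n _ (fun x => (f x)%:E))//; last 2 first.
- by move=> i'; rewrite /one_row; case: ifP.
- exact/measurable_EFinP.
congr (_%:E * _)%E; rewrite (bigD1 i)//= /one_row eqxx exprVn big1 ?mulr1// => i' /negPf ->.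
by rewrite invr1 expr1n.
Qed.

(** In [phi_psi], [- psi u] is a subgradient of the convex function [phi] at [u]. This inequality
    replaces differentiation under the integral sign and admits the kink of [ramp1] and the jump of
    [ramp0]. [rest] stands for the contribution of the other rows. *)
Variables (rest : 'M[R]_(m, n) -> R) (phi psi : R -> R) (k : nat).
Hypothesis mrest : measurable_fun setT rest.
Hypothesis rest0 : forall x, 0 <= rest x.
Hypothesis rest_inv : forall c x, 0 < c -> rest (mx_scale (one_row c) x) = rest x.
Hypotheses (mphi : measurable_fun setT phi) (mpsi : measurable_fun setT psi).
Hypotheses (phi0 : forall u, 0 <= phi u) (psi0 : forall u, 0 <= psi u).
Hypothesis phi_psi : forall u v, phi u - psi u * (v - u) <= phi v.

Let ms : measurable_fun setT s.
Proof.
apply: (@measurableT_comp _ _ _ _ _ _ (@powR R ^~ r)); first exact: measurable_powR.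
exact: measurable_row_norm.
Qed.

Let s0 x : 0 <= s x. Proof. exact: powR_ge0. Qed.

Let I t := (\int[lam]_x (s x ^+ k * phi (t * s x + rest x))%:E)%E.
Let J := (\int[lam]_x (s x ^+ k.+1 * psi (s x + rest x))%:E)%E.

Let IE t : 0 < t -> I t = ((t `^ (- (n%:R / r + k%:R)))%:E * I 1)%E.
Proof.
move=> t0; pose c := t `^ r^-1.
have c0 : 0 < c by exact: powR_gt0.
have cr : c `^ r = t by rewrite /c -powRrM mulVf ?gt_eqF// powRr1// ltW.
have cn : c ^- n = t `^ (- (n%:R / r)).
  rewrite -powR_invn ?(ltW c0)// /c -powRrM; congr (_ `^ _).
  by rewrite mulrN mulrC.
pose f x := s x ^+ k * phi (s x + rest x).
have mf : measurable_fun setT f.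
  apply: measurable_funM; first exact: measurable_funX.
  by apply: (measurableT_comp mphi); exact: measurable_funD.
have f0 x : 0 <= f x by rewrite mulr_ge0// exprn_ge0.
have sc x : s (mx_scale (one_row c) x) = t * s x.
  rewrite /s row_norm_scale// /one_row eqxx ?(ltW c0)//.
  by rewrite powRM ?row_norm_ge0 ?(ltW c0)// cr.
have := integral_one_row c0 mf f0.
rewrite /f; under eq_integral do rewrite rest_inv// sc exprMn -mulrA EFinM.
rewrite ge0_integralZl//; last 3 first.
- apply/measurable_EFinP/measurable_funM; first exact: measurable_funX.
  by apply: (measurableT_comp mphi); apply: measurable_funD => //; exact: measurable_funM.
- by move=> x _; rewrite lee_fin mulr_ge0// exprn_ge0.
- by rewrite lee_fin exprn_ge0// ltW.
rewrite -/(I t) cn => E.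
have -> : I t = ((t ^- k)%:E * ((t ^+ k)%:E * I t))%E.
  by rewrite muleA -EFinM mulVf ?mul1e// expf_neq0// gt_eqF.
rewrite E muleA -EFinM opprD powRD; last by apply/implyP => _; rewrite gt_eqF.
rewrite powR_invn ?ltW// mulrC; congr (_ * _)%E.
by rewrite /I; apply: eq_integral => x _; rewrite mul1r.
Qed.

(* Substituting t^(1/r) for the scale of row i gives I(t) = t^-(n/r+k) I(1),
   while [phi_psi] gives I(t) >= I(1) - (t-1) J; comparing slopes at t = 1
   yields J = (n/r+k) I(1). *)
Lemma row_moment :
  (\int[lam]_x (rn x i `^ r ^+ k * phi (rn x i `^ r + rest x))%:E < +oo)%E ->
  (\int[lam]_x (rn x i `^ r ^+ k.+1 * psi (rn x i `^ r + rest x))%:E =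
   (n%:R / r + k%:R)%:E *
   \int[lam]_x (rn x i `^ r ^+ k * phi (rn x i `^ r + rest x))%:E)%E.
Proof.
rewrite -/J.
have -> : (\int[lam]_x (rn x i `^ r ^+ k * phi (rn x i `^ r + rest x))%:E)%E = I 1.
  by apply: eq_integral => x _; rewrite mul1r.
move=> Ioo.
have mf t : measurable_fun setT (fun x => s x ^+ k * phi (t * s x + rest x)).
  apply: measurable_funM; first exact: measurable_funX.
  by apply: (measurableT_comp mphi); apply: measurable_funD => //; exact: measurable_funM.
have f0 t x : 0 <= s x ^+ k * phi (t * s x + rest x) by rewrite mulr_ge0// exprn_ge0.
have mg : measurable_fun setT (fun x => s x ^+ k.+1 * psi (s x + rest x)).
  apply: measurable_funM; first exact: measurable_funX.
  by apply: (measurableT_comp mpsi); exact: measurable_funD.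
have g0 x : 0 <= s x ^+ k.+1 * psi (s x + rest x) by rewrite mulr_ge0// exprn_ge0.
have I0 t : (0 <= I t)%E by apply: integral_ge0 => x _; rewrite lee_fin.
have J0 : (0 <= J)%E by apply: integral_ge0 => x _; rewrite lee_fin.
have tan t x : s x ^+ k * phi (1 * s x + rest x) <=
    s x ^+ k * phi (t * s x + rest x) + (t - 1) * (s x ^+ k.+1 * psi (s x + rest x)).
  rewrite mul1r.
  have := phi_psi (s x + rest x) (t * s x + rest x).
  move=> /(ler_wpM2l (exprn_ge0 k (s0 x))).
  rewrite exprS; set u := s x ^+ k; set a := phi _; set b := phi _; set c := psi _ => H.
  rewrite -lerBlDr; apply: le_trans H.
  by rewrite le_eqVlt; apply/orP; left; apply/eqP; ring.
(* At [t = 1/2] the tangent inequality bounds [J / 2] by [I (1/2)], a finite multiple of [I 1]. Only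
   then can slopes be compared in the reals. *)
have Jlt : (J < +oo)%E.
  have : (2^-1%:E * J <= I 2^-1)%E.
    rewrite -ge0_integralZl//; [|exact/measurable_EFinP|by move=> x _; rewrite lee_fin].
    apply: ge0_le_integral => //.
    - by move=> x _; rewrite -EFinM lee_fin mulr_ge0.
    - by apply/measurable_EFinP; exact: measurable_funM.
    - exact/measurable_EFinP.
    - move=> x _; rewrite -EFinM lee_fin.
      have := le_trans (f0 1 x) (tan 2^-1 x).
      set u := _ * phi _; set v := _ * psi _ => H; lra.
  rewrite IE// => H.
  have : (2^-1%:E * J < +oo)%E.
    by apply: le_lt_trans H _; rewrite lte_mul_pinfty// lee_fin powR_ge0.
  by rewrite !ltey; apply: contra => /eqP ->; rewrite gt0_muley.
have If : I 1 \is a fin_num by rewrite ge0_fin_numE.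
have Jf : J \is a fin_num by rewrite ge0_fin_numE.
rewrite -(fineK If) -(fineK Jf) -EFinM; congr EFin.
apply: powR_tangent => t t0.
rewrite lerBlDr -lee_fin EFinD !EFinM fineK// fineK// -IE//.
(* Integrals of nonnegative functions are added without integrability conditions, so the term with
   [t - 1] is placed on the side where its coefficient is nonnegative. *)
have [t1|t1] := leP 1 t.
  rewrite -ge0_integralZl//; [|exact/measurable_EFinP|by move=> x _; rewrite lee_fin|by rewrite lee_fin subr_ge0].
  rewrite -ge0_integralD//; last 4 first.
  - by move=> x _; rewrite lee_fin.
  - exact/measurable_EFinP.
  - by move=> x _; rewrite -EFinM lee_fin mulr_ge0// subr_ge0.
  - by apply/measurable_EFinP; exact: measurable_funM.
  apply: ge0_le_integral => //.
  - by move=> x _; rewrite lee_fin.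
  - exact/measurable_EFinP.
  - by apply/measurable_EFinP/measurable_funD => //; exact: measurable_funM.
  - by move=> x _; rewrite -EFinM -EFinD lee_fin.
have : (I 1 + (1 - t)%:E * J <= I t)%E.
  rewrite -ge0_integralZl//; [|exact/measurable_EFinP|by move=> x _; rewrite lee_fin|by rewrite lee_fin subr_ge0 ltW].
  rewrite -ge0_integralD//; last 4 first.
  - by move=> x _; rewrite lee_fin.
  - exact/measurable_EFinP.
  - by move=> x _; rewrite -EFinM lee_fin mulr_ge0// subr_ge0 ltW.
  - by apply/measurable_EFinP; exact: measurable_funM.
  apply: ge0_le_integral => //.
  - by move=> x _; rewrite -EFinM -EFinD lee_fin addr_ge0// mulr_ge0// subr_ge0 ltW.
  - by apply/measurable_EFinP/measurable_funD => //; exact: measurable_funM.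
  - exact/measurable_EFinP.
  - move=> x _; rewrite -EFinM -EFinD lee_fin.
    by have := tan t x; set u := _ * phi _; set v := _ * psi _ => H; lra.
have Itf : I t \is a fin_num.
  by rewrite ge0_fin_numE// IE// lte_mul_pinfty// lee_fin powR_ge0.
rewrite -(fineK If) -(fineK Jf) -(fineK Itf) -!EFinM -!EFinD !lee_fin.
move: (fine _) (fine _) (fine _) => a b c; lra.
Qed.

End row_moment.

Section truncated_powers.
Context {R : realType}.

(* Up to sign, each ramp is the derivative of the next one; [ramp0] of the
   p-th powers of the row norms is the indicator function of the ball. *)
Definition ramp0 (u : R) : R := (u <= 1)%R%:R.
Definition ramp1 (u : R) : R := Num.max 0 (1 - u).
Definition ramp2 (u : R) : R := Num.max 0 (1 - u) ^+ 2 / 2.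

Let max01B u : u <= 1 -> Num.max 0 (1 - u) = 1 - u :> R.
Proof. by move=> u1; apply/max_idPr; rewrite subr_ge0. Qed.

Let max01B0 u : 1 < u -> Num.max 0 (1 - u) = 0 :> R.
Proof. by move=> u1; apply/max_idPl; rewrite subr_le0 ltW. Qed.

Lemma ramp0_ge0 u : 0 <= ramp0 u. Proof. exact: ler0n. Qed.
Lemma ramp1_ge0 u : 0 <= ramp1 u. Proof. by rewrite le_max lexx. Qed.
Lemma ramp2_ge0 u : 0 <= ramp2 u.
Proof. by rewrite divr_ge0// sqr_ge0. Qed.

Lemma measurable_ramp0 : measurable_fun setT ramp0.
Proof.
rewrite (_ : ramp0 = \1_`]-oo, 1]%classic); first exact: measurable_indic.
by apply/funext => u; rewrite indicE /ramp0; congr (nat_of_bool _)%:R; rewrite mem_setE in_itv.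
Qed.

Lemma measurable_ramp1 : measurable_fun setT ramp1.
Proof. by apply: measurable_maxr => //; exact: measurable_funB. Qed.

Lemma measurable_ramp2 : measurable_fun setT ramp2.
Proof.
by apply: measurable_funM => //; apply: measurable_funX; exact: measurable_ramp1.
Qed.

Lemma ramp10 u v : ramp1 u - ramp0 u * (v - u) <= ramp1 v.
Proof.
rewrite {1}/ramp1 /ramp0; have [u1|u1] := leP u 1; last first.
  by rewrite max01B0// mul0r subr0 ramp1_ge0.
rewrite max01B// mul1r le_max; apply/orP; right; lra.
Qed.

Lemma ramp21 u v : ramp2 u - ramp1 u * (v - u) <= ramp2 v.
Proof.
rewrite {1}/ramp2 /ramp1; have [u1|u1] := leP u 1; last first.
  by rewrite max01B0// expr0n/= !mul0r subr0 ramp2_ge0.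
rewrite max01B// /ramp2; have [v1|v1] := leP v 1.
  rewrite max01B// -subr_ge0 [leRHS](_ : _ = (u - v) ^+ 2 / 2); last by field.
  by rewrite divr_ge0// sqr_ge0.
rewrite max01B0// -subr_ge0 [leRHS](_ : _ = (1 - u) * ((v - 1) + (v - u)) / 2); last by field.
by rewrite divr_ge0// mulr_ge0//; lra.
Qed.

(** Taken at [u = row_sum x] and integrated, this identity and [ramp1E] become linear equations
    between the integrals of consecutive ramps, since [row_sum] splits into the row terms computed
    by [row_moment_sum]. *)
Lemma ramp0E u : ramp0 u = ramp1 u + u * ramp0 u.
Proof.
rewrite /ramp0 /ramp1; have [u1|u1] := leP u 1.
  by rewrite max01B//= mulr1 subrK.
by rewrite max01B0// mulr0 addr0.
Qed.

Lemma ramp1E u : ramp1 u = 2 * ramp2 u + u * ramp1 u.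
Proof.
rewrite /ramp2 /ramp1; have [u1|u1] := leP u 1.
  by rewrite max01B//; field.
by rewrite max01B0// expr0n/= mul0r !mulr0 addr0.
Qed.

Lemma ramp1_le u : 0 <= u -> ramp1 u <= ramp0 u.
Proof.
move=> u0; rewrite [leRHS]ramp0E lerDl mulr_ge0// ramp0_ge0.
Qed.

Lemma ramp2_le u : 0 <= u -> ramp2 u <= ramp0 u.
Proof.
move=> u0; apply: le_trans (ramp1_le u0); rewrite [leRHS]ramp1E.
have := ramp2_ge0 u; have := mulr_ge0 u0 (ramp1_ge0 u); lra.
Qed.

End truncated_powers.

Section ball_moments.
Context {R : realType} (q : \bar R) (q0 : (0 < q)%E) (m n : nat).
Context (r : R) (r0 : 0 < r).
Implicit Types (x y : 'M[R]_(m, n)).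
Notation lam := (@lebesgue_matrix R m n).
Notation rn := (row_norm q).

Let s i x := rn x i `^ r.
Definition row_sum x := \sum_i rn x i `^ r.

Let rest i x := \sum_(i' < m | i' != i) s i' x.

Let ms i : measurable_fun setT (s i).
Proof.
apply: (@measurableT_comp _ _ _ _ _ _ (@powR R ^~ r)); first exact: measurable_powR.
exact: measurable_row_norm.
Qed.

Let s0 i x : 0 <= s i x. Proof. exact: powR_ge0. Qed.

Lemma measurable_row_sum : measurable_fun setT row_sum.
Proof. by apply: measurable_sum => i; exact: ms. Qed.

Lemma row_sum_ge0 x : 0 <= row_sum x.
Proof. by apply: sumr_ge0 => i _; exact: powR_ge0. Qed.

Let SE i x : row_sum x = s i x + rest i x.
Proof. by rewrite /row_sum (bigD1 i). Qed.

Lemma row_moment_sum (phi psi : R -> R) (k : nat) i :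
  measurable_fun setT phi -> measurable_fun setT psi ->
  (forall u, 0 <= phi u) -> (forall u, 0 <= psi u) ->
  (forall u v, phi u - psi u * (v - u) <= phi v) ->
  (\int[lam]_x (rn x i `^ r ^+ k * phi (row_sum x))%:E < +oo)%E ->
  (\int[lam]_x (rn x i `^ r ^+ k.+1 * psi (row_sum x))%:E =
   (n%:R / r + k%:R)%:E * \int[lam]_x (rn x i `^ r ^+ k * phi (row_sum x))%:E)%E.
Proof.
move=> mphi mpsi phi0 psi0 pp.
under eq_integral do rewrite (SE i).
under [in X in _ -> X = _]eq_integral do rewrite (SE i).
apply: row_moment => //.
- rewrite /rest; under eq_fun do rewrite big_mkcond; apply: measurable_sum => i'.
  by case: (i' != i).
- move=> c x c0; apply: eq_bigr => i' /negPf i'i.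
  by rewrite /s row_norm_scale// /one_row i'i ?mul1r.
Qed.

Let a := n%:R / r.
Variable L : R.
Hypothesis LE : (\int[lam]_x (ramp0 (row_sum x))%:E = L%:E)%E.

Let mt (f : R -> R) : measurable_fun setT f ->
  measurable_fun setT (fun x => (f (row_sum x))%:E).
Proof.
by move=> mf; apply/measurable_EFinP; apply: (measurableT_comp mf); exact: measurable_row_sum.
Qed.

Let fint (f : 'M[R]_(m, n) -> R) : measurable_fun setT f -> (forall x, 0 <= f x) ->
  (forall x, f x <= ramp0 (row_sum x)) -> (\int[lam]_x (f x)%:E < +oo)%E.
Proof.
move=> mf f0 fle; apply: (@le_lt_trans _ _ L%:E); last exact: ltry.
rewrite -LE; apply: ge0_le_integral => //.
- by move=> x _; rewrite lee_fin.
- exact/measurable_EFinP.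
- by apply: mt; exact: measurable_ramp0.
- by move=> x _; rewrite lee_fin.
Qed.

(** With [J1], [J2] the integrals of [ramp1], [ramp2], the row moments are [a * J1] and
    [(a + 1) * a * J2], while the ramp identities give [L = (m a + 1) J1] and [J1 = (m a + 2) J2].
    The results, divided by [L], are the moments of a Dirichlet law with parameters a, ..., a, 1. *)
Lemma ball_moments (i : 'I_m) :
  (\int[lam]_x (rn x i `^ r * ramp0 (row_sum x))%:E =
    (L * (a / (m%:R * a + 1)))%:E)%E /\
  (\int[lam]_x (rn x i `^ r ^+ 2 * ramp0 (row_sum x))%:E =
    (L * (a * (a + 1) / ((m%:R * a + 1) * (m%:R * a + 2))))%:E)%E.
Proof.
have a0 : 0 <= a by rewrite divr_ge0// ltW.
have m0 : 0 <= m%:R * a by rewrite mulr_ge0.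
pose J1 := (\int[lam]_x (ramp1 (row_sum x))%:E)%E.
pose J2 := (\int[lam]_x (ramp2 (row_sum x))%:E)%E.
have mt0 := @measurable_ramp0 R.
have mt1 := @measurable_ramp1 R.
have mt2 := @measurable_ramp2 R.
have J1f : J1 \is a fin_num.
  rewrite ge0_fin_numE; last by apply: integral_ge0 => x _; rewrite lee_fin ramp1_ge0.
  apply: fint; first by apply/measurable_EFinP; exact: mt.
    by move=> x; exact: ramp1_ge0.
  by move=> x; exact/ramp1_le/row_sum_ge0.
have J2f : J2 \is a fin_num.
  rewrite ge0_fin_numE; last by apply: integral_ge0 => x _; rewrite lee_fin ramp2_ge0.
  apply: fint; first by apply/measurable_EFinP; exact: mt.
    by move=> x; exact: ramp2_ge0.
  by move=> x; exact/ramp2_le/row_sum_ge0.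
have e0 i' (f : R -> R) : (\int[lam]_x (rn x i' `^ r ^+ 0 * f (row_sum x))%:E =
    \int[lam]_x (f (row_sum x))%:E)%E.
  by apply: eq_integral => x _; rewrite mul1r.
have e1 i' (f : R -> R) : (\int[lam]_x (rn x i' `^ r ^+ 1 * f (row_sum x))%:E =
    \int[lam]_x (s i' x * f (row_sum x))%:E)%E.
  by apply: eq_integral => x _; rewrite expr1.
have M1 i' : (\int[lam]_x (s i' x * ramp0 (row_sum x))%:E = a%:E * J1)%E.
  have := @row_moment_sum _ _ 0 i' mt1 mt0 ramp1_ge0 ramp0_ge0 ramp10.
  rewrite addr0.
  rewrite e0 e1.
  by apply; rewrite -ge0_fin_numE//; apply: integral_ge0 => x _; rewrite lee_fin ramp1_ge0.
have M2 i' : (\int[lam]_x (s i' x * ramp1 (row_sum x))%:E = a%:E * J2)%E.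
  have := @row_moment_sum _ _ 0 i' mt2 mt1 ramp2_ge0 ramp1_ge0 ramp21.
  rewrite addr0.
  rewrite e0 e1.
  by apply; rewrite -ge0_fin_numE//; apply: integral_ge0 => x _; rewrite lee_fin ramp2_ge0.
have M3 : (\int[lam]_x (s i x ^+ 2 * ramp0 (row_sum x))%:E = (a + 1)%:E * (a%:E * J2))%E.
  have := @row_moment_sum _ _ 1 i mt1 mt0 ramp1_ge0 ramp0_ge0 ramp10.
  rewrite e1 M2; apply; rewrite -(fineK J2f) -EFinM; exact: ltry.
have sumE (f : R -> R) : measurable_fun setT f -> (forall u, 0 <= f u) ->
   (\int[lam]_x (row_sum x * f (row_sum x))%:E =
     \sum_(i' < m) \int[lam]_x (s i' x * f (row_sum x))%:E)%E.
  move=> mf f0; rewrite -ge0_integral_sum//; last 2 first.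
  - move=> i'; apply/measurable_EFinP/measurable_funM => //.
    by apply/measurable_EFinP; exact: mt.
  - by move=> i' x _; rewrite lee_fin mulr_ge0.
  by apply: eq_integral => x _; rewrite sumEFin -mulr_suml.
have E1 : L%:E = (J1 + \sum_(i' < m) a%:E * J1)%E.
  rewrite -LE; under eq_integral do rewrite ramp0E EFinD.
  rewrite ge0_integralD//; last 4 first.
  - by move=> x _; rewrite lee_fin ramp1_ge0.
  - exact: mt.
  - by move=> x _; rewrite lee_fin mulr_ge0 ?row_sum_ge0 ?ramp0_ge0.
  - apply/measurable_EFinP/measurable_funM; first exact: measurable_row_sum.
    by apply/measurable_EFinP; exact: mt.
  rewrite (sumE _ mt0 ramp0_ge0).
  by congr (_ + _)%E; apply: eq_bigr => i' _; exact: M1.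
have E2 : J1 = (2%:E * J2 + \sum_(i' < m) a%:E * J2)%E.
  rewrite /J1; under eq_integral do rewrite ramp1E EFinD EFinM.
  rewrite ge0_integralD//; last 4 first.
  - by move=> x _; rewrite -EFinM lee_fin mulr_ge0 ?ramp2_ge0.
  - by apply: measurable_funeM; exact: mt.
  - by move=> x _; rewrite lee_fin mulr_ge0 ?row_sum_ge0 ?ramp1_ge0.
  - apply/measurable_EFinP/measurable_funM; first exact: measurable_row_sum.
    by apply/measurable_EFinP; exact: mt.
  rewrite ge0_integralZl//; last 2 first.
  - exact: mt.
  - by move=> x _; rewrite lee_fin ramp2_ge0.
  rewrite (sumE _ mt1 ramp1_ge0).
  by congr (_ + _)%E; apply: eq_bigr => i' _; exact: M2.
rewrite M1 M3.
move: E1 E2; rewrite -(fineK J1f) -(fineK J2f) -!EFinM !sumEFin -!EFinD.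
move: (fine J1) (fine J2) => j1 j2 EE1 EE2.
move: (EFin_inj EE1) (EFin_inj EE2).
rewrite !sumr_const card_ord -(mulr_natl (a * j1)) -(mulr_natl (a * j2)) => E1 E2.
have p1 : m%:R * a + 1 != 0 by rewrite gt_eqF// ltr_wpDl.
have p2 : m%:R * a + 2 != 0 by rewrite gt_eqF// ltr_wpDl.
split; congr EFin.
  by rewrite E1; field.
by rewrite E1 E2; field; rewrite p1 p2.
Qed.

End ball_moments.

(** * Deviation inequalities for the row norms *)

Section density_chebyshev.
Context {R : realType} d (T : measurableType d) (mu : {measure set T -> \bar R}).
Variables (G u : T -> R) (a1 a2 c : R).
Hypotheses (mG : measurable_fun setT G) (mu_ : measurable_fun setT u).
Hypotheses (G0 : forall x, 0 <= G x) (u0 : forall x, 0 <= u x) (c0 : 0 <= c).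
Hypothesis G1 : (\int[mu]_x (G x)%:E = 1)%E.
Hypothesis uG1 : (\int[mu]_x (u x * G x)%:E = a1%:E)%E.
Hypothesis uG2 : (\int[mu]_x (u x ^+ 2 * G x)%:E = a2%:E)%E.

Lemma density_chebyshev (e : R) : 0 < e ->
  (\int[mu]_(x in [set x | e <= `|u x - c|]%R) (G x)%:E
    <= ((a2 - 2 * c * a1 + c ^+ 2) / e ^+ 2)%:E)%E.
Proof.
move=> e0.
pose v x := (u x - c) ^+ 2 * G x.
have mv : measurable_fun setT v.
  by apply: measurable_funM => //; apply: measurable_funX; exact: measurable_funB.
have v0 x : 0 <= v x by rewrite mulr_ge0// sqr_ge0.
have muG : measurable_fun setT (fun x => (2 * c * (u x * G x))%:E).
  by apply/measurable_EFinP; apply: measurable_funM => //; exact: measurable_funM.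
have mcG : measurable_fun setT (fun x => (c ^+ 2 * G x)%:E).
  by apply/measurable_EFinP; exact: measurable_funM.
have uGE : (\int[mu]_x (2 * c * (u x * G x))%:E = (2 * c * a1)%:E)%E.
  under eq_integral do rewrite EFinM.
  rewrite ge0_integralZl//; first by rewrite uG1 -EFinM.
  - by apply/measurable_EFinP; exact: measurable_funM.
  - by move=> x _; rewrite lee_fin mulr_ge0.
  - by rewrite lee_fin mulr_ge0.
have cGE : (\int[mu]_x (c ^+ 2 * G x)%:E = (c ^+ 2)%:E)%E.
  under eq_integral do rewrite EFinM.
  rewrite ge0_integralZl//; first by rewrite G1 mule1.
  - exact/measurable_EFinP.
  - by move=> x _; rewrite lee_fin.
  - by rewrite lee_fin sqr_ge0.
have vE : (\int[mu]_x (v x)%:E = (a2 - 2 * c * a1 + c ^+ 2)%:E)%E.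
  (* The square is expanded with the cross term moved to the left, so that every integrand is
     nonnegative; subtraction waits until all terms are known to be finite. *)
  have : (\int[mu]_x (v x)%:E + \int[mu]_x (2 * c * (u x * G x))%:E =
     \int[mu]_x (u x ^+ 2 * G x)%:E + \int[mu]_x (c ^+ 2 * G x)%:E)%E.
    rewrite -!ge0_integralD//.
    - apply: eq_integral => x _; rewrite -!EFinD; congr EFin.
      by rewrite /v; ring.
    - by move=> x _; rewrite lee_fin mulr_ge0// sqr_ge0.
    - by apply/measurable_EFinP; apply: measurable_funM => //; exact: measurable_funX.
    - by move=> x _; rewrite lee_fin mulr_ge0// sqr_ge0.
    - by move=> x _; rewrite lee_fin.
    - exact/measurable_EFinP.
    - by move=> x _; rewrite lee_fin !mulr_ge0.
  rewrite uGE uG2 cGE -EFinD => h.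
  have ca1 : 0 <= 2 * c * a1.
    rewrite mulr_ge0 ?mulr_ge0// -lee_fin -uG1.
    by apply: integral_ge0 => x _; rewrite lee_fin mulr_ge0.
  have vf : (\int[mu]_x (v x)%:E)%E \is a fin_num.
    rewrite ge0_fin_numE; last by apply: integral_ge0 => x _; rewrite lee_fin.
    apply: (@le_lt_trans _ _ (a2 + c ^+ 2)%:E); last exact: ltry.
    by rewrite -h leeDl// lee_fin.
  have h2 : fine (\int[mu]_x (v x)%:E)%E + 2 * c * a1 = a2 + c ^+ 2.
    by apply: EFin_inj; rewrite EFinD fineK.
  by rewrite -(fineK vf); congr EFin; lra.
have mA : measurable [set x | (e <= `|u x - c|)%R].
  rewrite -[X in measurable X]setTI.
  apply: (measurable_fun_le (f := cst e)) => //.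
  by apply: measurableT_comp => //; exact: measurable_funB.
rewrite EFinM -vE muleC -ge0_integralZl//; last 3 first.
- exact/measurable_EFinP.
- by move=> x _; rewrite lee_fin.
- by rewrite lee_fin invr_ge0 exprn_ge0// ltW.
apply: (@le_trans _ _ (\int[mu]_(x in [set x | (e <= `|u x - c|)%R]) ((e ^+ 2)^-1%:E * (v x)%:E)))%E.
  apply: ge0_le_integral => //.
  - by move=> x _; rewrite lee_fin.
  - by apply/measurable_EFinP; exact: measurable_funTS.
  - by apply: measurable_funTS; apply/measurable_EFinP; exact: measurable_funM.
  - move=> x /= ex; rewrite -EFinM lee_fin /v mulrA ler_peMl// mulrC ler_pdivlMr ?exprn_gt0// mul1r.
    by rewrite -[leRHS]real_normK ?num_real// lerXn2r// nnegrE ltW.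
apply: ge0_subset_integral => //.
- by apply/measurable_EFinP; exact: measurable_funM.
- by move=> x _; rewrite -EFinM lee_fin mulr_ge0// invr_ge0 exprn_ge0// ltW.
Qed.

End density_chebyshev.

Section radial_deviations.
Context {R : realType} (q : \bar R) (q0 : (0 < q)%E) (m n : nat) (n0 : (0 < n)%N).
Context (r : R) (r0 : 0 < r).
Implicit Types (x y : 'M[R]_(m, n)).
Notation lam := (@lebesgue_matrix R m n).
Notation rn := (row_norm q).

Let ms (i : 'I_m) : measurable_fun setT (fun x : 'M[R]_(m, n) => rn x i `^ r).
Proof.
apply: (@measurableT_comp _ _ _ _ _ _ (@powR R ^~ r)); first exact: measurable_powR.
exact: measurable_row_norm.
Qed.

(** The exponential is convex and proportional to its own subgradient, so [row_moment_sum] yields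
    the moments [n] and [n (n + r)]. They are those of a Gamma law of shape [n / r] and scale [r];
    after division by [n] the variance is [r / n]. *)
Lemma expR_deviation (C : R) (G : 'M[R]_(m, n) -> R) (i : 'I_m) (e : R) :
  0 <= C -> (forall y, G y = C * expR (- (row_sum q r y / r))) ->
  (\int[lam]_y (G y)%:E = 1)%E -> 0 < e ->
  (\int[lam]_(y in [set y | e <= `|rn y i `^ r / n%:R - 1|]%R) (G y)%:E <=
    (r / n%:R / e ^+ 2)%:E)%E.
Proof.
move=> C0 GE G1 e0.
have N0 : n%:R != 0 :> R by rewrite pnatr_eq0 -lt0n.
pose phi (u : R) : R := C * expR (- (u / r)).
pose psi (u : R) : R := r^-1 * phi u.
have phi0 u : 0 <= phi u by rewrite mulr_ge0// expR_ge0.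
have psi0 u : 0 <= psi u by rewrite mulr_ge0// invr_ge0 ltW.
have mphi : measurable_fun setT phi.
  apply: measurable_funM => //; apply: measurableT_comp => //.
  by apply: measurableT_comp => //; exact: measurable_funM.
have mpsi : measurable_fun setT psi by exact: measurable_funM.
have pp u v : phi u - psi u * (v - u) <= phi v.
  rewrite /psi /phi [leLHS](_ : _ = C * (expR (- (u / r)) * (1 + (u / r - v / r)))); last by ring.
  have -> : expR (- (v / r)) = expR (- (u / r)) * expR (u / r - v / r).
    by rewrite -expRD; congr expR; ring.
  by rewrite ler_wpM2l// ler_wpM2l ?expR_ge0// expR_ge1Dx.
have mG : measurable_fun setT G.
  rewrite (_ : G = phi \o row_sum q r); last exact/funext.
  by apply: measurableT_comp => //; exact: measurable_row_sum.
have G0 y : 0 <= G y by rewrite GE; exact: phi0.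
have E1 : (\int[lam]_y (rn y i `^ r * G y)%:E = n%:R%:E)%E.
  have := @row_moment_sum R q q0 m n r r0 _ _ 0 i mphi mpsi phi0 psi0 pp.
  have -> : (\int[lam]_x (rn x i `^ r ^+ 0 * phi (row_sum q r x))%:E = 1)%E.
    by rewrite -G1; apply: eq_integral => x _; rewrite mul1r GE.
  rewrite addr0 mule1 => /(_ (ltry _)) h.
  have : (r%:E * \int[lam]_x (rn x i `^ r ^+ 1 * psi (row_sum q r x))%:E = n%:R%:E)%E.
    by rewrite h -EFinM mulrC divfK// gt_eqF.
  rewrite -ge0_integralZl//; last 3 first.
  - apply/measurable_EFinP/measurable_funM; first exact: measurable_funX.
    by apply: measurableT_comp => //; exact: measurable_row_sum.
  - by move=> x _; rewrite lee_fin mulr_ge0// exprn_ge0// powR_ge0.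
  - by rewrite lee_fin ltW.
  move=> <-; apply: eq_integral => x _; rewrite -EFinM expr1 GE; congr EFin.
  by rewrite /psi /phi; field; rewrite gt_eqF.
have E2 : (\int[lam]_y ((rn y i `^ r) ^+ 2 * G y)%:E = (n%:R * (n%:R + r))%:E)%E.
  have := @row_moment_sum R q q0 m n r r0 _ _ 1 i mphi mpsi phi0 psi0 pp.
  have -> : (\int[lam]_x (rn x i `^ r ^+ 1 * phi (row_sum q r x))%:E = n%:R%:E)%E.
    by rewrite -E1; apply: eq_integral => x _; rewrite expr1 GE.
  move=> /(_ (ltry _)) h.
  have : (r%:E * \int[lam]_x (rn x i `^ r ^+ 2 * psi (row_sum q r x))%:E = (n%:R * (n%:R + r))%:E)%E.
    by rewrite h -!EFinM; congr EFin; field; rewrite gt_eqF.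
  rewrite -ge0_integralZl//; last 3 first.
  - apply/measurable_EFinP/measurable_funM; first exact: measurable_funX.
    by apply: measurableT_comp => //; exact: measurable_row_sum.
  - by move=> x _; rewrite lee_fin mulr_ge0// exprn_ge0// powR_ge0.
  - by rewrite lee_fin ltW.
  move=> <-; apply: eq_integral => x _; rewrite -EFinM GE; congr EFin.
  by rewrite /psi /phi; field; rewrite gt_eqF.
have mu1 : measurable_fun setT (fun y : 'M[R]_(m, n) => rn y i `^ r / n%:R).
  by apply: measurable_funM => //.
have := @density_chebyshev R _ _ lam G (fun y => rn y i `^ r / n%:R) 1
  ((n%:R + r) / n%:R) 1 mG mu1 G0 _ ler01 G1 _ _ e e0.
rewrite (_ : (n%:R + r) / n%:R - 2 * 1 * 1 + 1 ^+ 2 = r / n%:R); last by field.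
apply.
- by move=> y; rewrite divr_ge0// powR_ge0.
- transitivity (n%:R^-1%:E * \int[lam]_y (rn y i `^ r * G y)%:E)%E.
    rewrite -ge0_integralZl//.
    + by apply: eq_integral => x _; rewrite -EFinM; congr EFin; ring.
    + by apply/measurable_EFinP; exact: measurable_funM.
    + by move=> y _; rewrite lee_fin mulr_ge0// powR_ge0.
  by rewrite E1 -EFinM mulVf.
- transitivity ((n%:R ^- 2)%:E * \int[lam]_y ((rn y i `^ r) ^+ 2 * G y)%:E)%E.
    rewrite -ge0_integralZl//.
    + by apply: eq_integral => x _; rewrite -EFinM; congr EFin; rewrite exprMn exprVn; ring.
    + by apply/measurable_EFinP; apply: measurable_funM => //; exact: measurable_funX.
    + by move=> y _; rewrite lee_fin mulr_ge0// exprn_ge0// powR_ge0.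
  by rewrite E2 -EFinM; congr EFin; field.
Qed.

(** Chebyshev's inequality about 1 with the Dirichlet moments; the point is a bound in which [m] no
    longer appears. *)
Lemma ball_deviation (L : R) (i : 'I_m) (e : R) : 0 < L ->
  (\int[lam]_y (ramp0 (row_sum q r y))%:E = L%:E)%E -> 0 < e ->
  (\int[lam]_(y in [set y | e <= `|m%:R * rn y i `^ r - 1|]%R)
      (L^-1 * ramp0 (row_sum q r y))%:E <=
    (r / n%:R / e ^+ 2)%:E)%E.
Proof.
move=> L0 LE e0.
have N0 : 0 < n%:R :> R by rewrite ltr0n.
have m1 : 1 <= m%:R :> R by rewrite ler1n; exact: leq_ltn_trans (ltn_ord i).
have [E1 E2] := ball_moments q0 r0 LE i.
set a := n%:R / r in E1 E2.
have a0 : 0 < a by rewrite divr_gt0.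
pose G y := L^-1 * ramp0 (row_sum q r y) : R.
have mr : measurable_fun setT (fun y : 'M[R]_(m, n) => ramp0 (row_sum q r y)).
  by apply: measurableT_comp; [exact: measurable_ramp0|exact: measurable_row_sum].
have mG : measurable_fun setT G by exact: measurable_funM.
have G0 y : 0 <= G y by rewrite mulr_ge0// ?ramp0_ge0// invr_ge0 ltW.
have GE (f : 'M[R]_(m, n) -> R) (c : R) : measurable_fun setT f -> (forall y, 0 <= f y) ->
    (\int[lam]_y (f y * ramp0 (row_sum q r y))%:E = (L * c)%:E)%E ->
    (\int[lam]_y (f y * G y)%:E = c%:E)%E.
  move=> mf f0 h.
  transitivity (L^-1%:E * \int[lam]_y (f y * ramp0 (row_sum q r y))%:E)%E.
    rewrite -ge0_integralZl//.
    - by apply: eq_integral => x _; rewrite -EFinM; congr EFin; rewrite /G; ring.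
    - by apply/measurable_EFinP; exact: measurable_funM.
    - by move=> y _; rewrite lee_fin mulr_ge0// ramp0_ge0.
    - by rewrite lee_fin invr_ge0 ltW.
  by rewrite h -EFinM mulKf// gt_eqF.
pose M := m%:R * a.
have M0 : 0 < M by rewrite mulr_gt0// (lt_le_trans _ m1).
have p1 : M + 1 != 0 by rewrite gt_eqF// addr_gt0.
have p2 : M + 2 != 0 by rewrite gt_eqF// addr_gt0.
have mu1 : measurable_fun setT (fun y : 'M[R]_(m, n) => m%:R * rn y i `^ r).
  by apply: measurable_funM => //.
have cheb := @density_chebyshev R _ _ lam G (fun y => m%:R * rn y i `^ r)
  (m%:R * (a / (M + 1))) (m%:R ^+ 2 * (a * (a + 1) / ((M + 1) * (M + 2)))) 1
  mG mu1 G0 _ ler01 _ _ _ e e0.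
apply: le_trans; first apply: cheb.
- by move=> y; rewrite mulr_ge0// powR_ge0.
- transitivity (\int[lam]_y (1 * G y)%:E)%E.
    by apply: eq_integral => y _; rewrite mul1r.
  apply: (GE (cst 1)) => //; rewrite mulr1 -LE.
  by apply: eq_integral => y _; rewrite mul1r.
- apply: (GE (fun y => m%:R * rn y i `^ r)) => //.
    by move=> y; rewrite mulr_ge0// powR_ge0.
  transitivity (m%:R%:E * \int[lam]_y (rn y i `^ r * ramp0 (row_sum q r y))%:E)%E.
    rewrite -ge0_integralZl//.
    + by apply: eq_integral => x _; rewrite -EFinM; congr EFin; ring.
    + by apply/measurable_EFinP; exact: measurable_funM.
    + by move=> y _; rewrite lee_fin mulr_ge0 ?ramp0_ge0 ?powR_ge0.
  by rewrite E1 -EFinM; congr EFin; rewrite /M; ring.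
- apply: (GE (fun y => (m%:R * rn y i `^ r) ^+ 2)).
  + exact: measurable_funX.
  + by move=> y; rewrite sqr_ge0.
  transitivity ((m%:R ^+ 2)%:E * \int[lam]_y ((rn y i `^ r) ^+ 2 * ramp0 (row_sum q r y))%:E)%E.
    rewrite -ge0_integralZl//.
    + by apply: eq_integral => x _; rewrite -EFinM; congr EFin; rewrite exprMn; ring.
    + by apply/measurable_EFinP; apply: measurable_funM => //; exact: measurable_funX.
    + by move=> y _; rewrite lee_fin mulr_ge0 ?ramp0_ge0 ?sqr_ge0.
  by rewrite E2 -EFinM; congr EFin; rewrite /M; ring.
rewrite lee_fin ler_wpM2r ?invr_ge0 ?sqr_ge0//.
(* With [M = m n / r], the mean square distance to 1 is [(m M - M + 2) / ((M + 1)(M + 2))], and for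
   [m >= 1] it is at most [m / M]. *)
have -> : r / n%:R = m%:R / M.
  rewrite /M /a; field; rewrite !gt_eqF//; exact: lt_le_trans m1.
rewrite [leLHS](_ : _ = (m%:R * M - M + 2) / ((M + 1) * (M + 2))); last first.
  by move: p1 p2; rewrite /M => p1 p2; field; rewrite p1 p2.
rewrite ler_pdivrMr ?mulr_gt0 ?addr_gt0// mulrAC ler_pdivlMr//.
by have := mulr_ge0 (ltW M0) (ltW M0); nra.
Qed.

(** On the support of [G], a deviation means that row [i] has norm at most [1 - e]. Stretching this
    row by [1/(1 - e)] stays in the support, and the change of variables contributes [(1 - e)^n].
    This covers [q = +oo] for the Gaussian law and [p = +oo] for the ball. *)
Lemma cube_deviation (C : R) (G : 'M[R]_(m, n) -> R) (i : 'I_m) (e : R) :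
  0 <= C -> (forall y, G y = C * \1_[set y | forall i, rn y i <= 1]%R y) ->
  (\int[lam]_y (G y)%:E = 1)%E -> 0 < e < 1 ->
  (\int[lam]_(y in [set y | e <= `|rn y i - 1|]%R) (G y)%:E <=
    ((1 - e) ^+ n)%:E)%E.
Proof.
move=> C0 GE G1 /andP[e0 e1].
have mB : measurable [set y : 'M[R]_(m, n) | forall i, rn y i <= 1].
  rewrite (_ : mkset _ = \bigcap_(i in [set: 'I_m])
      ((fun x => rn x i) @^-1` `]-oo, 1])).
    apply: fin_bigcap_measurable => [|i' _]; first exact: finite_finset.
    by rewrite -[X in measurable X]setTI; exact: measurable_row_norm.
  apply/seteqP; split=> [x Ux i' _|x Ux i']; first by rewrite /= in_itv/= Ux.
  by have := Ux i' I; rewrite /= in_itv/=.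
have mG : measurable_fun setT G.
  rewrite (_ : G = fun y => C * \1_[set y | forall i, rn y i <= 1] y); last exact/funext.
  by apply: measurable_funM => //; exact: measurable_indic.
have G0 y : 0 <= G y by rewrite GE mulr_ge0.
have d0 : 0 < 1 - e by rewrite subr_gt0.
have mA : measurable [set y : 'M[R]_(m, n) | (e <= `|rn y i - 1|)%R].
  rewrite -[X in measurable X]setTI.
  apply: (measurable_fun_le (f := cst e)) => //.
  by apply: measurableT_comp => //; apply: measurable_funB => //; exact: measurable_row_norm.
have := @integral_one_row R m n i (1 - e)^-1 G.
rewrite invr_gt0 G1 mule1 exprVn invrK => /(_ d0 mG G0) <-.
rewrite integral_mkcond; apply: ge0_le_integral => //.
- by move=> y _; rewrite /patch; case: ifP => // _; rewrite lee_fin.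
- by apply/(measurable_restrictT _ _).1 => //; exact/measurable_funTS/measurable_EFinP.
- apply/measurable_EFinP; apply: (measurableT_comp mG); exact: measurable_mx_scale.
move=> y _; rewrite /patch; case: ifPn => [|_]; last by rewrite lee_fin.
rewrite inE /= => ey; rewrite lee_fin !GE ler_wpM2l// !indicE ler_nat.
case: (boolP (y \in _)) => //; rewrite inE /= => yB.
rewrite mem_set// => i'; rewrite row_norm_scale//; last first.
  by rewrite /one_row; case: ifP => // _; rewrite invr_ge0 ltW.
rewrite /one_row; case: eqP => [->|_]; last by rewrite mul1r.
rewrite mulrC ler_pdivrMr// mul1r.
by move: ey; rewrite ler0_norm ?subr_le0//; lra.
Qed.

End radial_deviations.

(** * The coupling *)

Section density.
Context {R : realType} d (T : measurableType d) (mu : {measure set T -> \bar R}).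
Variable G : T -> R.
Hypotheses (mG : measurable_fun setT G) (G0 : forall x, 0 <= G x).

Definition density_measure (A : set T) : \bar R := (\int[mu]_(x in A) (G x)%:E)%E.

Let mGE : measurable_fun setT (fun x => (G x)%:E).
Proof. exact/measurable_EFinP. Qed.

Let density0 : density_measure set0 = 0%E.
Proof. by rewrite /density_measure integral_set0. Qed.

Let density_ge0 A : (0 <= density_measure A)%E.
Proof. by apply: integral_ge0 => x _; rewrite lee_fin. Qed.

Let density_sigma_additive : semi_sigma_additive density_measure.
Proof. by apply: semi_sigma_additive_nng_induced => // x; rewrite lee_fin. Qed.

HB.instance Definition _ := isMeasure.Build _ _ _ density_measure
  density0 density_ge0 density_sigma_additive.

Lemma density_measure_exists :
  {nu : {measure set T -> \bar R} | forall A, nu A = (\int[mu]_(x in A) (G x)%:E)%E}.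
Proof. by exists density_measure. Qed.

Hypothesis G1 : (\int[mu]_x (G x)%:E = 1)%E.

HB.instance Definition _ := Measure_isProbability.Build _ _ _ density_measure G1.

Lemma density_probability :
  {nu : probability T R | forall A, nu A = (\int[mu]_(x in A) (G x)%:E)%E}.
Proof. by exists density_measure. Qed.

End density.

Section product_density.
Context {R : realType} d1 d2 (T1 : measurableType d1) (T2 : measurableType d2).
Variables (l1 : {sigma_finite_measure set T1 -> \bar R})
  (l2 : {sigma_finite_measure set T2 -> \bar R}).
Variables (G1 : T1 -> R) (G2 : T2 -> R).
Hypotheses (mG1 : measurable_fun setT G1) (mG2 : measurable_fun setT G2).
Hypotheses (G10 : forall x, 0 <= G1 x) (G20 : forall x, 0 <= G2 x).
Variables (m1 : probability T1 R) (m2 : probability T2 R).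
Hypothesis m1E : forall A, measurable A -> m1 A = (\int[l1]_(x in A) (G1 x)%:E)%E.
Hypothesis m2E : forall A, measurable A -> m2 A = (\int[l2]_(x in A) (G2 x)%:E)%E.

(** By Tonelli's theorem the measure with density [G1 * G2] factors on rectangles, and these
    determine the product measure. *)
Lemma product_density (S : set (T1 * T2)) : measurable S ->
  ((m1 \x m2) S =
   \int[l1]_x \int[l2]_y (\1_S (x, y) * (G1 x * G2 y))%:E)%E.
Proof.
move=> mS.
pose H (z : T1 * T2) := G1 z.1 * G2 z.2.
have mH : measurable_fun setT H.
  by apply: measurable_funM; apply: measurableT_comp.
have H0 z : 0 <= H z by rewrite mulr_ge0.
have [nu nuE] := density_measure_exists (l1 \x l2)%E mH H0.
have nuS A : measurable A -> nu A = (\int[l1]_x \int[l2]_y (\1_A (x, y) * H (x, y))%:E)%E.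
  move=> mA; rewrite nuE integral_mkcond -(fubini_tonelli1 (m1 := l1) (m2 := l2) (fun z => (\1_A z * H z)%:E)).
  - apply: eq_integral => z _; rewrite /patch indicE; case: ifP => _; first by rewrite mul1r.
    by rewrite mul0r.
  - by apply/measurable_EFinP; apply: measurable_funM => //; exact: measurable_indic.
  - by move=> z; rewrite lee_fin mulr_ge0.
transitivity (nu S); last exact: nuS.
apply: product_measure_unique => // A B mA mB.
rewrite nuS; last exact: measurableX.
transitivity ((\int[l1]_(x in A) (G1 x)%:E) * \int[l2]_(x in B) (G2 x)%:E)%E; last first.
  by congr (_ * _)%E; apply/esym; [exact: m1E|exact: m2E].
rewrite [in RHS]integral_mkcond [in X in (_ * X)%E]integral_mkcond.
have p1 A' (G : T1 -> R) x : (((fun x => (G x)%:E) \_ A') x = (\1_A' x * G x)%:E)%E.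
  by rewrite /patch indicE; case: ifP => _; rewrite ?mul1r ?mul0r.
have p2 A' (G : T2 -> R) x : (((fun x => (G x)%:E) \_ A') x = (\1_A' x * G x)%:E)%E.
  by rewrite /patch indicE; case: ifP => _; rewrite ?mul1r ?mul0r.
under [in RHS]eq_integral do rewrite p1.
under [X in (_ * X)%E]eq_integral do rewrite p2.
rewrite -ge0_integralZr//; last 3 first.
- by apply/measurable_EFinP; apply: measurable_funM => //; exact: measurable_indic.
- by move=> x _; rewrite lee_fin mulr_ge0.
- by apply: integral_ge0 => x _; rewrite lee_fin mulr_ge0.
apply: eq_integral => x _; rewrite -ge0_integralZl//.
- apply: eq_integral => y _; rewrite -EFinM /H /= !indicE in_setX -mulnb natrM.
  by congr EFin; ring.
- by apply/measurable_EFinP; apply: measurable_funM => //; exact: measurable_indic.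
- by move=> y _; rewrite lee_fin mulr_ge0.
- by rewrite lee_fin mulr_ge0.
Qed.

End product_density.

Section exchange_law.
Context {R : realType} (q : \bar R) (q0 : (0 < q)%E) (m n : nat) (n0 : (0 < n)%N).
Implicit Types (x y : 'M[R]_(m, n)).
Notation lam := (@lebesgue_matrix R m n).
Notation rn := (row_norm q).
Notation U := (@full_rows R q m n).
Variables (G : 'M[R]_(m, n) -> R) (B : set 'M[R]_(m, n)) (L : R).
Hypothesis mG : measurable_fun setT G.
Hypothesis G0 : forall x, 0 <= G x.
Hypothesis Gnorm : forall x y, rn x =1 rn y -> G x = G y.
Hypothesis mB : measurable B.
Hypothesis Bnorm : forall x y, rn x =1 rn y -> B x -> B y.
Hypotheses (L0 : 0 < L) (LE : lam B = L%:E).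
Variables mu gam : probability 'M[R]_(m, n) R.
Hypothesis muE : forall A, measurable A -> mu A = (lam (A `&` B) / lam B)%E.
Hypothesis gamE : forall A, measurable A -> gam A = (\int[lam]_(y in A) (G y)%:E)%E.

Let T2 := ('M[R]_(m, n) * 'M[R]_(m, n))%type.
Let mU : measurable U. Proof. exact: measurable_full_rows. Qed.
Let U0 : lam (~` U) = 0%E. Proof. exact: lebesgue_full_rowsC. Qed.

Let GB x : R := L^-1 * \1_B x.

Let mGB : measurable_fun setT GB.
Proof. by apply: measurable_funM => //; exact: measurable_indic. Qed.

Let GB0 x : 0 <= GB x. Proof. by rewrite mulr_ge0// invr_ge0 ltW. Qed.

Lemma ball_densityE A : measurable A -> mu A = (\int[lam]_(x in A) (L^-1 * \1_B x)%:E)%E.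
Proof.
move=> mA; rewrite muE// LE inver gt_eqF//.
under eq_integral do rewrite EFinM.
rewrite ge0_integralZl//; last 2 first.
- by apply/measurable_EFinP; apply: measurable_funTS; exact: measurable_indic.
- by rewrite lee_fin invr_ge0 ltW.
by rewrite integral_indic// muleC setIC.
Qed.

Let S A : set T2 := [set z | A (exchange q z.1 z.2)].
Let S' A : set T2 := (U `*` U) `&` S A.

Let mS A : measurable A -> measurable (S A).
Proof.
by move=> mA; rewrite -[X in measurable X]setTI; exact: (@measurable_exchange R q m n).
Qed.

Let mS' A : measurable A -> measurable (S' A).
Proof. by move=> mA; apply: measurableI; [exact: measurableX|exact: mS]. Qed.

(** Both laws are absolutely continuous, so neither charges the null set of matrices with a
    vanishing row. *)
Let QU A : measurable A -> (mu \x gam)%E (S A) = (mu \x gam)%E (S' A).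
Proof.
move=> mA; apply/eqP; rewrite eq_le; apply/andP; split; last first.
  by apply: le_measure; rewrite ?inE; [exact: mS'|exact: mS|move=> z []].
have mUC : measurable (~` U) by exact: measurableC.
have muU : mu (~` U) = 0%E.
  apply/eqP; rewrite eq_le measure_ge0 andbT muE// LE inver gt_eqF//.
  rewrite (_ : lam _ = 0%E) ?mul0e//; apply/eqP; rewrite eq_le measure_ge0 andbT -U0.
  by apply: le_measure; rewrite ?inE//; exact: measurableI.
have gamU : gam (~` U) = 0%E.
  by rewrite gamE//; apply: null_set_integral => //; exact/measurable_funTS/measurable_EFinP.
pose N1 : set T2 := ~` U `*` setT.
pose N2 : set T2 := setT `*` ~` U.
have mN1 : measurable N1 by exact: measurableX.
have mN2 : measurable N2 by exact: measurableX.
have N10 : (mu \x gam)%E N1 = 0%E.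
  transitivity (mu (~` U) * gam setT)%E; last by rewrite muU mul0e.
  exact: product_measure1E.
have N20 : (mu \x gam)%E N2 = 0%E.
  transitivity (mu setT * gam (~` U))%E; last by rewrite gamU mule0.
  exact: product_measure1E.
rewrite -(measureU0 (mS' mA) mN1 N10) -(measureU0 (measurableU _ _ (mS' mA) mN1) mN2 N20).
apply: le_measure; rewrite ?inE; [exact: mS|by do 2! apply: measurableU => //; exact: mS'|].
move=> [x y] Sxy; have [Ux|Ux] := pselect (U x); last by left; right.
by have [Uy|Uy] := pselect (U y); [left; left|right].
Qed.

Let QE A : measurable A -> ((mu \x gam) (S A) =
  \int[lam]_x \int[lam]_y (L^-1 * (\1_U x * \1_U y * \1_(A `&` B) (exchange q x y) * G y))%:E)%E.
Proof.
move=> mA; rewrite QU// (product_density mGB mG GB0 G0 ball_densityE gamE (mS' mA)).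
apply: eq_integral => x _; apply: eq_integral => y _; congr EFin.
rewrite [\1_(S' A) _]indicE in_setI in_setX /GB !indicE /=.
case: (boolP (x \in U)) => [Ux|]; last by rewrite !mul0r mulr0.
case: (boolP (y \in U)) => [Uy|]; last by rewrite !(mulr0, mul0r).
rewrite !mul1r in_setI.
have -> : ((x, y) \in S A) = (exchange q x y \in A).
  by apply/idP/idP; rewrite !inE.
(* The constraint [B] sees only row norms, which the exchanged matrix shares with [x]. It can
   therefore be moved onto that matrix, which brings the integrand into the form of
   [exchange_const]. *)
have -> : (exchange q x y \in B) = (x \in B).
  have E : rn (exchange q x y) =1 rn x.
    by move=> i; apply: row_norm_exchange => //; rewrite inE in Uy.
  by apply/idP/idP; rewrite !inE; apply: Bnorm.
by case: (exchange q x y \in A); case: (x \in B); rewrite /= ?mulr1n ?mulr0n; ring.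
Qed.

(** By [exchange_const] the exchanged law is [C / L] times Lebesgue measure on [B]. Taking
    [A = setT] gives [C * L = L], which rules out infinite values and forces [C = 1] without
    evaluating any integral. *)
Lemma exchange_law A : measurable A ->
  (mu \x gam)%E [set z | A (exchange q z.1 z.2)] = mu A.
Proof.
move=> mA.
have [C CE] := exchange_const q0 n0 mG G0 Gnorm.
have QC A' : measurable A' -> ((mu \x gam) (S A') = L^-1%:E * (C * lam (A' `&` B)))%E.
  move=> mA'; rewrite QE// -CE; last exact: measurableI.
  have mf : measurable_fun setT (fun z : T2 =>
      \1_U z.1 * \1_U z.2 * \1_(A' `&` B) (exchange q z.1 z.2) * G z.2).
    have mi D (g : T2 -> 'M[R]_(m, n)) : measurable D -> measurable_fun setT g ->
        measurable_fun setT (fun z => \1_D (g z) : R).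
      by move=> mD mg; apply: (measurableT_comp _ mg); exact: measurable_indic.
    apply: measurable_funM; last exact: (measurableT_comp mG).
    apply: measurable_funM; first by apply: measurable_funM; exact: mi.
    by apply: mi; [exact: measurableI|exact: measurable_exchange].
  have f0 x y : 0 <= \1_U x * \1_U y * \1_(A' `&` B) (exchange q x y) * G y.
    by rewrite !mulr_ge0.
  rewrite -ge0_integralZl//; last 3 first.
  - apply: (measurable_fun_fubini_tonelli_F (m2 := lam) (fun z : T2 =>
      (\1_U z.1 * \1_U z.2 * \1_(A' `&` B) (exchange q z.1 z.2) * G z.2)%:E)).
      exact/measurable_EFinP.
    by move=> z; rewrite lee_fin.
  - by move=> x _; apply: integral_ge0 => y _; rewrite lee_fin.
  - by rewrite lee_fin invr_ge0 ltW.
  apply: eq_integral => x _; rewrite -ge0_integralZl//.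
  - apply/measurable_EFinP; exact: (measurable_fun_pair2 x mf).
  - by move=> y _; rewrite lee_fin.
  - by rewrite lee_fin invr_ge0 ltW.
have ST : S setT = setT by [].
have := QC _ measurableT; rewrite ST probability_setT setTI LE => C1.
rewrite -/(S A) QC// muE// LE inver gt_eqF//.
have : (C * L%:E = L%:E)%E.
  transitivity (L%:E * (L^-1%:E * (C * L%:E)))%E; last by rewrite -C1 mule1.
  by rewrite [RHS]muleA -EFinM divff ?mul1e// gt_eqF.
case: C {CE QC C1} => [c||].
- move=> cE; have cL : c * L = L by apply: EFin_inj; rewrite EFinM.
  have -> : c = 1 by apply: (mulIf (lt0r_neq0 L0)); rewrite mul1r.
  by rewrite mul1e muleC.
- by rewrite gt0_mulye// lte_fin.
- by rewrite gt0_mulNye// lte_fin.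
Qed.

End exchange_law.

(** * Uniform concentration of the row norms *)

Section q_gaussian.
Context {R : realType} (q : \bar R) (q0 : (0 < q)%E).
Notation leb := (@lebesgue_measure R).
Notation g := (q_gaussian_density q).
(* The value of the Gamma function is never needed: the normalization of the
   density follows from the existence of a random variable with this law. *)
Hypothesis g1 : (\int[leb]_x (g x)%:E = 1)%E.

Lemma measurable_q_gaussian_density : measurable_fun setT g.
Proof.
case: q => [r||] //=.
- apply: measurable_funM => //; apply: measurableT_comp => //.
  apply: measurableT_comp => //; apply: measurable_funM => //.
  apply: (@measurableT_comp _ _ _ _ _ _ (@powR R ^~ r)); first exact: measurable_powR.
  exact: normr_measurable.
- by apply: measurable_funM => //; apply: measurable_indic; exact: measurable_itv.
- exact: measurable_cst.
Qed.

(** The sign of the normalising factor is read off [g1]: a negative factor would make the total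
    integral at most 0 instead of 1. *)
Lemma q_gaussian_density_ge0 x : 0 <= g x.
Proof.
have mg := measurable_q_gaussian_density.
case: q q0 g1 mg => [r r0 /= h mg|_ _ _ /=|//]; last by rewrite mulr_ge0.
move: h mg; set Z := _^-1 => h mg.
have [Z0|Z0] := leP 0 Z; first by rewrite mulr_ge0// expR_ge0.
have : (\int[leb]_x (- (Z * expR (- (`|x| `^ r / r))))%:E >= 0)%E.
  by apply: integral_ge0 => y _; rewrite lee_fin oppr_ge0 mulr_le0_ge0 ?expR_ge0// ltW.
suff -> : (\int[leb]_x (- (Z * expR (- (`|x| `^ r / r))))%:E =
    - \int[leb]_x (Z * expR (- (`|x| `^ r / r)))%:E)%E.
  by rewrite h leeNr oppe0 lee_fin ler10.
rewrite -[LHS]oppeK; congr oppe; rewrite -integral_ge0N.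
  by apply: eq_integral => y _; rewrite EFinN oppeK.
by move=> y _; rewrite lee_fin oppr_ge0 mulr_le0_ge0 ?expR_ge0// ltW.
Qed.

Definition gauss_density m n (y : 'M[R]_(m, n)) : R := \prod_i \prod_j g (y i j).

Lemma gauss_density_ge0 m n (y : 'M[R]_(m, n)) : 0 <= gauss_density y.
Proof. by apply: prodr_ge0 => i _; apply: prodr_ge0 => j _; exact: q_gaussian_density_ge0. Qed.

Lemma measurable_gauss_density m n : measurable_fun setT (@gauss_density m n).
Proof.
apply: measurable_prod => i _; apply: measurable_prod => j _.
apply: measurableT_comp; first exact: measurable_q_gaussian_density.
exact: measurable_coord.
Qed.

Lemma gauss_density_mbox m n (A : 'I_m -> 'I_n -> set R) :
  (forall i j, measurable (A i j)) ->
  (\int[@lebesgue_matrix R m n]_(y in mbox A) (gauss_density y)%:E =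
   \prod_i \prod_j \int[leb]_(x in A i j) (g x)%:E)%E.
Proof.
move=> mA.
transitivity (\prod_i \prod_j \int[leb]_x (\1_(A i j) x * g x)%:E)%E; last first.
  apply: eq_bigr => i _; apply: eq_bigr => j _.
  rewrite [RHS]integral_mkcond; apply: eq_integral => x _.
  by rewrite /patch indicE; case: ifP => _; rewrite ?mul1r ?mul0r.
rewrite -(@integral_matrix_prod R m n (fun i j x => \1_(A i j) x * g x)).
- rewrite integral_mkcond; apply: eq_integral => y _; rewrite /patch.
  under eq_bigr do rewrite big_split/=.
  rewrite big_split/=; case: ifPn => [|/negP yA].
    rewrite inE => yA; rewrite big1 ?mul1r// => i _; apply: big1 => j _.
    by rewrite indicE mem_set//; exact: yA.
  rewrite (_ : \prod_i _ = 0) ?mul0r//.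
  have /existsNP[i /existsNP[j nA]] : ~ (mbox A y) by move=> yB; apply: yA; rewrite inE.
  by rewrite (bigD1 i)//= (bigD1 j)//= indicE memNset// !mul0r.
- move=> i j; apply: measurable_funM; first exact: measurable_indic.
  exact: measurable_q_gaussian_density.
- by move=> i j x; rewrite mulr_ge0// q_gaussian_density_ge0.
Qed.

Lemma gauss_density1 m n : (\int[@lebesgue_matrix R m n]_y (gauss_density y)%:E = 1)%E.
Proof.
rewrite (_ : setT = mbox (fun (_ : 'I_m) (_ : 'I_n) => setT)); last first.
  by apply/seteqP; split.
rewrite gauss_density_mbox// big1// => i _; rewrite big1// => j _; exact: g1.
Qed.

Lemma lp_norm_powR (r : R) n (x : 'I_n -> R) : 0 < r ->
  lp_norm r%:E x `^ r = \sum_j `|x j| `^ r.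
Proof.
move=> r0 /=; rewrite -powRrM mulVf ?gt_eqF// powRr1//.
by apply: sumr_ge0 => j _; exact: powR_ge0.
Qed.

Lemma lp_norm_infty_le n (x : 'I_n -> R) (c : R) : 0 <= c ->
  lp_norm +oo%E x <= c <-> forall j, `|x j| <= c.
Proof.
move=> c0; split=> [xc j|xc]; last by apply: bigmax_le.
by apply: le_trans xc; exact: ler_lp_norm.
Qed.

Lemma gauss_density_fin m n (r : R) : q = r%:E ->
  exists2 C : R, 0 <= C & forall y : 'M[R]_(m, n),
    gauss_density y = C * expR (- (row_sum q r y / r)).
Proof.
move=> qr; have r0 : 0 < r by rewrite -lte_fin -qr.
pose Z := (2 * r `^ r^-1 * Gamma (r^-1 + 1))^-1.
have gE x : g x = Z * expR (- (`|x| `^ r / r)) by rewrite qr.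
have Z0 : 0 <= Z.
  have := q_gaussian_density_ge0 0.
  by rewrite gE pmulr_lge0// expR_gt0.
exists (\prod_(i < m) \prod_(j < n) Z).
  by apply: prodr_ge0 => i _; apply: prodr_ge0.
move=> y; rewrite /gauss_density.
rewrite (_ : - _ = \sum_i \sum_j (- (`|y i j| `^ r / r))).
  rewrite expR_sum -big_split; apply: eq_bigr => i _ /=.
  by rewrite expR_sum -big_split; apply: eq_bigr => j _ /=; exact: gE.
rewrite /row_sum mulr_suml -sumrN; apply: eq_bigr => i _.
rewrite qr lp_norm_powR// mulr_suml -sumrN; exact: eq_bigr.
Qed.

Lemma gauss_density_infty m n : q = +oo%E ->
  exists2 C : R, 0 <= C & forall y : 'M[R]_(m, n),
    gauss_density y = C * \1_[set y | forall i, row_norm q y i <= 1] y.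
Proof.
move=> qoo; exists (\prod_(i < m) \prod_(j < n) 2^-1).
  by apply: prodr_ge0 => i _; apply: prodr_ge0.
move=> y; rewrite /gauss_density.
have gE x : g x = 2^-1 * \1_(`[-1, 1]%classic : set R) x by rewrite qoo.
under eq_bigr do under eq_bigr do rewrite gE.
under eq_bigr do rewrite big_split/=.
rewrite big_split/=; congr (_ * _).
rewrite indicE; case: (boolP (y \in _)) => [|/negP yB].
  rewrite inE /= => yB; rewrite big1// => i _; rewrite big1// => j _.
  have := yB i; rewrite /row_norm qoo lp_norm_infty_le// => /(_ j).
  by rewrite ler_norml => y1; rewrite indicE mem_set//= in_itv.
have : ~ (forall i j, `|y i j| <= 1).
  move=> y1; apply: yB; rewrite inE /= => i.
  by rewrite /row_norm qoo; apply/lp_norm_infty_le.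
move=> /existsNP[i /existsNP[j nA]].
rewrite (bigD1 i)//= (bigD1 j)//= indicE memNset ?mul0r//=.
by rewrite in_itv/= -ler_norml.
Qed.

Lemma gauss_density_norm m n (x y : 'M[R]_(m, n)) :
  row_norm q x =1 row_norm q y -> gauss_density x = gauss_density y.
Proof.
move=> xy; case qE : q q0 => [r||] //= _.
- have [C _ CE] := @gauss_density_fin m n r qE.
  by rewrite !CE /row_sum; under eq_bigr do rewrite xy.
- have [C _ CE] := @gauss_density_infty m n qE.
  rewrite !CE !indicE; congr (_ * (nat_of_bool _)%:R).
  by apply/idP/idP; rewrite !inE => /= h i; rewrite -?xy// xy.
Qed.

End q_gaussian.

Section uniform_concentration.
Context {R : realType}.

(** The moments control r-th powers, whereas norms are needed. By monotonicity of [v^r], the gaps at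
    [1 - e] and [1 + e] are the worst ones. *)
Lemma powR_dist1 (r e : R) : 0 < r -> 0 < e < 1 ->
  exists2 e' : R, 0 < e' & forall v, 0 <= v -> e <= `|v - 1| -> e' <= `|v `^ r - 1|.
Proof.
move=> r0 /andP[e0 e1].
have a1 : (1 - e) `^ r < 1.
  rewrite -[ltRHS](congr1 (@^~ r) (@powR1 R)) gt0_ltr_powR ?nnegrE//; lra.
have b1 : 1 < (1 + e) `^ r.
  rewrite -[ltLHS](congr1 (@^~ r) (@powR1 R)) gt0_ltr_powR ?nnegrE//; lra.
exists (Num.min (1 - (1 - e) `^ r) ((1 + e) `^ r - 1)).
  by rewrite lt_min !subr_gt0 a1.
move=> v v0; have [v1|v1] := leP v 1.
  rewrite ler0_norm ?subr_le0// => h.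
  have : v `^ r <= (1 - e) `^ r by rewrite ge0_ler_powR ?nnegrE ?(ltW r0)//; lra.
  move=> h2; rewrite ler0_norm; last by lra.
  by rewrite ge_min; apply/orP; left; lra.
rewrite gtr0_norm ?subr_gt0// => h.
have : (1 + e) `^ r <= v `^ r by rewrite ge0_ler_powR ?nnegrE ?(ltW r0)//; lra.
move=> h2; rewrite gtr0_norm; last by lra.
by rewrite ge_min; apply/orP; right; lra.
Qed.

Lemma near_inv_lt (r e' e : R) : 0 < r -> 0 < e' -> 0 < e ->
  exists N : nat, forall n, (N <= n)%N -> (0 < n)%N -> r / n%:R / e' ^+ 2 <= e.
Proof.
move=> r0 e'0 e0; exists (Num.truncn (r / e' ^+ 2 / e)).+1 => n Nn n0.
have n0' : 0 < n%:R :> R by rewrite ltr0n.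
have : r / e' ^+ 2 / e <= n%:R.
  by apply/ltW/(lt_le_trans (truncnS_gt _)); rewrite ler_nat.
by move=> h; rewrite mulrAC ler_pdivrMr// -ler_pdivrMl// mulrC.
Qed.

Lemma near_geometric (a e : R) : 0 <= a < 1 -> 0 < e ->
  exists N : nat, forall n, (N <= n)%N -> a ^+ n <= e.
Proof.
move=> /andP[a0 a1] e0.
have := @cvg_expr R a; rewrite ger0_norm// => /(_ a1) /cvgrPdist_le /(_ e e0) [N _ HN].
exists N => n /HN; rewrite /= sub0r normrN ger0_norm// exprn_ge0//.
Qed.

Lemma measurable_deviation (q : \bar R) m n (c d e : R) (f : R -> R) (i : 'I_m) :
  measurable_fun setT f ->
  measurable [set y : 'M[R]_(m, n) | (e <= `|c * f (row_norm q y i) * d - 1|)%R].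
Proof.
move=> mf; rewrite -[X in measurable X]setTI.
apply: (measurable_fun_le (f := cst e)) => //.
apply: measurableT_comp => //; apply: measurable_funB => //.
apply: measurable_funM => //; apply: measurable_funM => //.
by apply: (measurableT_comp mf); exact: measurable_row_norm.
Qed.

Section gauss.
Context (q : \bar R) (q0 : (0 < q)%E).
Hypothesis g1 : (\int[@lebesgue_measure R]_x (q_gaussian_density q x)%:E = 1)%E.

(** [N] is chosen before [m] and [i]; this uniformity lets the number of rows vary freely with
    [n]. *)
Lemma gauss_concentration (e1 e : R) : 0 < e1 < 1 -> 0 < e ->
  exists N : nat, forall m n, (N <= n)%N -> (0 < n)%N -> forall i : 'I_m,
    (\int[@lebesgue_matrix R m n]_(y in
        [set y | e1 <= `|row_norm q y i / n%:R `^ 1/[q] - 1|]%R)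
      (gauss_density q y)%:E <= e%:E)%E.
Proof.
move=> e11 e0; case qE : {+}q (q0) => [r||] // q0'.
- have r0 : 0 < r by rewrite -lte_fin.
  have [e' e'0 He'] := powR_dist1 r0 e11.
  have [N HN] := near_inv_lt r0 e'0 e0.
  exists N => m n Nn n0 i.
  have n0' : 0 < n%:R :> R by rewrite ltr0n.
  have [C C0 CE] := gauss_density_fin q0 g1 m n qE.
  rewrite -qE.
  apply: le_trans (le_trans (expR_deviation q0 n0 r0 i C0 CE (gauss_density1 q0 g1 m n) e'0) _).
    apply: ge0_subset_integral => //.
    + have := @measurable_deviation q m n 1 (n%:R `^ 1/[q])^-1 e1 id i (@measurable_id _ _ setT).
      by under eq_set do rewrite mul1r.
    + have := @measurable_deviation q m n 1 n%:R^-1 e' (@powR R ^~ r) i (measurable_powR r).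
      by under eq_set do rewrite mul1r.
    + by apply: measurable_funTS; apply/measurable_EFinP; exact: measurable_gauss_density.
    + by move=> y _; rewrite lee_fin gauss_density_ge0.
    + move=> y /= /He'.
      rewrite divr_ge0 ?row_norm_ge0 ?powR_ge0// => /(_ isT).
      rewrite qE inver gt_eqF//= powRM ?row_norm_ge0 ?invr_ge0 ?powR_ge0//.
      rewrite -[(_ `^ _)^-1]powR_inv1 ?powR_ge0// -!powRrM.
      by rewrite mulN1r mulrN mulVf ?gt_eqF// powR_inv1// ltW.
  by rewrite lee_fin HN.
- have [e10 e1l] := andP e11.
  have [|N HN] := @near_geometric (1 - e1) e _ e0; first by apply/andP; split; lra.
  exists N => m n Nn n0 i.
  have [C C0 CE] := gauss_density_infty m n qE.
  rewrite -qE (_ : 1/[q] = 0); last by rewrite qE invey.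
  rewrite powRr0; under eq_set do rewrite divr1.
  apply: (@le_trans _ _ ((1 - e1) ^+ n)%:E); last by rewrite lee_fin HN.
  exact: (cube_deviation q0 i C0 CE (gauss_density1 q0 g1 m n) e11).
Qed.

End gauss.

Section ball.
Context (p q : \bar R) (p0 : (0 < p)%E) (q0 : (0 < q)%E).

Lemma mixed_norm_ge0 m n (x : 'M[R]_(m, n)) : 0 <= mixed_norm p q x.
Proof. exact: lp_norm_ge0. Qed.

Lemma measurable_mixed_ball m n : measurable (@mixed_ball R p q m n).
Proof.
rewrite (_ : @mixed_ball R p q m n = (fun x : 'M[R]_(m, n) => mixed_norm p q x) @^-1` `]-oo, 1]).
  rewrite -[X in measurable X]setTI.
  have : measurable_fun setT (fun x : 'M[R]_(m, n) => mixed_norm p q x).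
    by apply: measurable_lp_norm => i; exact: measurable_row_norm.
  exact.
by apply/seteqP; split=> x; rewrite /mixed_ball /= in_itv/=.
Qed.

Lemma mixed_ball_norm m n (x y : 'M[R]_(m, n)) :
  row_norm q x =1 row_norm q y -> @mixed_ball R p q m n x -> @mixed_ball R p q m n y.
Proof.
rewrite /mixed_ball /= /mixed_norm => xy.
by have -> : (fun i => lp_norm q (fun j => x i j)) = (fun i => lp_norm q (fun j => y i j))
  by exact/funext.
Qed.

Lemma indic_mixed_ball_fin m n (r : R) (x : 'M[R]_(m, n)) : p = r%:E ->
  \1_(@mixed_ball R p q m n) x = ramp0 (row_sum q r x) :> R.
Proof.
move=> pr; have r0 : 0 < r by rewrite -lte_fin -pr.
rewrite indicE /ramp0; congr (nat_of_bool _)%:R.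
have -> : row_sum q r x = mixed_norm p q x `^ r.
  rewrite /mixed_norm pr lp_norm_powR//; apply: eq_bigr => i _.
  by rewrite ger0_norm// lp_norm_ge0.
apply/idP/idP; rewrite inE /mixed_ball /= => h.
  rewrite -[leRHS](congr1 (@^~ r) (@powR1 R)).
  by apply: ge0_ler_powR; rewrite ?nnegrE ?mixed_norm_ge0 ?(ltW r0).
rewrite leNgt; apply/negP => h1; move: h; apply/negP; rewrite -ltNge.
rewrite -[ltLHS](congr1 (@^~ r) (@powR1 R)).
by apply: gt0_ltr_powR; rewrite ?nnegrE ?mixed_norm_ge0.
Qed.

Lemma mixed_ball_infty m n : p = +oo%E ->
  @mixed_ball R p q m n = [set x : 'M[R]_(m, n) | forall i, row_norm q x i <= 1].
Proof.
move=> poo; apply/seteqP; split=> x; rewrite /mixed_ball /= /mixed_norm poo.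
  by move=> /lp_norm_infty_le xi i; apply: le_trans (ler_norm _) _; exact: xi.
by move=> xi; apply/lp_norm_infty_le => // i; rewrite ger0_norm ?lp_norm_ge0//; exact: xi.
Qed.

(** Finite [p] uses the Dirichlet moments, infinite [p] the cube. [N] does not depend on the volume
    [L], of which only finiteness and positivity are known. *)
Lemma ball_concentration (e1 e : R) : 0 < e1 < 1 -> 0 < e ->
  exists N : nat, forall m n, (N <= n)%N -> (0 < n)%N -> forall (i : 'I_m) (L : R),
    0 < L -> @lebesgue_matrix R m n (@mixed_ball R p q m n) = L%:E ->
    (\int[@lebesgue_matrix R m n]_(y in
        [set y | e1 <= `|m%:R `^ 1/[p] * row_norm q y i - 1|]%R)
      (L^-1 * \1_(@mixed_ball R p q m n) y)%:E <= e%:E)%E.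
Proof.
move=> e11 e0; case pE : {+}p (p0) => [r||] // p0'.
- have r0 : 0 < r by rewrite -lte_fin.
  have [e' e'0 He'] := powR_dist1 r0 e11.
  have [N HN] := near_inv_lt r0 e'0 e0.
  exists N => m n Nn n0 i L L0; rewrite -pE => LE.
  have LE' : (\int[@lebesgue_matrix R m n]_y (ramp0 (row_sum q r y))%:E = L%:E)%E.
    transitivity (\int[@lebesgue_matrix R m n]_y (\1_(@mixed_ball R p q m n) y)%:E)%E.
      by apply: eq_integral => x _; rewrite (indic_mixed_ball_fin _ pE).
    by rewrite integral_indic ?setIT//; exact: measurable_mixed_ball.
  under eq_integral do rewrite (indic_mixed_ball_fin _ pE).
  apply: le_trans (le_trans (ball_deviation q0 n0 r0 i L0 LE' e'0) _).
    apply: ge0_subset_integral => //.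
    + have := @measurable_deviation q m n (m%:R `^ 1/[p]) 1 e1 id i (@measurable_id _ _ setT).
      by under eq_set do rewrite mulr1.
    + have := @measurable_deviation q m n m%:R 1 e' (@powR R ^~ r) i (measurable_powR r).
      by under eq_set do rewrite mulr1.
    + apply: measurable_funTS; apply/measurable_EFinP; apply: measurable_funM => //.
      by apply: measurableT_comp; [exact: measurable_ramp0|exact: measurable_row_sum].
    + by move=> y _; rewrite lee_fin mulr_ge0 ?ramp0_ge0// invr_ge0 ltW.
    + move=> y /= /He'.
      rewrite mulr_ge0 ?row_norm_ge0 ?powR_ge0// => /(_ isT).
      rewrite pE inver gt_eqF//= powRM ?row_norm_ge0 ?powR_ge0//.
      by rewrite -powRrM mulVf ?gt_eqF// powRr1.
  by rewrite lee_fin HN.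
- have [e10 e1l] := andP e11.
  have [|N HN] := @near_geometric (1 - e1) e _ e0; first by apply/andP; split; lra.
  exists N => m n Nn n0 i L L0; rewrite -pE => LE.
  have CE y : L^-1 * \1_(@mixed_ball R p q m n) y =
      L^-1 * \1_[set x : 'M[R]_(m, n) | forall i, row_norm q x i <= 1] y.
    by rewrite mixed_ball_infty.
  rewrite pE invey/= powRr0; under eq_set do rewrite mul1r.
  rewrite -pE.
  have L1 : (\int[@lebesgue_matrix R m n]_y (L^-1 * \1_(@mixed_ball R p q m n) y)%:E = 1)%E.
    under eq_integral do rewrite EFinM.
    rewrite ge0_integralZl//.
    + rewrite integral_indic//; last exact: measurable_mixed_ball.
      transitivity (L^-1%:E * L%:E)%E; last by rewrite -EFinM mulVf// gt_eqF.
      by congr (_ * _)%E; rewrite -LE setIT.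
    + by apply/measurable_EFinP; apply: measurable_indic; exact: measurable_mixed_ball.
    + by rewrite lee_fin invr_ge0 ltW.
  have V0 : 0 <= L^-1 by rewrite invr_ge0 ltW.
  apply: (@le_trans _ _ ((1 - e1) ^+ n)%:E); last by rewrite lee_fin HN.
  exact: (cube_deviation q0 i V0 CE L1 e11).
Qed.

End ball.
End uniform_concentration.

Section ratio.
Context {R : realType} (p q : \bar R) (p0 : (0 < p)%E) (q0 : (0 < q)%E).
Hypothesis g1 : (\int[@lebesgue_measure R]_x (q_gaussian_density q x)%:E = 1)%E.

Definition scale_factor m n : R := m%:R `^ 1/[p] * n%:R `^ 1/[q].

(** The factor between row [i] of [y] and of the rescaled exchanged matrix: the quotient of
    [m^(1/p) N_i(x)] by [N_i(y) / n^(1/q)], both of which concentrate at 1. *)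
Definition norm_ratio m n (x y : 'M[R]_(m, n)) (i : 'I_m) : R :=
  scale_factor m n * (row_norm q x i / row_norm q y i).

Lemma scale_exchange m n (x y : 'M[R]_(m, n)) :
  scale_factor m n *: exchange q x y = mx_scale (norm_ratio x y) y.
Proof. by apply/matrixP => i j; rewrite !mxE mulrA. Qed.

Lemma measurable_norm_ratio m n (i : 'I_m) :
  measurable_fun setT (fun z : 'M[R]_(m, n) * 'M[R]_(m, n) => norm_ratio z.1 z.2 i).
Proof.
apply: measurable_funM => //; apply: measurable_funM.
  by apply: (measurableT_comp (@measurable_row_norm R q m n i)).
by apply: (measurableT_comp (@measurable_inv_norm R q m n i)).
Qed.

Definition ball_law m n (mu : probability 'M[R]_(m, n) R) :=
  forall A, measurable A -> mu A =
    (@lebesgue_matrix R m n (A `&` @mixed_ball R p q m n) /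
     lebesgue_matrix (@mixed_ball R p q m n))%E.

Definition gauss_law m n (gam : probability 'M[R]_(m, n) R) :=
  forall A, measurable A ->
    gam A = (\int[@lebesgue_matrix R m n]_(y in A) (gauss_density q y)%:E)%E.

Lemma gauss_law_exists m n : {gam : probability 'M[R]_(m, n) R | gauss_law gam}.
Proof.
have [gam gamE] := density_probability (@measurable_gauss_density R q m n)
  (gauss_density_ge0 q0 g1 (m := m) (n := n)) (gauss_density1 q0 g1 m n).
by exists gam => A _; exact: gamE.
Qed.

(** If the volume were 0 or infinite, the conventions for extended division would give [mu] total
    mass 0. *)
Lemma ball_law_volume m n (mu : probability 'M[R]_(m, n) R) : ball_law mu ->
  exists2 L : R, 0 < L & lebesgue_matrix (@mixed_ball R p q m n) = L%:E.
Proof.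
move=> /(_ _ measurableT); rewrite setTI probability_setT.
have : (0 <= lebesgue_matrix (@mixed_ball R p q m n))%E by exact: measure_ge0.
case: (lebesgue_matrix _) => [L||] //.
- rewrite lee_fin le_eqVlt => /predU1P[<-|L0 _]; last by exists L.
  by rewrite mul0e => -[] /eqP; rewrite oner_eq0.
- by rewrite invey mule0 => _ [] /eqP; rewrite oner_eq0.
Qed.

Lemma exchange_ball_law m n (mu gam : probability 'M[R]_(m, n) R) : (0 < n)%N ->
  ball_law mu -> gauss_law gam -> forall A, measurable A ->
  (mu \x gam)%E [set z | A (exchange q z.1 z.2)] = mu A.
Proof.
move=> n0 hmu hgam A mA; have [L L0 LE] := ball_law_volume hmu.
apply: (exchange_law q0 n0 (@measurable_gauss_density R q m n)
  (gauss_density_ge0 q0 g1 (m := m) (n := n)) _ (@measurable_mixed_ball R p q m n) _ L0 LE hmu hgam mA).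
- by move=> x y; exact: gauss_density_norm.
- by move=> x y; exact: mixed_ball_norm.
Qed.

Lemma ratio_concentration (e1 e : R) : 0 < e1 -> 0 < e ->
  exists N : nat, forall m n, (N <= n)%N -> (0 < n)%N ->
  forall mu gam : probability 'M[R]_(m, n) R, ball_law mu -> gauss_law gam ->
  forall i, ((mu \x gam) [set z | e1 <= `|norm_ratio z.1 z.2 i - 1|]%R <= e%:E)%E.
Proof.
move=> e10 e0.
(* If [a] and [b] are within [d] of 1, then [b > 1/2] and [|a / b - 1| = |a - b| / b < 2 d / (1/2) =
   4 d <= e1]. *)
pose d := Num.min (2^-1) (e1 / 4).
have d01 : 0 < d < 1.
  rewrite /d lt_min; apply/andP; split; first by apply/andP; split; lra.
  by rewrite gt_min; apply/orP; left; lra.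
have [d0 d1] := andP d01.
have d2 : d <= 2^-1 by rewrite ge_min lexx.
have d4 : 4 * d <= e1.
  have : d <= e1 / 4 by rewrite ge_min lexx orbT.
  lra.
have e20 : 0 < e / 2 by rewrite divr_gt0.
have [N1 HN1] := gauss_concentration q0 g1 d01 e20.
have [N2 HN2] := ball_concentration p0 q0 d01 e20.
exists (maxn N1 N2) => m n; rewrite geq_max => /andP[Nn1 Nn2] n0 mu gam hmu hgam i.
have [L L0 LE] := ball_law_volume hmu.
pose A1 := [set x : 'M[R]_(m, n) | d <= `|m%:R `^ 1/[p] * row_norm q x i - 1|].
pose A2 := [set y : 'M[R]_(m, n) | d <= `|row_norm q y i / n%:R `^ 1/[q] - 1|].
have mA1 : measurable A1.
  rewrite -[X in measurable X]setTI.
  apply: (measurable_fun_le (f := cst d)) => //.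
  apply: measurableT_comp => //; apply: measurable_funB => //.
  by apply: measurable_funM => //; exact: measurable_row_norm.
have mA2 : measurable A2.
  rewrite -[X in measurable X]setTI.
  apply: (measurable_fun_le (f := cst d)) => //.
  apply: measurableT_comp => //; apply: measurable_funB => //.
  by apply: measurable_funM => //; exact: measurable_row_norm.
have muA1 : (mu A1 <= (e / 2)%:E)%E.
  rewrite (ball_densityE (@measurable_mixed_ball R p q m n) L0 LE hmu mA1).
  exact: HN2.
have gamA2 : (gam A2 <= (e / 2)%:E)%E by rewrite hgam//; exact: HN1.
apply: (@le_trans _ _ ((mu \x gam) (A1 `*` setT) + (mu \x gam) (setT `*` A2)))%E.
  apply: le_trans (measureU2 _ _ _) => //; try exact: measurableX.
  apply: le_measure; rewrite ?inE.
  - rewrite -[X in measurable X]setTI.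
    apply: (measurable_fun_le (f := cst e1)) => //.
    apply: measurableT_comp => //; apply: measurable_funB => //.
    exact: measurable_norm_ratio.
  - by apply: measurableU; exact: measurableX.
  - move=> [x y] /= h.
    have [xA|xA] := leP d `|m%:R `^ 1/[p] * row_norm q x i - 1|; first by left.
    have [yA|yA] := leP d `|row_norm q y i / n%:R `^ 1/[q] - 1|; first by right.
    exfalso; move: h; apply/negP; rewrite -ltNge; apply: lt_le_trans d4.
    have c2 : n%:R `^ 1/[q] != 0 by rewrite gt_eqF// powR_gt0// ltr0n.
    move: xA yA; rewrite /norm_ratio /scale_factor.
    set a := _ * row_norm q x i; set b := row_norm q y i / _ => a1 b1.
    (* This also shows that the row norm of [y] is nonzero, which makes the cancellation in the
       quotient legitimate. *)
    have b0 : 2^-1 < b by move: b1; rewrite ltr_norml => /andP[]; lra.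
    have yne : row_norm q y i != 0.
      by apply: contraTneq b0 => y0; rewrite /b y0 mul0r -leNgt.
    have -> : m%:R `^ 1/[p] * n%:R `^ 1/[q] * (row_norm q x i / row_norm q y i) - 1 = (a - b) / b.
      by rewrite /a /b; field; do ?[apply/andP; split].
    have b00 : 0 < b by lra.
    rewrite normrM normfV (gtr0_norm b00) ltr_pdivrMr//.
    have ab : `|a - b| < 2 * d.
      rewrite (_ : a - b = (a - 1) - (b - 1)); last by ring.
      by apply: le_lt_trans (ler_normB _ _) _; lra.
    by apply: lt_le_trans ab _; nra.
rewrite (_ : (mu \x gam)%E (A1 `*` setT) = mu A1); last first.
  transitivity (mu A1 * gam setT)%E; last by rewrite probability_setT mule1.
  exact: product_measure1E.
rewrite (_ : (mu \x gam)%E (setT `*` A2) = gam A2); last first.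
  transitivity (mu setT * gam A2)%E; last by rewrite probability_setT mul1e.
  exact: product_measure1E.
by rewrite [e]splitr EFinD leeD.
Qed.

End ratio.

(** * Convergence of the corners *)

Section continuity_modulus.
Context {R : realType} (k l : nat).
Variable F : 'M[R]_(k, l) -> R.
Hypothesis cF : continuous F.

(** A substitute for uniform continuity, adapted to multiplicative perturbations of rows. The
    existential over the factors together with the strict [e <] makes the set a union of open sets,
    hence measurable. *)
Definition unstable (e d : R) : set 'M[R]_(k, l) :=
  [set w | exists2 c : 'I_k -> R, (forall i, `|c i - 1| < d) &
    e < `|F (mx_scale c w) - F w|].

Lemma continuous_mx_scale (c : 'I_k -> R) : continuous (mx_scale c : 'M[R]_(k, l) -> _).
Proof.
move=> w A; rewrite nbhs_simpl/= => -[P Pw PA].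
have : forall i j, nbhs (w i j) [set t | P i j (c i * t)].
  move=> i j; have := Pw i j; rewrite mxE => Pij.
  have : (c i * t) @[t --> w i j] --> c i * w i j by apply: cvgM; [exact: cvg_cst|exact: cvg_id].
  by apply.
move=> h; exists (fun i j => [set t | P i j (c i * t)]) => // z hz.
by apply: PA => i j; rewrite mxE; exact: hz.
Qed.

Lemma open_unstable e d : open (unstable e d).
Proof.
rewrite (_ : unstable e d = \bigcup_(c in [set c : 'I_k -> R | forall i, `|c i - 1| < d])
    ((fun w => `|F (mx_scale c w) - F w|) @^-1` [set t | e < t])).
  apply: bigcup_open => c _; apply: open_comp; last exact: open_gt.
  have c1 (w : 'M[R]_(k, l)) : F (mx_scale c z) @[z --> w] --> F (mx_scale c w).
    by apply: continuous_comp; [exact: continuous_mx_scale|exact: cF].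
  have c2 (w : 'M[R]_(k, l)) : F (mx_scale c z) - F z @[z --> w] --> F (mx_scale c w) - F w.
    exact: (cvgB (c1 w) (@cF w)).
  by move=> w _; exact: (cvg_norm (c2 w)).
by apply/seteqP; split => [w [c cd h]|w [c cd h]]; exists c.
Qed.

Lemma measurable_unstable e d : measurable (unstable e d).
Proof. by apply: open_measurable_mx; exact: open_unstable. Qed.

(** If the entries of [w] are bounded by [M], factors within [d / M] of 1 move every entry by less
    than [d], so continuity at [w] alone suffices. *)
Lemma bigcap_unstable e : 0 < e -> \bigcap_(i : nat) unstable e (i.+1%:R^-1) = set0.
Proof.
move=> e0; apply/seteqP; split => // w hw.
have /cvgrPdist_lt /(_ e e0) /= := @cF w.
move=> /nbhs_ballP[d /= d0 hd].
pose M := 1 + \big[Num.max/0]_(ij : 'I_k * 'I_l) `|w ij.1 ij.2|.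
have M0 : 0 < M by rewrite ltr_pwDl// bigmax_ge_id.
have wM i j : `|w i j| <= M.
  apply: le_trans (le_bigmax 0 (fun ij : 'I_k * 'I_l => `|w ij.1 ij.2|) (i, j)) _.
  by rewrite /M lerDr.
have dM : 0 < d / M by rewrite divr_gt0.
have [N _ /(_ N (leqnn N)) HN] := near_infty_natSinv_lt (PosNum dM).
have [c cN] := hw N I.
apply/negP; rewrite -leNgt; apply: ltW; rewrite distrC; apply: hd.
split => // i j; rewrite /ball /= mxE.
rewrite (_ : w i j - c i * w i j = - ((c i - 1) * w i j)); last by ring.
rewrite normrN normrM.
apply: (@le_lt_trans _ _ (`|c i - 1| * M)); first by rewrite ler_wpM2l.
rewrite -ltr_pdivlMr//; apply: lt_trans (cN i) _; exact: HN.
Qed.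

Lemma unstable_subset e d d' : d <= d' -> unstable e d `<=` unstable e d'.
Proof. by move=> dd' w [c cd h]; exists c => // i; exact: lt_le_trans dd'. Qed.

(** The unstable sets decrease to the empty set, and [P] is continuous from above. *)
Lemma unstable_small d (T : measurableType d) (P : probability T R)
    (h : T -> 'M[R]_(k, l)) (e e' : R) : measurable_fun setT h -> 0 < e -> 0 < e' ->
  exists2 d : R, 0 < d & (P (h @^-1` unstable e d) < e'%:E)%E.
Proof.
move=> mh e0 e'0.
pose S (i : nat) := h @^-1` unstable e i.+1%:R^-1.
have mS i : measurable (S i).
  by rewrite -[X in measurable X]setTI; apply: mh => //; exact: measurable_unstable.
have S0 : \bigcap_i S i = set0.
  by rewrite -preimage_bigcap bigcap_unstable// preimage_set0.
have Sf i : P (S i) \is a fin_num.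
  rewrite ge0_fin_numE//; exact: le_lt_trans (probability_le1 P (mS i)) (ltry 1).
have nd : {homo S : i j / (i <= j)%N >-> (j <= i)%O}.
  move=> i j ij; apply/subsetPset => t; apply: unstable_subset.
  by rewrite lef_pV2 ?posrE// ler_nat.
have mS0 : measurable (\bigcap_i S i) by rewrite S0.
have S0oo : (P (S 0%N) < +oo)%E by rewrite -ge0_fin_numE.
have := @nonincreasing_cvg_mu _ _ _ P S S0oo mS mS0 nd.
rewrite S0 measure0 => /fine_cvgP[_].
move=> /cvgrPdist_lt /(_ e' e'0) [N _ /(_ N (leqnn N))] /=.
rewrite sub0r normrN => hN; exists N.+1%:R^-1; first by rewrite invr_gt0.
by rewrite -(fineK (Sf N)) lte_fin; apply: le_lt_trans hN; rewrite ler_norm.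
Qed.

Lemma continuous_measurable_mx : measurable_fun setT F.
Proof.
apply: (measurability _ (RGenOInfty.measurableE R)) => _ [_ [x ->] <-].
rewrite setTI; apply: open_measurable_mx.
by apply: open_comp; [move=> w _; exact: cF|exact: interval_open].
Qed.

End continuity_modulus.

Section bounded_integrals.
Context {R : realType}.

Lemma bounded_measurable_integrable d (T : measurableType d) (P : probability T R)
    (f : T -> R) (M : R) :
  measurable_fun setT f -> (forall t, `|f t| <= M) -> P.-integrable setT (EFin \o f).
Proof.
move=> mf fM; apply: measurable_bounded_integrable => //.
  exact: (le_lt_trans (probability_le1 P (@measurableT _ T)) (ltry 1)).
by exists M; split; [exact: num_real|move=> x Mx t _ /=; apply: le_trans (fM t) (ltW Mx)].
Qed.

Lemma eq_law_integral d1 d2 d (T1 : measurableType d1) (T2 : measurableType d2)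
    (E : measurableType d) (P1 : probability T1 R) (P2 : probability T2 R)
    (h1 : T1 -> E) (h2 : T2 -> E) (f : E -> R) (M : R) :
  measurable_fun setT h1 -> measurable_fun setT h2 -> measurable_fun setT f ->
  (forall x, `|f x| <= M) ->
  (forall A, measurable A -> P1 (h1 @^-1` A) = P2 (h2 @^-1` A)) ->
  (\int[P1]_t (f (h1 t))%:E = \int[P2]_t (f (h2 t))%:E)%E.
Proof.
move=> mh1 mh2 mf fM hE.
have i1 : P1.-integrable setT ((EFin \o f) \o h1).
  apply: (@bounded_measurable_integrable _ _ P1 (f \o h1) M).
    exact: measurableT_comp.
  by move=> t; exact: fM.
have i2 : P2.-integrable setT ((EFin \o f) \o h2).
  apply: (@bounded_measurable_integrable _ _ P2 (f \o h2) M).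
    exact: measurableT_comp.
  by move=> t; exact: fM.
have mf' : measurable_fun setT (EFin \o f) by exact/measurable_EFinP.
have := @integral_pushforward _ _ _ _ _ _ mh1 P1 _ _ mf' i1 measurableT.
have := @integral_pushforward _ _ _ _ _ _ mh2 P2 _ _ mf' i2 measurableT.
rewrite !preimage_setT /= => <- <-.
pose p1 : {measure set E -> \bar R} :=
  measure_function_pushforward__canonical__measure_function_Measure P1 mh1.
pose p2 : {measure set E -> \bar R} :=
  measure_function_pushforward__canonical__measure_function_Measure P2 mh2.
change (\int[p1]_t (f t)%:E = \int[p2]_t (f t)%:E)%E.
by apply: eq_measure_integral => A mA _; exact: hE.
Qed.

Lemma integral_close d (T : measurableType d) (P : probability T R)
    (f g : T -> R) (M e e' : R) (D : set T) :
  measurable_fun setT f -> measurable_fun setT g -> measurable D -> 0 <= M ->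
  (forall t, `|f t| <= M) -> (forall t, `|g t| <= M) -> 0 <= e ->
  (forall t, ~ D t -> `|f t - g t| <= e) -> (P D <= e'%:E)%E ->
  (`|\int[P]_t (f t)%:E - \int[P]_t (g t)%:E| <= (e + 2 * M * e')%:E)%E.
Proof.
move=> mf mg mD M0 fM gM e0 fg PD.
have intf := bounded_measurable_integrable P mf fM.
have intg := bounded_measurable_integrable P mg gM.
have mfg : measurable_fun setT (fun t => (f t - g t)%:E).
  by apply/measurable_EFinP; exact: measurable_funB.
rewrite -(integralB_EFin measurableT intf intg) /=.
apply: le_trans (le_abse_integral P measurableT mfg) _.
apply: (@le_trans _ _ (\int[P]_t (e + 2 * M * \1_D t)%:E))%E.
  apply: ge0_le_integral => //.
  - exact: measurableT_comp.
  - apply/measurable_EFinP; apply: measurable_funD => //.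
    by apply: measurable_funM => //; exact: measurable_indic.
  - move=> t _; rewrite lee_fin indicE; case: (boolP (t \in D)) => [_|].
      rewrite mulr1; apply: le_trans (ler_normB _ _) _.
      by have := fM t; have := gM t; lra.
    by rewrite notin_setE mulr0 addr0; exact: fg.
under eq_integral do rewrite EFinD EFinM.
rewrite ge0_integralD//; last 2 first.
- by move=> t _; rewrite -EFinM lee_fin !mulr_ge0.
- apply: measurable_funeM; apply/measurable_EFinP; exact: measurable_indic.
have -> : (\int[P]_t e%:E = e%:E)%E.
  rewrite integral_cst//; transitivity (e%:E * 1)%E; last by rewrite mule1.
  by congr (_ * _)%E; exact: probability_setT.
rewrite ge0_integralZl//; last 2 first.
- by apply/measurable_EFinP; exact: measurable_indic.
- by rewrite lee_fin mulr_ge0.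
by rewrite integral_indic// setIT EFinD leeD// (EFinM (2 * M)) lee_wpmul2l// lee_fin mulr_ge0.
Qed.

Lemma union_bound d (T : measurableType d) (P : probability T R) (I : finType)
    (A : I -> set T) (e : R) : (forall i, measurable (A i)) ->
  (forall i, (P (A i) <= e%:E)%E) ->
  measurable (\big[setU/set0]_i A i) /\ (P (\big[setU/set0]_i A i) <= (e *+ #|I|)%:E)%E.
Proof.
move=> mA Pe; rewrite cardE -big_enum /=.
elim: (enum I) => [|i s [mB PB]]; first by rewrite big_nil measure0.
rewrite big_cons; split; first exact: measurableU.
rewrite /= mulrS EFinD; apply: (le_trans (measureU2 _ (mA i) mB)); exact: (leeD (Pe i) PB).
Qed.

End bounded_integrals.

Section corner.
Context {R : realType} (k l m n : nat).

Lemma measurable_corner : measurable_fun setT (@corner R k l m n).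
Proof.
apply: measurable_fun_mx => i j; under eq_fun do rewrite mxE.
case: insubP => [i' _ _|_]; last exact: measurable_cst.
by case: insubP => [j' _ _|_]; [exact: measurable_coord|exact: measurable_cst].
Qed.

Lemma corner_scale (c : 'I_m -> R) (y : 'M[R]_(m, n)) :
  corner k l (mx_scale c y) =
  mx_scale (fun i => if insub (val i) is Some i' then c i' else 1) (corner k l y).
Proof.
apply/matrixP => i j; rewrite !mxE.
case: insubP => [i' _ _|_]; last by rewrite mulr0.
by case: insubP => [j' _ _|_]; rewrite ?mxE// mulr0.
Qed.

Lemma prod_insub (f : 'I_k -> \bar R) : (k <= m)%N ->
  (\prod_(i < m) (if insub (val i) is Some i' then f i' else 1) = \prod_(i < k) f i)%E.
Proof.
move=> /subnKC <-; rewrite big_split_ord /= [X in (_ * X)%E]big1 ?mule1.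
  by apply: eq_bigr => i _; rewrite valK.
by move=> i _; rewrite insubF// ltnNge leq_addr.
Qed.

End corner.

Section corner_law.
Context {R : realType} (q : \bar R) (q0 : (0 < q)%E) (k l : nat).
Context (d' : measure_display) (T' : measurableType d') (P' : probability T' R)
    (eta : 'I_k -> 'I_l -> {RV P' >-> R}).
Hypothesis eta_law : forall i j, q_gaussian q (eta i j).
Hypothesis eta_indep : mutually_independent (fun ij : 'I_k * 'I_l => eta ij.1 ij.2).
Hypothesis g1 : (\int[@lebesgue_measure R]_x (q_gaussian_density q x)%:E = 1)%E.

Let etaM w : 'M[R]_(k, l) := \matrix_(i, j) eta i j w.

Lemma measurable_etaM : measurable_fun setT etaM.
Proof.
by apply: measurable_fun_mx => i j; under eq_fun do rewrite mxE; exact: measurable_funP.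
Qed.

Lemma eta_mbox (A : 'I_k -> 'I_l -> set R) : (forall i j, measurable (A i j)) ->
  (P' (etaM @^-1` mbox A) = \prod_(i < k) \prod_(j < l)
    \int[@lebesgue_measure R]_(x in A i j) (q_gaussian_density q x)%:E)%E.
Proof.
move=> mA; have := eta_indep [set: 'I_k * 'I_l]%SET (fun ij => mA ij.1 ij.2).
rewrite (_ : \bigcap_(_ in _) _ = etaM @^-1` mbox A); last first.
  apply/seteqP; split=> [w h i j|w h [i j] _ /=].
    by rewrite mxE; apply: (h (i, j)); rewrite /= inE.
  by have := h i j; rewrite mxE.
move=> ->; rewrite pair_bigA /=.
rewrite [LHS](eq_bigl xpredT); last by move=> ij; rewrite inE.
by apply: eq_bigr => ij _; exact: (eta_law _ _ (mA ij.1 ij.2)).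
Qed.

(** It suffices to compare boxes. A box for the corner extends to a box of the full matrix by whole
    lines, each contributing a factor 1 by [g1]. *)
Lemma corner_law m n (gam : probability 'M[R]_(m, n) R) : (k <= m)%N -> (l <= n)%N ->
  gauss_law q gam -> forall A, measurable A ->
  gam (@corner R k l m n @^-1` A) = P' (etaM @^-1` A).
Proof.
move=> km ln hgam A mA.
pose p1 : {measure set 'M[R]_(k, l) -> \bar R} :=
  measure_function_pushforward__canonical__measure_function_Measure gam
    (@measurable_corner R k l m n).
pose p2 : {measure set 'M[R]_(k, l) -> \bar R} :=
  measure_function_pushforward__canonical__measure_function_Measure P' measurable_etaM.
apply: (@measure_mx_unique R k l p1 p2) => // [B mB|j]; last first.
  have mS : measurable (@corner R k l m n @^-1` mcube j).
    rewrite -[X in measurable X]setTI; apply: measurable_corner => //.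
    exact: measurable_mbox.
  exact: (le_lt_trans (probability_le1 gam mS) (ltry 1)).
rewrite [RHS]eta_mbox//.
pose B' (i : 'I_m) (j : 'I_n) : set R :=
  if insub (val i) is Some i' then
    if insub (val j) is Some j' then B i' j' else setT
  else setT.
transitivity (gam (mbox B')).
  congr (gam _); apply/seteqP; split=> [x Bx i j|x Bx i j].
    rewrite /B'; case: insubP => // i' i'k i'E; case: insubP => // j' j'l j'E.
    have := Bx i' j'; rewrite mxE.
    have -> : insub (val i') = Some i by rewrite i'E valK.
    by have -> : insub (val j') = Some j by rewrite j'E valK.
  have im : (i < m)%N by exact: leq_trans km.
  have jn : (j < n)%N by exact: leq_trans ln.
  have := Bx (Ordinal im) (Ordinal jn); rewrite /B' /= !valK mxE.
  by rewrite !insubT.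
have mB' i j : measurable (B' i j).
  by rewrite /B'; case: insubP => // i' _ _; case: insubP.
rewrite hgam; last exact: measurable_mbox.
rewrite (gauss_density_mbox q0 g1 mB').
rewrite -(prod_insub _ km); apply: eq_bigr => i _.
rewrite /B'; case: insubP => [i' _ _|_]; last by rewrite big1.
rewrite -(prod_insub _ ln); apply: eq_bigr => j _.
by case: insubP.
Qed.

Context (p : \bar R) (p0 : (0 < p)%E).

Lemma corner_expectation_close (F : 'M[R]_(k, l) -> R) (M e : R) :
  continuous F -> 0 <= M -> (forall x, `|F x| <= M) -> 0 < e ->
  exists N : nat, forall m n, (N <= n)%N -> (0 < n)%N -> (k <= m)%N -> (l <= n)%N ->
  forall mu : probability 'M[R]_(m, n) R, ball_law p q mu ->
  (`|\int[mu]_x (F (corner k l (scale_factor p q m n *: x)))%:E -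
     \int[P']_w (F (etaM w))%:E| <= e%:E)%E.
Proof.
move=> cF M0 FM e0.
have mF := continuous_measurable_mx cF.
(* Instability costs probability [e2], and bad ratios in [k] rows cost at most [k * e3 <= e2]. The
   total error is [e1 + 2 M (e2 + e2) <= 3 e1 = e]. The added 1 in the denominators keeps them
   positive when [M] or [k] is 0. *)
pose e1 := e / 3.
have e10 : 0 < e1 by rewrite divr_gt0.
pose e2 := e1 / (2 * M + 1).
have M1 : 0 < 2 * M + 1 by rewrite ltr_wpDl// mulr_ge0.
have e20 : 0 < e2 by rewrite divr_gt0.
have [d d0 dP] := unstable_small cF P' measurable_etaM e10 e20.
pose e3 := e2 / k.+1%:R.
have e30 : 0 < e3 by rewrite divr_gt0.
have [N HN] := ratio_concentration p0 q0 g1 d0 e30.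
exists N => m n Nn n0 km ln mu hmu.
have [gam hgam] := gauss_law_exists q0 g1 m n.
set c := scale_factor p q m n.
pose Q : probability ('M[R]_(m, n) * 'M[R]_(m, n))%type R := (mu \x gam)%E.
pose f (x : 'M[R]_(m, n)) := F (corner k l (c *: x)).
have mscale : measurable_fun setT (fun x : 'M[R]_(m, n) => c *: x).
  apply: measurable_fun_mx => i j; under eq_fun do rewrite mxE.
  by apply: measurable_funM => //; exact: measurable_coord.
have mf : measurable_fun setT f.
  apply: (measurableT_comp mF); apply: (measurableT_comp (@measurable_corner R k l m n)).
  exact: mscale.
pose ex (z : 'M[R]_(m, n) * 'M[R]_(m, n)) := exchange q z.1 z.2.
have mex : measurable_fun setT ex by exact: measurable_exchange.
(* Both expectations are moved to the product space, where the two corners can be compared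
   pointwise. *)
have -> : (\int[mu]_x (f x)%:E = \int[Q]_z (f (ex z))%:E)%E.
  apply: (@eq_law_integral _ _ _ _ _ _ _ mu Q id ex f M) => //.
    by move=> x; exact: FM.
  move=> A mA; apply/esym; exact: (exchange_ball_law q0 g1 n0 hmu hgam mA).
have msnd : measurable_fun setT (fun z : 'M[R]_(m, n) * 'M[R]_(m, n) => @corner R k l m n z.2).
  by apply: (measurableT_comp (@measurable_corner R k l m n)).
have sndE A : measurable A -> Q (snd @^-1` A) = gam A.
  move=> mA; rewrite (_ : snd @^-1` A = setT `*` A); last first.
    by apply/seteqP; split => [z|z []].
  transitivity (mu setT * gam A)%E; last by rewrite probability_setT mul1e.
  exact: product_measure1E.
have cornerE A : measurable A ->
    Q ((fun z => @corner R k l m n z.2) @^-1` A) = P' (etaM @^-1` A).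
  move=> mA; rewrite -(corner_law km ln hgam mA) -sndE//.
  by rewrite -[X in measurable X]setTI; exact: measurable_corner.
have -> : (\int[P']_w (F (etaM w))%:E = \int[Q]_z (F (@corner R k l m n z.2))%:E)%E.
  apply: (@eq_law_integral _ _ _ _ _ _ _ P' Q etaM _ F M) => //.
    exact: measurable_etaM.
  by move=> A mA; apply/esym; exact: cornerE.
pose D0 := (fun z : 'M[R]_(m, n) * 'M[R]_(m, n) => @corner R k l m n z.2) @^-1` unstable F e1 d.
have mD0 : measurable D0.
  by rewrite -[X in measurable X]setTI; apply: msnd => //; exact: measurable_unstable.
pose wi := widen_ord km.
pose Di (i : 'I_k) := [set z : 'M[R]_(m, n) * 'M[R]_(m, n) |
  d <= `|norm_ratio p q z.1 z.2 (wi i) - 1|].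
have mDi i : measurable (Di i).
  rewrite -[X in measurable X]setTI.
  apply: (measurable_fun_le (f := cst d)) => //.
  apply: measurableT_comp => //; apply: measurable_funB => //.
  exact: measurable_norm_ratio.
have [mDu PDu] := union_bound (P := Q) mDi (fun i => HN _ _ Nn n0 mu gam hmu hgam (wi i)).
set Du := \big[setU/set0]_i Di i in mDu PDu.
have mD : measurable (D0 `|` Du) by exact: measurableU.
have PD : (Q (D0 `|` Du) <= (e2 + e2)%:E)%E.
  apply: le_trans (measureU2 _ mD0 mDu) _; rewrite EFinD; apply: leeD.
    rewrite [leLHS](_ : _ = P' (etaM @^-1` unstable F e1 d)); first exact: ltW.
    exact: (cornerE _ (measurable_unstable cF e1 d)).
  apply: le_trans PDu _; rewrite lee_fin card_ord -(mulr_natr e3 k) /e3 -(mulrA e2).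
  by rewrite ler_piMr ?(ltW e20)// mulrC ler_pdivrMr// mul1r ler_nat.
have := @integral_close _ _ _ Q (f \o ex) (fun z => F (@corner R k l m n z.2)) M e1 (e2 + e2)
  (D0 `|` Du) (measurableT_comp mf mex) (measurableT_comp mF msnd) mD M0
  (fun z => FM _) (fun z => FM _) (ltW e10) _ PD.
move=> /(_ _)/le_trans; apply.
- move=> z /not_orP[nD0 nDu].
  rewrite /f /ex /= scale_exchange corner_scale.
  set c' := (X in mx_scale X _); rewrite leNgt; apply/negP => h; apply: nD0.
  (* The row ratios themselves would witness instability of the corner of [z.2]. *)
  exists c' => // i; rewrite /c'.
  have -> : insub (val i) = Some (wi i) by rewrite -[val i]/(val (wi i)) valK.
  rewrite ltNge; apply/negP => h2; apply: nDu.
  by rewrite /Du (bigD1 i)//=; left.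
- rewrite lee_fin /e2.
  have h : (2 * M) * (e1 / (2 * M + 1)) <= e1.
    by rewrite mulrA ler_pdivrMr// mulrC ler_wpM2l ?(ltW e10)// lerDl.
  have : e1 * 3 = e by rewrite /e1 divfK.
  lra.
Qed.

End corner_law.

(** * Convergence of the empirical measures *)

Section thickening.
Context {R : realType}.
Implicit Types A B : set R.

Lemma measurable_thickening A e : measurable (thickening A e).
Proof. by apply: open_measurable; apply: bigcup_open => a _; exact: ball_open. Qed.

Lemma thickening_thickening A e e' :
  thickening (thickening A e) e' `<=` thickening A (e + e').
Proof. by move=> x [y [a Aa ay] yx]; exists a => //; exact: ball_triangle yx. Qed.

End thickening.

Section cells.
Context {R : realType}.

Lemma measure_cells_le (m1 m2 : {measure set R -> \bar R}) (C : nat -> set R)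
    (K : nat) (h e t : R) (A : set R) :
  (forall s, measurable (C s)) -> trivIset setT C -> measurable A ->
  (forall s u v, C s u -> C s v -> `|u - v| < h) ->
  (forall s, (s < K)%N -> (m1 (C s) <= m2 (C s) + e%:E)%E) -> 0 <= e ->
  (m1 (~` \big[setU/set0]_(s < K) C s) <= t%:E)%E ->
  (m1 A <= m2 (thickening A h) + (K%:R * e + t)%:E)%E.
Proof.
move=> mC tC mA Ch m12 e0 m1T.
(* The union of the cells meeting A covers A up to the tail and is contained in
   the thickening of A. *)
pose F s := if `[< C s `&` A !=set0 >] then C s else set0.
have mF s : measurable (F s) by rewrite /F; case: ifP.
have FC s : F s `<=` C s by rewrite /F; case: ifP => _ // x [].
have tF : trivIset setT F.
  by move=> s s' _ _ [x [/FC Cs /FC Cs']]; apply: tC => //; exists x.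
have mU : measurable (\big[setU/set0]_(s < K) F s) by exact: bigsetU_measurable.
have mT : measurable (~` \big[setU/set0]_(s < K) C s).
  by apply: measurableC; exact: bigsetU_measurable.
apply: (@le_trans _ _ (m1 (\big[setU/set0]_(s < K) F s `|` ~` \big[setU/set0]_(s < K) C s))).
  apply: le_measure; rewrite ?inE//; first exact: measurableU.
  move=> x Ax; have [xC|xC] := pselect ((\big[setU/set0]_(s < K) C s) x); last by right.
  left; move: xC; rewrite -!bigcup_mkord => -[s sK Csx]; exists s => //.
  by rewrite /F; case: asboolP => // -[]; exists x.
apply: le_trans (measureU2 _ mU mT) _.
rewrite EFinD addeA; apply: leeD => //.
rewrite measure_bigsetU//.
apply: (@le_trans _ _ (\sum_(s < K) (m2 (F s) + e%:E))%E).
  apply: lee_sum => s _; rewrite /F; case: ifP => _; first exact: m12.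
  by rewrite !measure0 add0e lee_fin.
rewrite big_split /= -measure_bigsetU// sumEFin sumr_const card_ord mulr_natl.
rewrite leeD2r//; apply: le_measure; rewrite ?inE//; first exact: measurable_thickening.
move=> x; rewrite -bigcup_mkord => -[s sK]; rewrite /F; case: asboolP => // -[y [Cy Ay]] Cx.
by exists y => //; exact: Ch Cy Cx.
Qed.

(** Half-open, so that consecutive cells are disjoint without gaps and have differences strictly
    below [h], as an open thickening requires. *)
Definition cell (a h : R) (s : nat) : set R := `[a + s%:R * h, a + s.+1%:R * h[%classic.

Lemma measurable_cell a h s : measurable (cell a h s).
Proof. exact: measurable_itv. Qed.

Lemma cell_diam a h s u v : cell a h s u -> cell a h s v -> `|u - v| < h.
Proof.
rewrite /cell /= !in_itv /= -natr1 => /andP[u1 u2] /andP[v1 v2].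
by rewrite ltr_norml; apply/andP; split; lra.
Qed.

Lemma trivIset_cell a h : 0 < h -> trivIset setT (cell a h).
Proof.
move=> h0 s t _ _ [u []]; rewrite /cell /= !in_itv /= => /andP[s1 s2] /andP[t1 t2].
have H (i j : nat) : a + i%:R * h <= u -> u < a + j.+1%:R * h -> (i <= j)%N.
  move=> iu uj; have := le_lt_trans iu uj.
  by rewrite ltrD2l ltr_pM2r// ltr_nat.
by apply/eqP; rewrite eqn_leq !H.
Qed.

Lemma bigcup_cell a h K u : 0 < h -> a <= u -> u < a + K%:R * h ->
  (\big[setU/set0]_(s < K) cell a h s) u.
Proof.
move=> h0; elim: K => [|K IH] au uK; first by move: uK; rewrite mul0r addr0 ltNge au.
rewrite big_ord_recr /=; have [uK'|uK'] := ltP u (a + K%:R * h).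
  by left; exact: IH.
by right; rewrite /cell /= in_itv /= uK' uK.
Qed.

Lemma tail_small (m : probability R R) (e : R) : 0 < e ->
  exists2 M : R, 0 < M & (m [set t | M <= `|t|]%R <= e%:E)%E.
Proof.
move=> e0.
pose S (i : nat) : set R := [set t | i%:R <= `|t|].
have mS i : measurable (S i).
  rewrite -[X in measurable X]setTI.
  by apply: (measurable_fun_le (f := cst i%:R)) => //; exact: measurableT_comp.
have S0 : \bigcap_i S i = set0.
  apply/seteqP; split => // t /(_ (Num.truncn `|t|).+1 I).
  by rewrite /S /= leNgt truncnS_gt.
have Sf i : m (S i) \is a fin_num.
  rewrite ge0_fin_numE//; exact: le_lt_trans (probability_le1 m (mS i)) (ltry 1).
have nd : {homo S : i j / (i <= j)%N >-> (j <= i)%O}.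
  by move=> i j ij; apply/subsetPset => t; apply: le_trans; rewrite ler_nat.
have mS0 : measurable (\bigcap_i S i) by rewrite S0.
have S0oo : (m (S 0%N) < +oo)%E by rewrite -ge0_fin_numE.
have := @nonincreasing_cvg_mu _ _ _ m S S0oo mS mS0 nd.
rewrite S0 measure0 => /fine_cvgP[_].
(* The index [N.+1] instead of [N] keeps the threshold positive. *)
move=> /cvgrPdist_lt /(_ e e0) [N _ /(_ N.+1 (leqnSn N))] /=.
rewrite sub0r normrN => hN; exists N.+1%:R => //.
by rewrite -(fineK (Sf N.+1)) lee_fin; apply: ltW; apply: le_lt_trans hN; rewrite ler_norm.
Qed.

End cells.

Section empirical.
Context {R : realType} (m n : nat).
Implicit Types (x y : 'M[R]_(m, n)) (A : set R).

Lemma empirical_measureE x A : empirical_measure x A =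
  (((m * n)%:R^-1) * \sum_(ij : 'I_m * 'I_n) \1_A (x ij.1 ij.2))%:E.
Proof.
rewrite /empirical_measure EFinM; congr (_ * _)%E.
rewrite pair_bigA /= -sumEFin; apply: eq_bigr => ij _.
by rewrite diracE indicE.
Qed.

Lemma empirical_measure_exists x : {mx : {measure set R -> \bar R} |
  forall A, mx A = empirical_measure x A}.
Proof.
have [ms msE] : {ms : {measure set R -> \bar R} | forall A, ms A =
    (\sum_(ij : 'I_m * 'I_n) \1_A (x ij.1 ij.2))%:E}.
  elim: (index_enum _) => [|ij s [ms msE]].
    by exists mzero => A; rewrite big_nil.
  exists (measure_add (dirac (x ij.1 ij.2)) ms) => A.
  transitivity (\d_(x ij.1 ij.2) A + ms A)%E; first exact: measure_addE.
  by rewrite msE big_cons EFinD diracE indicE.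
have N0 : 0 <= (m * n)%:R^-1 :> R by rewrite invr_ge0.
exists (mscale (NngNum N0) ms) => A.
transitivity (((m * n)%:R^-1)%:E * ms A)%E => //.
by rewrite msE empirical_measureE EFinM.
Qed.

Definition far_fraction (d : R) x y : R :=
  (m * n)%:R^-1 * \sum_(ij : 'I_m * 'I_n) (d <= `|x ij.1 ij.2 - y ij.1 ij.2|)%R%:R.

(** An entry of [x] in [A] either has its partner in [y] within [d], hence in the thickening, or is
    counted by [far_fraction]. *)
Lemma empirical_measure_far d x y A : (empirical_measure x A <=
  empirical_measure y (thickening A d) + (far_fraction d x y)%:E)%E.
Proof.
rewrite !empirical_measureE -EFinD lee_fin -mulrDr ler_wpM2l ?invr_ge0//.
rewrite -big_split /=; apply: ler_sum => ij _; rewrite !indicE.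
case: (boolP (x _ _ \in A)) => [|_]; last by rewrite addr_ge0.
rewrite inE => Ax; have [h|h] := leP d `|x ij.1 ij.2 - y ij.1 ij.2|.
  by rewrite lerDr.
by rewrite addr0 mem_set//; exists (x ij.1 ij.2).
Qed.

Lemma le_empirical_measure x A B : A `<=` B ->
  (empirical_measure x A <= empirical_measure x B)%E.
Proof.
move=> AB; rewrite !empirical_measureE lee_fin ler_wpM2l ?invr_ge0//.
by apply: ler_sum => ij _; rewrite !indicE ler_nat; case: (boolP (_ \in A)) => //;
  rewrite inE => /AB Bx; rewrite mem_set.
Qed.

Lemma far_fraction0 d x y : (forall i j, `|x i j - y i j| < d) -> far_fraction d x y = 0.
Proof.
move=> xy; rewrite /far_fraction big1 ?mulr0// => ij _.
by rewrite leNgt xy.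
Qed.

(* Needed for measurability: a probability has junk values outside the
   measurable sets. *)
Lemma open_levy_prokhorov_gt (nu : {measure set R -> \bar R}) (e : R) :
  open [set x : 'M[R]_(m, n) | (e%:E < levy_prokhorov (empirical_measure x) nu)%E].
Proof.
rewrite openE => x /= ex.
(* Moving all entries by less than [d] changes the distance by at most [d]. With [d = (e1 - e) / 2],
   a distance at most [e] at [z] would force one at most [e + 2 d = e1] at [x]. *)
have [e1 ee1 e1x] : exists2 e1 : R, e < e1 &
    (e1%:E < levy_prokhorov (empirical_measure x) nu)%E.
  move: ex; case: levy_prokhorov => [r||]//.
    by rewrite lte_fin => er; exists ((e + r) / 2); rewrite ?lte_fin; lra.
  by move=> _; exists (e + 1); rewrite ?ltry//; lra.
pose d := (e1 - e) / 2.
have d0 : 0 < d by rewrite divr_gt0// subr_gt0.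
apply/nbhs_ballP; exists d => //= z [_ xz] /=.
rewrite ltNge; apply/negP => ze.
have : (levy_prokhorov (empirical_measure z) nu < (e + d)%:E)%E.
  by apply: le_lt_trans ze _; rewrite lte_fin ltrDl.
move=> /ereal_inf_lt[_ [e' [e'0 He'] <-]]; rewrite lte_fin => e'd.
have e'd1 : d + e' <= e1.
  have : d * 2 = e1 - e by rewrite divfK.
  lra.
have d'0 : 0 < d + e' by rewrite addr_gt0.
move: e1x; apply/negP; rewrite -leNgt.
apply: (@le_trans _ _ (d + e')%:E); last by rewrite lee_fin.
apply: ereal_inf_lbound; exists (d + e') => //; split => // A mA; split.
  apply: le_trans (empirical_measure_far d x z A) _.
  rewrite far_fraction0 ?adde0//.
  have [+ _] := He' _ (measurable_thickening A d) => /le_trans; apply.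
  apply: leeD; last by rewrite lee_fin lerDr ltW.
  apply: le_measure; rewrite ?inE; [exact: measurable_thickening..|].
  exact: thickening_thickening.
have [_ +] := He' _ mA => /le_trans; apply.
apply: leeD; last by rewrite lee_fin lerDr ltW.
apply: le_trans (empirical_measure_far d z x _) _.
rewrite far_fraction0 ?adde0; last by move=> i j; rewrite distrC; exact: xz.
rewrite addrC; apply: le_empirical_measure; exact: thickening_thickening.
Qed.

End empirical.

Section frequencies.
Context {R : realType} d (T : measurableType d) (P : probability T R) (I : finType).
Variables (A : I -> set T).
Hypothesis mA : forall i, measurable (A i).

Definition frequency (w : T) : R := #|I|%:R^-1 * \sum_i \1_(A i) w.

Lemma frequency_ge0 w : 0 <= frequency w.
Proof. by rewrite mulr_ge0 ?invr_ge0// sumr_ge0. Qed.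

Lemma measurable_frequency : measurable_fun setT frequency.
Proof.
apply: measurable_funM => //; apply: measurable_sum => i.
exact: measurable_indic.
Qed.

Lemma expectation_frequency :
  (\int[P]_w (frequency w)%:E = #|I|%:R^-1%:E * \sum_i P (A i))%E.
Proof.
under eq_integral do rewrite EFinM -sumEFin.
rewrite ge0_integralZl//; last 2 first.
- under eq_fun do rewrite sumEFin.
  by apply/measurable_EFinP; apply: measurable_sum => i; exact: measurable_indic.
- by move=> w _; rewrite sumEFin lee_fin sumr_ge0.
congr (_ * _)%E; rewrite ge0_integral_sum//; last first.
  by move=> i; apply/measurable_EFinP; exact: measurable_indic.
by apply: eq_bigr => i _; rewrite integral_indic// setIT.
Qed.

(** Meant for the events that an entry is displaced: entries of one row share the same ratio, so
    only a first-moment bound is available. *)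
Lemma frequency_markov (a e : R) : (0 < #|I|)%N ->
  (forall i, (P (A i) <= a%:E)%E) -> 0 < e ->
  (P [set w | e <= frequency w]%R <= (a / e)%:E)%E.
Proof.
move=> I0 PA e0.
have mS : measurable [set w | (e <= frequency w)%R].
  rewrite -[X in measurable X]setTI.
  by apply: (measurable_fun_le (f := cst e)) => //; exact: measurable_frequency.
have : (\int[P]_w (frequency w)%:E <= a%:E)%E.
  rewrite expectation_frequency muleC lee_pdivrMr ?ltr0n//.
  apply: (@le_trans _ _ (\sum_(i : I) a%:E)%E); first exact: lee_sum.
  by rewrite sumEFin sumr_const lee_fin mulr_natr.
have : (e%:E * P [set w | (e <= frequency w)%R] <= \int[P]_w (frequency w)%:E)%E.
  rewrite -integral_cst//.
  apply: (@le_trans _ _ (\int[P]_(w in [set w | (e <= frequency w)%R]) (frequency w)%:E)%E).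
    apply: ge0_le_integral => //.
    - by move=> w _; rewrite lee_fin ltW.
    - by apply: measurable_funTS; apply/measurable_EFinP; exact: measurable_frequency.
  apply: ge0_subset_integral => //.
  - by apply/measurable_EFinP; exact: measurable_frequency.
  - by move=> w _; rewrite lee_fin frequency_ge0.
move=> /le_trans h /h; rewrite EFinM lee_pdivlMr//.
by rewrite muleC.
Qed.

(** Sets [S] of size at most 2 encode a common probability [c] and pairwise independence. The bound
    is [density_chebyshev] with constant density 1. *)
Lemma frequency_chebyshev (c e : R) : (0 < #|I|)%N -> 0 <= c ->
  (forall S : {set I}, (#|S| <= 2)%N ->
     P (\bigcap_(i in [set` S]) A i) = (c ^+ #|S|)%:E) ->
  0 < e ->
  (P [set w | e <= `|frequency w - c|]%R <= ((#|I|%:R * e ^+ 2)^-1)%:E)%E.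
Proof.
move=> I0 c0 PA e0.
have N0 : #|I|%:R != 0 :> R by rewrite pnatr_eq0 -lt0n.
have PA1 i : P (A i) = c%:E.
  have := PA [set i]%SET; rewrite cards1 expr1 => /(_ isT) <-.
  congr (P _); apply/seteqP; split=> [w Ai k /=|w h]; first by rewrite inE => /eqP ->.
  by apply: h; rewrite /= inE.
have PA2 i j : i != j -> P (A i `&` A j) = (c ^+ 2)%:E.
  move=> ij; have := PA [set i; j]%SET; rewrite cards2 ij => /(_ (leqnn _)) <-.
  congr (P _); apply/seteqP; split=> [w [Ai Aj] k /=|w h].
    by rewrite !inE => /orP[] /eqP ->.
  by split; apply: h; rewrite /= !inE eqxx ?orbT.
have uG1 : (\int[P]_w (frequency w * cst 1 w)%:E = c%:E)%E.
  under eq_integral do rewrite mulr1.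
  rewrite expectation_frequency (eq_bigr (fun=> c%:E)) ?sumEFin ?sumr_const => [|i _]; last exact: PA1.
  by rewrite -EFinM -(mulr_natl c) mulKf.
(* In the squared sum each index contributes [c] on the diagonal and [c^2] for each of the other
   indices; the variance becomes [(c - c^2) / #|I|]. *)
pose a2 : R := #|I|%:R^-1 * (#|I|%:R^-1 * (#|I|%:R * (c + (#|I|%:R - 1) * c ^+ 2))).
have uG2 : (\int[P]_w (frequency w ^+ 2 * cst 1 w)%:E = a2%:E)%E.
  transitivity (\int[P]_w ((#|I|%:R^-1 * #|I|%:R^-1)%:E *
      \sum_(ij : I * I) (\1_(A ij.1 `&` A ij.2) w)%:E))%E.
    apply: eq_integral => w _; rewrite mulr1 sumEFin -EFinM; congr EFin.
    rewrite /frequency exprMn; congr (_ * _).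
    rewrite expr2 mulr_suml -(pair_bigA _ (fun i j => \1_(A i `&` A j) w)) /=.
    apply: eq_bigr => i _; rewrite mulr_sumr; apply: eq_bigr => j _.
    by rewrite indicI.
  rewrite ge0_integralZl//; last 2 first.
  - under eq_fun do rewrite sumEFin.
    apply/measurable_EFinP; apply: measurable_sum => ij; apply: measurable_indic.
    exact: measurableI.
  - by move=> w _; rewrite sumEFin lee_fin sumr_ge0.
  rewrite ge0_integral_sum//; last first.
    by move=> ij; apply/measurable_EFinP; apply: measurable_indic; exact: measurableI.
  rewrite /a2 mulrA [RHS]EFinM; congr (_ * _)%E.
  transitivity (\sum_(i : I) \sum_(j : I) P (A i `&` A j))%E.
    rewrite pair_bigA /=; apply: eq_bigr => ij _.
    by rewrite integral_indic ?setIT//; exact: measurableI.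
  transitivity (\sum_(i : I) (c + (#|I|%:R - 1) * c ^+ 2)%:E)%E; last first.
    by rewrite sumEFin sumr_const mulr_natl.
  apply: eq_bigr => i _; rewrite (bigD1 i)//= setIid PA1 EFinD; congr (_ + _)%E.
  rewrite (eq_bigr (fun=> (c ^+ 2)%:E)); last by move=> j; rewrite eq_sym => /PA2.
  rewrite sumEFin sumr_const; congr EFin; rewrite -(mulr_natl (c ^+ 2)); congr (_ * _).
  transitivity (#|I|.-1%:R : R); first by rewrite -(cardC1 i).
  by rewrite -[in RHS](prednK I0) -natr1 addrK.
have G1 : (\int[P]_w ((cst 1 w : R))%:E = 1)%E.
  rewrite (integral_cst P (@measurableT _ T) 1) mul1e; exact: probability_setT.
have := @density_chebyshev R _ _ P (cst 1) frequency c a2 c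
  (@measurable_cst _ _ _ _ setT (1 : R)) measurable_frequency (fun=> ler01) frequency_ge0 c0 G1 uG1 uG2 e e0.
rewrite (integral_cst P _ 1) ?mul1e; last first.
  rewrite -[X in measurable X]setTI.
  apply: (measurable_fun_le (f := cst e)) => //; apply: measurableT_comp => //.
  by apply: measurable_funB => //; exact: measurable_frequency.
move=> /le_trans; apply; rewrite lee_fin [leRHS]invfM ler_wpM2r ?invr_ge0 ?sqr_ge0//.
have c1 : c <= 1.
  have /card_gt0P[i _] := I0.
  by rewrite -lee_fin -(PA1 i); exact: probability_le1.
rewrite (_ : a2 - _ + _ = (c - c ^+ 2) / #|I|%:R); last by rewrite /a2; field.
rewrite ler_pdivrMr ?ltr0n// mulVf//.
by have := sqr_ge0 c; lra.
Qed.

End frequencies.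

Lemma measurable_levy_prokhorov_gt (R : realType) (nu : {measure set R -> \bar R})
    m n (c e : R) :
  measurable [set x : 'M[R]_(m, n) |
    (e%:E < levy_prokhorov (empirical_measure (c *: x)) nu)%E].
Proof.
have mscale : measurable_fun setT (fun x : 'M[R]_(m, n) => c *: x).
  apply: measurable_fun_mx => i j; under eq_fun do rewrite mxE.
  by apply: measurable_funM => //; exact: measurable_coord.
have := mscale measurableT _ (open_measurable_mx (@open_levy_prokhorov_gt R m n nu e)).
by rewrite setTI.
Qed.

Section levy_prokhorov_bound.
Context {R : realType} (m n : nat).

(** Half of [e] pays for passing between [x] and [y], the other half for comparing [y] with [nu]
    cell by cell. [K.+1] counts the cells and the remaining tail [T]. *)
Lemma levy_prokhorov_le (nu : {measure set R -> \bar R}) (x y : 'M[R]_(m, n))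
    (C : nat -> set R) (K : nat) (e t a : R) :
  (forall s, measurable (C s)) -> trivIset setT C ->
  (forall s u v, C s u -> C s v -> `|u - v| < e / 2) -> 0 < e -> 0 <= t -> 0 <= a ->
  (K.+1%:R * a + t <= e / 2) ->
  (forall s, (s < K)%N -> (empirical_measure y (C s) <= nu (C s) + a%:E)%E /\
     (nu (C s) <= empirical_measure y (C s) + a%:E)%E) ->
  let T := ~` \big[setU/set0]_(s < K) C s in
  (empirical_measure y T <= nu T + a%:E)%E -> (nu T <= t%:E)%E ->
  far_fraction (e / 2) x y <= e / 2 ->
  (levy_prokhorov (empirical_measure x) nu <= e%:E)%E.
Proof.
move=> mC tC Ch e0 t0 a0 eE yC T yT nuT xy.
have [my myE] := empirical_measure_exists y.
have sA (A : set R) : thickening (thickening A (e / 2)) (e / 2) `<=` thickening A e.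
  by rewrite {3}(splitr e); exact: thickening_thickening.
have xy' : far_fraction (e / 2) y x <= e / 2.
  apply: le_trans xy; rewrite /far_fraction; under eq_bigr do rewrite distrC.
  by [].
have KE : K.+1%:R * a = K%:R * a + a by rewrite -natr1 mulrDl mul1r.
apply: ereal_inf_lbound; exists e => //; split => // A mA; split.
- apply: le_trans (empirical_measure_far (e / 2) x y A) _.
  have mA' := measurable_thickening A (e / 2).
  have mT : (my T <= (a + t)%:E)%E.
    by rewrite myE; apply: le_trans yT _; rewrite addrC EFinD; apply: leeD.
  have := @measure_cells_le R my nu C K (e / 2) a (a + t) _ mC tC mA' Ch _ a0 mT.
  rewrite myE => /(_ _)/le_trans h.
  rewrite [in leRHS](splitr e) EFinD addeA; apply: leeD; last by rewrite lee_fin.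
  apply: h => [s sK|]; first by rewrite myE; have [] := yC s sK.
  apply: leeD; last by rewrite lee_fin; lra.
  apply: le_measure; rewrite ?inE; [exact: measurable_thickening..|].
  exact: thickening_thickening.
- have := @measure_cells_le R nu my C K (e / 2) a t _ mC tC mA Ch _ a0 nuT.
  rewrite myE => /(_ _)/le_trans; apply.
    by move=> s sK; rewrite myE; have [] := yC s sK.
  apply: (@le_trans _ _ (empirical_measure x (thickening A e) + (e / 2)%:E + (e / 2)%:E)%E).
    apply: leeD; last by rewrite lee_fin; lra.
    apply: le_trans (empirical_measure_far (e / 2) y x _) _.
    apply: leeD; last by rewrite lee_fin.
    apply: le_empirical_measure; exact: sA.
  by rewrite -addeA -EFinD -splitr.
Qed.

End levy_prokhorov_bound.

Section empirical_concentration.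
Context {R : realType} (q : \bar R) (q0 : (0 < q)%E).
Context (nu : probability R R).
Hypothesis nuE : forall A, measurable A ->
  nu A = (\int[@lebesgue_measure R]_(x in A) (q_gaussian_density q x)%:E)%E.

Let g1 : (\int[@lebesgue_measure R]_x (q_gaussian_density q x)%:E = 1)%E.
Proof. by rewrite -nuE// probability_setT. Qed.

Lemma gauss_law_coords m n (gam : probability 'M[R]_(m, n) R) (B : set R)
    (S : {set 'I_m * 'I_n}) : gauss_law q gam -> measurable B ->
  gam (\bigcap_(ij in [set` S]) [set y : 'M[R]_(m, n) | B (y ij.1 ij.2)]) =
  (fine (nu B) ^+ #|S|)%:E.
Proof.
move=> hgam mB.
pose B' i j : set R := if (i, j) \in S then B else setT.
have mB' i j : measurable (B' i j) by rewrite /B'; case: ifP.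
rewrite (_ : \bigcap_(_ in _) _ = mbox B'); last first.
  apply/seteqP; split=> [y h i j|y h [i j] ij].
    by rewrite /B'; case: ifPn => // ij; exact: (h (i, j)).
  by have := h i j; rewrite /B' ifT.
rewrite hgam; last exact: measurable_mbox.
rewrite (gauss_density_mbox q0 g1 mB') pair_bigA /=.
have nuB : nu B \is a fin_num.
  rewrite ge0_fin_numE//; exact: le_lt_trans (probability_le1 nu mB) (ltry 1).
transitivity (\prod_(ij : 'I_m * 'I_n) ((if ij \in S then fine (nu B) else 1)%:E : \bar R))%E.
  apply: eq_bigr => -[i j] _ /=; rewrite -nuE// /B'.
  by case: ifP => _; [rewrite fineK|rewrite probability_setT].
by rewrite prodEFin -big_mkcond /= prodr_const.
Qed.

Lemma empirical_frequency m n (y : 'M[R]_(m, n)) (B : set R) :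
  empirical_measure y B =
  (frequency (fun (ij : 'I_m * 'I_n) => [set y : 'M[R]_(m, n) | B (y ij.1 ij.2)]) y)%:E.
Proof.
by rewrite empirical_measureE /frequency card_prod !card_ord.
Qed.

(** The entries are independent under [gam], so Chebyshev's inequality yields [1 / (m n e^2)];
    dropping [m >= 1] makes the bound uniform in [m]. *)
Lemma empirical_chebyshev m n (gam : probability 'M[R]_(m, n) R) (B : set R) (e : R) :
  (0 < m)%N -> (0 < n)%N -> gauss_law q gam -> measurable B -> 0 < e ->
  let S := [set y | (e%:E <= `|empirical_measure y B - nu B|)%E] in
  measurable S /\ (gam S <= ((n%:R * e ^+ 2)^-1)%:E)%E.
Proof.
move=> m0 n0 hgam mB e0 S.
have nuB : nu B \is a fin_num.
  rewrite ge0_fin_numE//; exact: le_lt_trans (probability_le1 nu mB) (ltry 1).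
pose A (ij : 'I_m * 'I_n) := [set y : 'M[R]_(m, n) | B (y ij.1 ij.2)].
have mA ij : measurable (A ij).
  rewrite -[X in measurable X]setTI; exact: (measurable_coord ij.1 ij.2).
have SE : S = [set y | e <= `|frequency A y - fine (nu B)|].
  by apply/seteqP; split => y; rewrite /S /= empirical_frequency -(fineK nuB) -EFinB lee_fin.
rewrite SE; split.
  rewrite -[X in measurable X]setTI.
  apply: (measurable_fun_le (f := cst e)) => //; apply: measurableT_comp => //.
  by apply: measurable_funB => //; exact: measurable_frequency.
have c0 : 0 <= fine (nu B) by exact: fine_ge0.
have I0 : (0 < #|{: 'I_m * 'I_n}|)%N by rewrite card_prod !card_ord muln_gt0 m0.
apply: le_trans (frequency_chebyshev mA I0 c0 _ e0) _.
  by move=> T _; exact: gauss_law_coords.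
rewrite lee_fin lef_pV2 ?posrE ?mulr_gt0 ?exprn_gt0// ?ltr0n//.
by rewrite ler_wpM2r ?sqr_ge0// ler_nat card_prod !card_ord leq_pmull.
Qed.

End empirical_concentration.

Section empirical_coupling.
Context {R : realType} (p q : \bar R) (p0 : (0 < p)%E) (q0 : (0 < q)%E).
Context (nu : probability R R).
Hypothesis nuE : forall A, measurable A ->
  nu A = (\int[@lebesgue_measure R]_(x in A) (q_gaussian_density q x)%:E)%E.

Let g1 : (\int[@lebesgue_measure R]_x (q_gaussian_density q x)%:E = 1)%E.
Proof. by rewrite -nuE// probability_setT. Qed.

Definition coupling_far m n (d : R) : set ('M[R]_(m, n) * 'M[R]_(m, n)) :=
  [set z | d <= far_fraction d (scale_factor p q m n *: exchange q z.1 z.2) z.2].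

(** An entry is displaced by its ratio minus 1 times the Gaussian entry. A displacement of at least
    [d] needs a ratio off by [d / M] or an entry of size [M], and both are unlikely uniformly in the
    entry. *)
Lemma coupling_far_small (d e : R) : 0 < d -> 0 < e ->
  exists N : nat, forall m n, (N <= n)%N -> (0 < m)%N -> (0 < n)%N ->
  forall mu gam : probability 'M[R]_(m, n) R, ball_law p q mu -> gauss_law q gam ->
  measurable (@coupling_far m n d) /\ ((mu \x gam) (@coupling_far m n d) <= e%:E)%E.
Proof.
move=> d0 e0.
(* Markov's inequality at level [d] divides the probability bound for a single entry by [d]. *)
pose a := e * d.
have a20 : 0 < a / 2 by rewrite divr_gt0// mulr_gt0.
have [M M0 nuM] := tail_small nu a20.
have dM0 : 0 < d / M by rewrite divr_gt0.
have [N HN] := ratio_concentration p0 q0 g1 dM0 a20.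
exists N => m n Nn m0 n0 mu gam hmu hgam.
set c := scale_factor p q m n.
pose Q : probability ('M[R]_(m, n) * 'M[R]_(m, n))%type R := (mu \x gam)%E.
pose A (ij : 'I_m * 'I_n) := [set z : 'M[R]_(m, n) * 'M[R]_(m, n) |
  d <= `|(norm_ratio p q z.1 z.2 ij.1 - 1) * z.2 ij.1 ij.2|].
have msnd ij : measurable_fun setT
    (fun z : 'M[R]_(m, n) * 'M[R]_(m, n) => z.2 ij.1 ij.2 : R).
  by apply: (measurableT_comp (@measurable_coord R m n ij.1 ij.2)).
have mratio ij : measurable_fun setT
    (fun z : 'M[R]_(m, n) * 'M[R]_(m, n) => norm_ratio p q z.1 z.2 ij - 1).
  by apply: measurable_funB => //; exact: measurable_norm_ratio.
have mA ij : measurable (A ij).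
  rewrite -[X in measurable X]setTI.
  apply: (measurable_fun_le (f := cst d)) => //; apply: measurableT_comp => //.
  exact: measurable_funM.
have QA ij : (Q (A ij) <= a%:E)%E.
  pose B1 := [set z : 'M[R]_(m, n) * 'M[R]_(m, n) |
    d / M <= `|norm_ratio p q z.1 z.2 ij.1 - 1|].
  pose B2 := [set z : 'M[R]_(m, n) * 'M[R]_(m, n) | M <= `|z.2 ij.1 ij.2|].
  have mB1 : measurable B1.
    rewrite -[X in measurable X]setTI.
    by apply: (measurable_fun_le (f := cst (d / M))) => //; exact: measurableT_comp.
  have mB2 : measurable B2.
    rewrite -[X in measurable X]setTI.
    by apply: (measurable_fun_le (f := cst M)) => //; exact: measurableT_comp.
  apply: (@le_trans _ _ (Q (B1 `|` B2))).
    apply: le_measure; rewrite ?inE//; first exact: measurableU.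
    move=> z; rewrite /A /= normrM => dz.
    have [h1|h1] := leP (d / M) `|norm_ratio p q z.1 z.2 ij.1 - 1|; first by left.
    have [h2|h2] := leP M `|z.2 ij.1 ij.2|; first by right.
    exfalso; move: dz; apply/negP; rewrite -ltNge.
    have -> : d = d / M * M by rewrite divfK// gt_eqF.
    exact: ltr_pM.
  apply: le_trans (measureU2 _ mB1 mB2) _.
  rewrite [a]splitr EFinD; apply: leeD; first exact: (HN _ _ Nn n0 mu gam hmu hgam).
  pose B := [set t : R | M <= `|t|].
  have mB : measurable B.
    rewrite -[X in measurable X]setTI.
    by apply: (measurable_fun_le (f := cst M)) => //; exact: measurableT_comp.
  have mC : measurable [set y : 'M[R]_(m, n) | B (y ij.1 ij.2)].
    rewrite -[X in measurable X]setTI; exact: (measurable_coord ij.1 ij.2).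
  have nuB : nu B \is a fin_num.
    rewrite ge0_fin_numE//; exact: le_lt_trans (probability_le1 nu mB) (ltry 1).
  apply: le_trans nuM; rewrite -[leRHS]/(nu B).
  rewrite [leLHS](_ : _ = gam [set y : 'M[R]_(m, n) | B (y ij.1 ij.2)]); last first.
    rewrite (_ : B2 = setT `*` [set y : 'M[R]_(m, n) | B (y ij.1 ij.2)]); last first.
      by apply/seteqP; split => [z|z []].
    transitivity (mu setT * gam [set y : 'M[R]_(m, n) | B (y ij.1 ij.2)])%E.
      exact: product_measure1E.
    by rewrite probability_setT mul1e.
  have := gauss_law_coords q0 nuE [set ij]%SET hgam mB.
  rewrite cards1 expr1 fineK// => <-.
  rewrite le_eqVlt; apply/orP; left; apply/eqP; congr (gam _).
  apply/seteqP; split=> [y By k /=|y h]; first by rewrite inE => /eqP ->.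
  by apply: h; rewrite /= inE.
have FE (z : 'M[R]_(m, n) * 'M[R]_(m, n)) :
    far_fraction d (c *: exchange q z.1 z.2) z.2 = frequency A z.
  rewrite /far_fraction /frequency card_prod !card_ord; congr (_ * _).
  apply: eq_bigr => ij _; rewrite indicE scale_exchange mxE.
  rewrite -[X in _ - X]mul1r -mulrBl; congr ((nat_of_bool _)%:R); apply/idP/idP.
    by move=> h; rewrite inE.
  by rewrite inE.
have -> : @coupling_far m n d = [set z | d <= frequency A z].
  by apply/seteqP; split => z; rewrite /coupling_far /= FE.
split.
  rewrite -[X in measurable X]setTI.
  by apply: (measurable_fun_le (f := cst d)) => //; exact: measurable_frequency.
have I0 : (0 < #|{: 'I_m * 'I_n}|)%N by rewrite card_prod !card_ord muln_gt0 m0.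
have -> : e = a / d by rewrite mulfK// gt_eqF.
exact: (frequency_markov mA I0 QA d0).
Qed.

Lemma empirical_levy_prokhorov (e e' : R) : 0 < e -> 0 < e' ->
  exists N : nat, forall m n, (N <= n)%N -> (0 < m)%N -> (0 < n)%N ->
  forall mu : probability 'M[R]_(m, n) R, ball_law p q mu ->
  (mu [set x | (e%:E < levy_prokhorov
     (empirical_measure (scale_factor p q m n *: x)) nu)%E] <= e'%:E)%E.
Proof.
move=> e0 e'0.
have h0 : 0 < e / 2 by rewrite divr_gt0.
have t0 : 0 < e / 4 by rewrite divr_gt0.
have e'20 : 0 < e' / 2 by rewrite divr_gt0.
(* [K] cells of width [e / 2] starting at [- M] cover the values of modulus below [M], so the tail
   [T] has [nu]-mass at most [e / 4]. The choice of [a] makes [K.+1 * a = e / 4], which completes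
   the budget [e / 2]. *)
have [M M0 nuM] := tail_small nu t0.
pose K := (Num.truncn (2 * M / (e / 2))).+1.
have KM : 2 * M < K%:R * (e / 2) by rewrite -ltr_pdivrMr// truncnS_gt.
pose a := e / 4 / K.+1%:R.
have a0 : 0 < a by rewrite divr_gt0.
have aE : K.+1%:R * a + e / 4 <= e / 2.
  by rewrite /a mulrCA mulfV// mulr1; lra.
pose C := cell (- M) (e / 2).
pose T := ~` \big[setU/set0]_(s < K) C s.
have mC s : measurable (C s) by exact: measurable_cell.
have mT : measurable T by apply: measurableC; exact: bigsetU_measurable.
have nuT : (nu T <= (e / 4)%:E)%E.
  apply: le_trans nuM; apply: le_measure; rewrite ?inE//.
    rewrite -[X in measurable X]setTI.
    by apply: (measurable_fun_le (f := cst M)) => //; exact: measurableT_comp.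
  move=> t Tt /=; rewrite leNgt; apply/negP => tM; apply: Tt.
  move: tM; rewrite ltr_norml => /andP[t1 t2].
  by apply: bigcup_cell => //; [exact: ltW|lra].
(* The tail is appended as a last cell, so that one union bound covers all required comparisons. *)
pose D (s : 'I_K.+1) := if (s < K)%N then C s else T.
have mD s : measurable (D s) by rewrite /D; case: ifP.
have [N1 HN1] := coupling_far_small h0 e'20.
pose b := e' / 2 / K.+1%:R.
have b0 : 0 < b by rewrite divr_gt0.
(* From [N2] on, the Chebyshev bound [1 / (n a^2)] is at most [b], and [K.+1 * b = e' / 2]. *)
pose N2 := (Num.truncn (a ^+ 2 * b)^-1).+1.
exists (maxn N1 N2) => m n; rewrite geq_max => /andP[Nn1 Nn2] m0 n0 mu hmu.
have [gam hgam] := gauss_law_exists q0 g1 m n.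
pose Q : probability ('M[R]_(m, n) * 'M[R]_(m, n))%type R := (mu \x gam)%E.
have [mF QF] := HN1 m n Nn1 m0 n0 mu gam hmu hgam.
set c := scale_factor p q m n.
pose G s := [set y : 'M[R]_(m, n) | (a%:E <= `|empirical_measure y (D s) - nu (D s)|)%E].
have HG s : measurable (G s) /\ (gam (G s) <= b%:E)%E.
  have [mG gG] := empirical_chebyshev q0 nuE m0 n0 hgam (mD s) a0.
  split => //; apply: le_trans gG _; rewrite lee_fin.
  rewrite -[b]invrK lef_pV2 ?posrE ?invr_gt0 ?mulr_gt0 ?exprn_gt0 ?ltr0n//.
  rewrite -ler_pdivrMr ?exprn_gt0// -invfM mulrC.
  by apply: (@le_trans _ _ N2%:R); [exact: ltW (truncnS_gt _)|rewrite ler_nat].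
pose E s := [set z : 'M[R]_(m, n) * 'M[R]_(m, n) | G s z.2].
have EE s : E s = setT `*` G s by apply/seteqP; split => [z|z []].
have mE s : measurable (E s) by rewrite EE; apply: measurableX => //; exact: (HG s).1.
have QE s : (Q (E s) <= b%:E)%E.
  apply: le_trans (HG s).2; rewrite EE.
  rewrite [leLHS](_ : _ = mu setT * gam (G s))%E; last exact: (product_measure1E _ _ _ (HG s).1).
  by rewrite probability_setT mul1e.
have [mEu QEu] := union_bound mE QE.
set Eu := \big[setU/set0]_s E s in mEu QEu.
pose S := [set x : 'M[R]_(m, n) | (e%:E < levy_prokhorov (empirical_measure (c *: x)) nu)%E].
have mS : measurable S by exact: measurable_levy_prokhorov_gt.
rewrite -[leLHS]/(mu S) -(exchange_ball_law q0 g1 n0 hmu hgam mS).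
apply: (@le_trans _ _ (Q (coupling_far (e / 2) `|` Eu))).
  apply: le_measure; rewrite ?inE.
  - rewrite -[X in measurable X]setTI.
    exact: (@measurable_exchange R q m n measurableT _ mS).
  - exact: measurableU.
  move=> z Sz; have [|zF] := pselect (coupling_far (e / 2) z); first by left.
  have [|zE] := pselect (Eu z); first by right.
  exfalso; move: Sz; apply/negP; rewrite -leNgt.
  have near s : (`|empirical_measure z.2 (D s) - nu (D s)| < a%:E)%E.
    rewrite ltNge; apply/negP => hs; apply: zE.
    by rewrite /Eu (bigD1 s)//=; left.
  have near2 s : (empirical_measure z.2 (D s) <= nu (D s) + a%:E)%E /\
      (nu (D s) <= empirical_measure z.2 (D s) + a%:E)%E.
    have nuD : nu (D s) \is a fin_num.
      rewrite ge0_fin_numE//; exact: le_lt_trans (probability_le1 nu (mD s)) (ltry 1).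
    have := near s; rewrite empirical_measureE -(fineK nuD) -EFinB lte_fin.
    by rewrite -!EFinD !lee_fin ltr_norml => /andP[]; split; lra.
  apply: (levy_prokhorov_le (y := z.2) (C := C) (K := K) (t := e / 4) (a := a)) => //.
  - exact: trivIset_cell.
  - by move=> s u v; exact: cell_diam.
  - exact: ltW.
  - exact: ltW.
  - by move=> s sK; have := near2 (widen_ord (leqnSn K) (Ordinal sK)); rewrite /D /= sK.
  - by have [+ _] := near2 ord_max; rewrite /D /= ltnn.
  - by rewrite ltW// ltNge; apply/negP.
apply: le_trans (measureU2 _ mF mEu) _.
rewrite [e']splitr EFinD; apply: leeD => //.
apply: le_trans QEu _; rewrite lee_fin card_ord /b -(mulr_natr (_ / _)) divfK//.
Qed.

End empirical_coupling.

(** * The two limits *)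

Lemma cvg_fin_numP (R : realType) (u : (\bar R)^nat) (l : \bar R) : l \is a fin_num ->
  (forall n, u n \is a fin_num) ->
  (forall e : R, 0 < e -> exists N, forall n, (N <= n)%N -> (`|u n - l| <= e%:E)%E) ->
  u n @[n --> \oo] --> l.
Proof.
move=> lf uf h; rewrite -(fineK lf); apply/fine_cvgP; split; first exact: nearW.
apply/cvgrPdist_le => e e0; have [N HN] := h e e0.
exists N => // n /= /HN; rewrite -[u n]fineK// -{1}(fineK lf) -EFinB /= lee_fin.
by rewrite distrC.
Qed.

(** The alternative between fixed and growing [m] enters only here; all estimates are uniform in
    [m]. *)
Lemma eventually_ge (k : nat) (m : nat -> nat) :
  (exists2 m0, (k <= m0)%N & forall n, (0 < n)%N -> m n = m0) \/
          m n @[n --> \oo] --> \oo ->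
  exists N, forall n, (N <= n)%N -> (0 < n)%N -> (k <= m n)%N.
Proof.
case=> [[m0 km0 mE]|moo]; first by exists 0%N => n _ /mE ->.
have [|N _ HN] := moo [set j | (k <= j)%N]; first by exists k.
by exists N => n Nn _; exact: HN.
Qed.

Theorem theorem2 (R : realType) (p q : \bar R) (hp : (0 < p)%E) (hq : (0 < q)%E)
    (k l : nat) (hk : (0 < k)%N) (hl : (0 < l)%N)
    (m : nat -> nat) (m_gt0 : forall n, (0 < n)%N -> (0 < m n)%N)
    (hm : (exists2 m0, (k <= m0)%N & forall n, (0 < n)%N -> m n = m0) \/
          m n @[n --> \oo] --> \oo)
    (d : nat -> measure_display) (T : forall n, measurableType (d n))
    (P : forall n, probability (T n) R)
    (X : forall n, {RV (P n) >-> 'M[R]_(m n, n)})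
    (hX : forall n, (0 < n)%N -> uniform_on (X n) (@mixed_ball R p q (m n) n))
    (d' : measure_display) (T' : measurableType d') (P' : probability T' R)
    (eta : 'I_k -> 'I_l -> {RV P' >-> R})
    (eta_law : forall i j, q_gaussian q (eta i j))
    (eta_indep : mutually_independent (fun ij : 'I_k * 'I_l => eta ij.1 ij.2)) :
  let scaledX n w : 'M[R]_(m n, n) :=
    ((m n)%:R `^ 1/[p] * n%:R `^ 1/[q]) *: X n w in
  cvg_in_distribution P (fun n w => corner k l (scaledX n w))
    P' (fun w => \matrix_(i, j) eta i j w)
  /\
  cvg_in_probability_LP P (fun n w => empirical_measure (scaledX n w))
    (distribution P' (eta (Ordinal hk) (Ordinal hl))).
Proof.
move=> scaledX.
pose i0 := Ordinal hk; pose j0 := Ordinal hl.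
pose nu : probability R R := distribution P' (eta i0 j0).
have nuE A : measurable A ->
  nu A = (\int[@lebesgue_measure R]_(x in A) (q_gaussian_density q x)%:E)%E.
  exact: eta_law.
have g1 : (\int[@lebesgue_measure R]_x (q_gaussian_density q x)%:E = 1)%E.
  by rewrite -nuE// probability_setT.
pose mu n : probability 'M[R]_(m n, n) R := distribution (P n) (X n).
have hmu n : (0 < n)%N -> ball_law p q (mu n) by move=> n0 A mA; exact: hX.
split.
  move=> F cF [M FM].
  have M0 : 0 <= M by apply: le_trans (FM 0).
  have mF := continuous_measurable_mx cF.
  pose etaM w : 'M[R]_(k, l) := \matrix_(i, j) eta i j w.
  have metaM : measurable_fun setT etaM by exact: measurable_etaM.
  have mc n : measurable_fun setT
      (fun x : 'M[R]_(m n, n) => F (corner k l (scale_factor p q (m n) n *: x))).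
    apply: (measurableT_comp mF); apply: (measurableT_comp (@measurable_corner R k l (m n) n)).
    apply: measurable_fun_mx => i j; under eq_fun do rewrite mxE.
    by apply: measurable_funM => //; exact: measurable_coord.
  have EE n : ('E_(P n)[F \o (fun w => corner k l (scaledX n w))] =
      \int[mu n]_x (F (corner k l (scale_factor p q (m n) n *: x)))%:E)%E.
    rewrite unlock; apply/esym.
    exact: (@eq_law_integral _ _ _ _ _ _ _ (mu n) (P n) id (X n)
      (fun x => F (corner k l (scale_factor p q (m n) n *: x))) M
      (@measurable_id _ _ setT) (@measurable_funPT _ _ _ _ (X n)) (mc n) (fun x => FM _)
      (fun A mA => erefl)).
  have E' : ('E_P'[F \o etaM] = \int[P']_w (F (etaM w))%:E)%E by rewrite unlock.
  apply: cvg_fin_numP.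
  - rewrite E'; apply: integrable_fin_num => //.
    exact: (bounded_measurable_integrable P' (measurableT_comp mF metaM) (fun=> FM _)).
  - move=> n; rewrite EE; apply: integrable_fin_num => //.
    exact: (bounded_measurable_integrable (mu n) (mc n) (fun=> FM _)).
  move=> e e0; have [N1 HN1] := corner_expectation_close hq eta_law eta_indep g1 hp cF M0 FM e0.
  have [N2 HN2] := eventually_ge hm.
  (* Including [l] ensures that the corner fits into the [n] columns, and also that [n > 0]. *)
  exists (maxn N1 (maxn N2 l)) => n; rewrite !geq_max => /and3P[n1 n2 ln].
  have n0 : (0 < n)%N by exact: leq_trans ln.
  rewrite EE E'; apply: HN1 => //; [exact: HN2|exact: hmu].
move=> e e0; rewrite -/i0 -/j0.
pose S n := [set x : 'M[R]_(m n, n) | (e%:E < levy_prokhorov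
     (empirical_measure (scale_factor p q (m n) n *: x)) nu)%E].
have mS n : measurable (S n) by exact: measurable_levy_prokhorov_gt.
(* The probability of the event is by definition the mass [mu n (S n)] under the law of [X n], so
   the original probability spaces disappear. *)
apply: (@cvg_fin_numP R (fun n => mu n (S n))) => // [n|e' e'0].
  by rewrite ge0_fin_numE//; exact: le_lt_trans (probability_le1 (mu n) (mS n)) (ltry 1).
have [N HN] := empirical_levy_prokhorov hp hq nuE e0 e'0.
exists (maxn N 1) => n; rewrite geq_max => /andP[Nn n0].
rewrite sube0 gee0_abs//; apply: HN => //; [exact: m_gt0|exact: hmu].
Qed.
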